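(* Fix an integer $m\ge 1$. For each $n$ let $A^1,\dots,A^m$ be independent $n\times n$ random matrices with entries $(A^k)_{ij}=a^k_{ij}$, where $(a^k_{ij})_{1\le i,j\le n,\ 1\le k\le m}$ are independent identically distributed random variables satisfying $\mathbb{E}[a^k_{ij}]=0$ and $\mathbb{E}[|a^k_{ij}|^2]=1$. Then for every $\epsilon>0$, with probability $1-o(1)$ as $n\to\infty$, all eigenvalues of the product matrix $n^{-m/2}A^1\cdots A^m$ lie in $(1+\epsilon)\mathbb{D}$, i.e. $$\rho\left(n^{-m/2}A^1\cdots A^m\right)\le 1+\epsilon .$$
   Context: The entries are complex-valued random variables whose common law does not depend on $n$; no moment assumption beyond the second moment is made. $\mathbb{D}=\{z\in\mathbb{C}:|z|<1\}$ is the unit disk and $\rho(\cdot)$ denotes the spectral radius (maximal modulus of an eigenvalue) of a square matrix. *)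

(* Defs.v *)
From HB Require Import structures.
From mathcomp Require Import all_boot all_order all_algebra.
From mathcomp Require Import all_classical all_reals all_analysis.
From mathcomp Require Import complex.

Set Implicit Arguments.
Unset Strict Implicit.
Unset Printing Implicit Defensive.

Import Order.TTheory GRing.Theory Num.Theory.
Import numFieldNormedType.Exports.

Local Open Scope classical_set_scope.
Local Open Scope ring_scope.
Local Open Scope complex_scope.

Definition complex_pair (R : realType) (z : R[i]) : R * R :=
  (complex.Re z, complex.Im z).

HB.instance Definition _ (R : realType) := isPointed.Build R[i] 0.

(* The sigma-algebra on R[i] is pulled back from the product (Borel)
   sigma-algebra of R * R along complex_pair, that is, it is the Borel
   sigma-algebra of the complex plane. *)
HB.instance Definition _ (R : realType) :=
  Measurable.copy R[i] (g_sigma_algebra_preimageType (@complex_pair R)).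

Section random_variables.
Context d d' (T : measurableType d) (T' : measurableType d') (R : realType).
Variable P : probability T R.

Definition has_law (X : {RV P >-> T'}) (mu : probability T' R) : Prop :=
  forall B, measurable B -> distribution P X B = mu B.

Definition mutually_independent (I : finType) (X : I -> {RV P >-> T'}) : Prop :=
  forall (J : {set I}) (B : I -> set T'), (forall i, measurable (B i)) ->
    P (\bigcap_(i in [set` J]) (X i @^-1` B i)) =
    (\prod_(i in J) P (X i @^-1` B i))%E.

End random_variables.

Section spectrum.
Variable R : realType.

Definition unit_disk : set R[i] := [set z | Normc.normc z < 1].

(* The supremum ranges over a finite set, which is nonempty when n > 0. *)
Definition spectral_radius n (M : 'M[R[i]]_n) : R :=
  sup [set Normc.normc z | z in [set z | eigenvalue M z]].

Definition scaled_product m n (A : 'I_m -> 'M[R[i]]_n) : 'M[R[i]]_n :=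
  (n%:R `^ (- (m%:R / 2)))%:C *: \prod_(k < m) A k.

End spectrum.

(* Main.v *)
Require Import Defs.
From HB Require Import structures.
From mathcomp Require Import all_boot all_order all_algebra all_fingroup.
From mathcomp Require Import all_classical all_reals all_analysis.
From mathcomp Require Import measurable_realfun.
From mathcomp Require Import complex.
From mathcomp Require Import zify ring lra.

(* Every eigenvalue of n^(-m/2) A^1 ... A^m is 1 / z^m for a zero z of
   P(z) = det (1 - z B), where B is the block-cyclic matrix of the A^k / sqrt n.
   The coefficients of P and of its permanental analogue Q(z) = per (1 + z B) are
   sums of orthogonal monomials, one for each partial permutation, so that their
   second moments grow polynomially in the degree. For truncated entries, a pair
   of partial permutations in which some cycle of one is disjoint from the other
   can be toggled, which changes its sign: such pairs cancel in P Q, and the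
   surviving ones give each coefficient of P Q a variance O(1/n). The mean of P Q
   is the determinant of 1 - (kappa z^2 / n) J with J the block-cyclic matrix of
   ones and kappa the mean of the squared entry, hence is bounded below on |z| <= r < 1.
   Truncation costs little in L^2, so P has no zero in |z| <= r with probability
   tending to one. *)

Set Implicit Arguments.
Unset Strict Implicit.
Unset Printing Implicit Defensive.

Import Order.TTheory GRing.Theory Num.Theory.
Import numFieldNormedType.Exports.

Local Open Scope ring_scope.

(** * Partial permutations *)

Section PartialPermutations.
Variables (C : numFieldType) (V : finType).
Implicit Types (w : {set V} * {perm V}) (y : V -> V -> C).

(** In general the coefficient of degree k of P keeps a variance of order one, so P cannot be
    compared with its mean. The factor Q removes this fluctuation: by MacMahon's master theorem 1 /
    P is a sum of permanents of B with rows and columns repeated, and Q keeps the terms without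
    repetition, so that Q imitates 1 / P up to collisions. Only one property of Q matters at the
    end: a zero of P is a zero of P Q. The covariances of the coefficients of P Q involve fourth
    powers of entries, hence the truncation. Writing P' and Q' for truncated entries, a zero of P is
    a zero of P Q' = P' Q' + (P - P') Q'; the first term concentrates, and the second needs only
    second moments of P - P' and of Q'. These second moments are bounded uniformly in n and in the
    truncation level, whereas the variance of P' Q' has a constant that grows with the level. This
    dictates the order of choices: the degree beyond which coefficients are bounded crudely, then
    the level, then n. *)

Definition pperm_of_size k w := perm_on w.1 w.2 && (#|w.1| == k).

(** Each cycle of [w.2] on [w.1], fixed points included, contributes -1: this is -1 to the number of
    cycles. *)
Definition psign w : C := (-1) ^+ odd_perm w.2 * (-1) ^+ #|w.1|.

Definition pmono y w : C := \prod_(v in w.1) y v (w.2 v).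

Definition esum y k := \sum_(w | pperm_of_size k w) psign w * pmono y w.

Definition psum y k := \sum_(w | pperm_of_size k w) pmono y w.

End PartialPermutations.

(** In the Leibniz product, the rows that take the entry of [- z *: b] form the domain. The other
    rows take the entry of the identity, which forces the permutation to fix them. *)
Lemma det_sub_scale (C : numFieldType) N (b : 'M[C]_N) z :
  \det (1%:M - z *: b) = \sum_(k < N.+1) z ^+ k * esum b k.
Proof.
rewrite /determinant.
have E (s : 'S_N) : (-1) ^+ s * \prod_i (1%:M - z *: b) i (s i) =
    \sum_(D : {set 'I_N} | perm_on D s)
      z ^+ #|D| * (psign C (D, s) * pmono b (D, s)).
  under eq_bigr => i _ do rewrite !mxE addrC.
  rewrite bigA_distr big_distrr /= [RHS]big_mkcond /=; apply: eq_bigr => D _.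
  rewrite (bigID (fun i => i \in D)) /=.
  under eq_bigr => i iD do rewrite iD -mulNr.
  rewrite [\prod_(i < N | i \notin D) _](eq_bigr (fun i => (i == s i)%:R)); last first.
    by move=> i /negbTE ->.
  rewrite big_split /= prodr_const.
  case: ifPn => Ds.
    have -> : \prod_(i < N | i \notin D) (i == s i)%:R = 1 :> C.
      by rewrite big1 // => i iD; rewrite (out_perm Ds) ?eqxx.
    have X4 (t u v x : C) : t * (u * v * x) = v * (t * u * x) by ring.
    by rewrite mulr1 (exprNn z) /psign /pmono /= X4.
  have /existsP[i /andP[iD si]] : [exists i, (i \notin D) && (s i != i)].
    apply: contraNT Ds => /existsPn H; apply/fintype.subsetP => i; rewrite inE => si.
    by have := H i; rewrite si andbT negbK.
  have -> : \prod_(i < N | i \notin D) (i == s i)%:R = 0 :> C.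
    by rewrite (bigD1 i) //= eq_sym (negbTE si) mul0r.
  by rewrite !mulr0.
under eq_bigr => s _ do rewrite E.
rewrite pair_big_dep /=.
rewrite (reindex (fun w : {set 'I_N} * 'S_N => (w.2, w.1))) /=; last first.
  by exists (fun w => (w.2, w.1)) => -[].
rewrite (partition_big (fun w : {set 'I_N} * 'S_N => inord #|w.1| : 'I_N.+1)
   predT) //=.
apply: eq_bigr => k _; rewrite /esum big_distrr /=.
have cardK (D : {set 'I_N}) : (inord #|D| == k :> 'I_N.+1) = (#|D| == k :> nat).
  by rewrite -(inj_eq val_inj) /= inordK // ltnS -[X in (_ <= X)%N]card_ord max_card.
rewrite [LHS](eq_bigl (fun w => pperm_of_size k w)); last first.
  by move=> w; rewrite cardK.
by apply: eq_bigr => -[D s] /andP[/= _ /eqP ->].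
Qed.

(** * Cycles of a permutation and their signs *)

Section Orbits.
Variable V : finType.
Implicit Types (p : {perm V}).

Lemma porbit_astabs p v : p \in ('N(porbit p v | 'P))%g.
Proof.
apply/astabsP => x /=; rewrite apermE -!eq_porbit_mem.
by rewrite -[p x]/((p ^+ 1)%g x) porbit_perm.
Qed.

Lemma porbit_stable p v x : (p x \in porbit p v) = (x \in porbit p v).
Proof. by have /astabsP /(_ x) := porbit_astabs p v. Qed.

Lemma restr_porbitE p v x :
  restr_perm (porbit p v) p x = if x \in porbit p v then p x else x.
Proof.
case: ifPn => xC; first by rewrite restr_permE ?porbit_astabs.
by rewrite (out_perm (restr_perm_on _ _)).
Qed.

(** The orbits of the restriction are the cycle and the singletons outside it, which gives its
    parity. A cycle thus contributes -1 to [psign] whatever its length. *)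
Lemma sign_restr_porbit p v (R : pzRingType) :
  (-1) ^+ odd_perm (restr_perm (porbit p v) p) * (-1) ^+ #|porbit p v| = -1 :> R.
Proof.
set Cc := porbit p v; set g := restr_perm Cc p.
have gX x i : x \in Cc -> (g ^+ i)%g x = (p ^+ i)%g x.
  move=> xC; elim: i => [|i IH]; first by rewrite !expg0.
  rewrite !expgSr !permM IH /g restr_porbitE.
  suff -> : (p ^+ i)%g x \in Cc by [].
  elim: i {IH} => [|i IH]; first by rewrite expg0 perm1.
  by rewrite expgSr permM porbit_stable.
have Po : porbits g = Cc |: [set [set x] | x in ~: Cc].
  apply/setP => A; rewrite !inE; apply/imsetP/orP.
    move=> [x _ ->]; have [xC|xC] := boolP (x \in Cc); [left|right].
      apply/eqP/setP => u; apply/porbitP/idP.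
        move=> [i ->]; rewrite gX //; elim: i => [|i IH]; first by rewrite expg0 perm1.
        by rewrite expgSr permM porbit_stable.
      rewrite -eq_porbit_mem => /eqP uC.
      have : u \in porbit p x.
        by rewrite -eq_porbit_mem uC eq_sym eq_porbit_mem.
      by move=> /porbitP [i ->]; exists i; rewrite gX.
    apply/imsetP; exists x; rewrite ?inE //; apply/setP => u; rewrite inE.
    apply/porbitP/eqP => [[i ->]|->]; last by exists 0%N; rewrite expg0 perm1.
    by rewrite permX_fix // /g restr_porbitE (negbTE xC).
  move=> [/eqP ->|/imsetP[x]]; last rewrite inE => xC ->.
    exists v => //; apply/setP => u; apply/porbitP/porbitP => -[i ->]; exists i;
      by rewrite gX // porbit_id.
  exists x => //; apply/setP => u; rewrite inE.
  apply/eqP/porbitP => [->|[i ->]]; first by exists 0%N; rewrite expg0 perm1.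
  by rewrite permX_fix // /g restr_porbitE (negbTE xC).
have cPo : #|porbits g| = (#|~: Cc|).+1.
  rewrite Po cardsU1 card_imset; last exact: finset.set1_inj.
  suff -> : Cc \notin [set [set x] | x in ~: Cc] by [].
  apply/negP => /imsetP[x]; rewrite inE => xC CE; move: xC.
  by rewrite CE set11.
rewrite -[(-1) ^+ #|_|]signr_odd /odd_perm cPo -(cardsC Cc) oddD /=.
by case: (odd #|Cc|); case: (odd #|~: Cc|);
  rewrite /= ?expr0 ?expr1 ?mulr1 ?mul1r.
Qed.

End Orbits.

Lemma prod_setU (C : comPzRingType) (V : finType) (A B : {set V}) (F : V -> C) :
  [disjoint A & B] ->
  \prod_(v in A :|: B) F v = \prod_(v in A) F v * \prod_(v in B) F v.
Proof.
move=> AB; rewrite (eq_bigl [predU A & B]) ?bigU // => v.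
by rewrite !inE.
Qed.

(** * The sign-reversing involution on pairs of partial permutations *)

Section Toggle.
Variable V : finType.
Let pair_of_pperms := (({set V} * {perm V}) * ({set V} * {perm V}))%type.
Implicit Types (q : pair_of_pperms) (v x : V).

Definition pperm_pair q := perm_on q.1.1 q.1.2 && perm_on q.2.1 q.2.2.

Definition pperm_pair_of_size k q :=
  pperm_pair q && (#|q.1.1| + #|q.2.1| == k)%N.

Let cyc q v := porbit (q.1.2 * q.2.2)%g v.

(** Cycles of the product of the two permutations are used, rather than cycles of each factor,
    because toggling preserves the product: the candidates for toggling are then the same before and
    after. On an isolated cycle one factor is the identity, so the product agrees with the other
    factor. *)
Definition isolated q v :=
  ((cyc q v \subset q.1.1) && [disjoint cyc q v & q.2.1]) ||
  ((cyc q v \subset q.2.1) && [disjoint cyc q v & q.1.1]).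

(** Inserting [g] and its inverse between the two permutations carries the cycle from one to the
    other and leaves their product unchanged. *)
Definition toggle_at q v : pair_of_pperms :=
  let g := restr_perm (cyc q v) (q.1.2 * q.2.2)%g in
  if cyc q v \subset q.1.1
  then ((q.1.1 :\: cyc q v, q.1.2 * g^-1), (q.2.1 :|: cyc q v, g * q.2.2))%g
  else ((q.1.1 :|: cyc q v, q.1.2 * g), (q.2.1 :\: cyc q v, g^-1 * q.2.2))%g.

Definition toggle q :=
  if pperm_pair q then
    if [pick v | isolated q v] is Some v then toggle_at q v else q
  else q.

Lemma toggle_at_prod q v :
  ((toggle_at q v).1.2 * (toggle_at q v).2.2 = q.1.2 * q.2.2)%g.
Proof. by rewrite /toggle_at; case: ifP => _ /=; rewrite ?mulgA mulgK || rewrite ?mulgA mulgKV. Qed.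

Section Fixed.
Variables (q : pair_of_pperms) (v : V).
Hypothesis qP : pperm_pair q.
Let D := q.1.1.
Let E := q.2.1.
Let s := q.1.2.
Let t := q.2.2.
Let p := (s * t)%g.
Let Cv := porbit p v.
Let g := restr_perm Cv p.

Let Ds : perm_on D s. Proof. by case/andP: qP. Qed.
Let Et : perm_on E t. Proof. by case/andP: qP. Qed.

Let gC x : x \in Cv -> g x = p x.
Proof. by move=> xC; rewrite /g restr_porbitE -/Cv xC. Qed.
Let gN x : x \notin Cv -> g x = x.
Proof. by move=> xC; rewrite /g restr_porbitE -/Cv (negbTE xC). Qed.
Let gVN x : x \notin Cv -> (g^-1)%g x = x.
Proof. by move=> xC; rewrite -{1}(gN xC) permK. Qed.
Let pC x : (p x \in Cv) = (x \in Cv). Proof. exact: porbit_stable. Qed.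

Lemma toggle_at1 : Cv \subset D -> [disjoint Cv & E] ->
  (forall x, (s * g^-1)%g x = if x \in Cv then x else s x) /\
  (forall x, (g * t)%g x = if x \in Cv then s x else t x).
Proof.
move=> CD CE.
have tC x : x \in Cv -> t x = x.
  by move=> xC; rewrite (out_perm Et) // (disjointFr CE).
have sp x : x \in Cv -> s x = p x.
  by move=> xC; apply: (@perm_inj _ t); rewrite [RHS]tC ?pC // /p permM.
have sN x : x \notin Cv -> s x \notin Cv.
  by move=> xC; apply: contra xC => sxC; rewrite -pC /p permM tC.
split=> x; rewrite permM; case: ifPn => xC.
- by rewrite sp // -gC // permK.
- by rewrite gVN // sN.
- by rewrite gC // tC ?pC // sp.
- by rewrite gN.
Qed.

Lemma toggle_at2 : Cv \subset E -> [disjoint Cv & D] ->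
  (forall x, (s * g)%g x = if x \in Cv then t x else s x) /\
  (forall x, (g^-1 * t)%g x = if x \in Cv then x else t x).
Proof.
move=> CE CD.
have sC x : x \in Cv -> s x = x.
  by move=> xC; rewrite (out_perm Ds) // (disjointFr CD).
have tp x : x \in Cv -> t x = p x by move=> xC; rewrite /p permM sC.
have sN x : x \notin Cv -> s x \notin Cv.
  move=> xC; apply: contra xC => sxC.
  by have /perm_inj <- := sC _ sxC.
have gV x : x \in Cv -> (g^-1)%g x \in Cv.
  move=> xC; apply/negPn/negP => gxC; move: (gN gxC); rewrite permKV => E'.
  by rewrite -E' xC in gxC.
split=> x; rewrite permM; case: ifPn => xC.
- by rewrite sC // gC // tp.
- by rewrite gN // sN.
- by rewrite tp ?gV // -gC ?gV // permKV.
- by rewrite gVN.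
Qed.

Hypothesis iso : isolated q v.

Lemma toggle_at_cases :
  (Cv \subset D /\ [disjoint Cv & E] /\
     toggle_at q v = ((D :\: Cv, s * g^-1), (E :|: Cv, g * t))%g) \/
  (Cv \subset E /\ [disjoint Cv & D] /\
     toggle_at q v = ((D :|: Cv, s * g), (E :\: Cv, g^-1 * t))%g).
Proof.
have [/andP[CD CE]|/andP[CE CD]] := orP iso; [left|right]; do 2 split => //.
  by rewrite /toggle_at ifT.
rewrite /toggle_at ifF //; apply/negP => /fintype.subsetP CD'.
by have := disjointFr CD (porbit_id p v); rewrite CD' // porbit_id.
Qed.

Lemma toggle_at_pperm : pperm_pair (toggle_at q v).
Proof.
have [[CD [CE ->]]|[CE [CD ->]]] := toggle_at_cases; rewrite /pperm_pair /=.
  have [E1 E2] := toggle_at1 CD CE.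
  apply/andP; split; apply/fintype.subsetP => x; rewrite !inE ?E1 ?E2; case: ifPn => xC.
  - by rewrite eqxx.
  - by move=> sx; apply: (fintype.subsetP Ds); rewrite inE.
  - by rewrite orbT.
  - by move=> tx; rewrite orbF; apply: (fintype.subsetP Et); rewrite inE.
have [E1 E2] := toggle_at2 CE CD.
apply/andP; split; apply/fintype.subsetP => x; rewrite !inE ?E1 ?E2; case: ifPn => xC.
- by rewrite orbT.
- by move=> sx; rewrite orbF; apply: (fintype.subsetP Ds); rewrite inE.
- by rewrite eqxx.
- by move=> tx; apply: (fintype.subsetP Et); rewrite inE.
Qed.

Lemma toggle_at_card :
  (#|(toggle_at q v).1.1| + #|(toggle_at q v).2.1| = #|D| + #|E|)%N.
Proof.
have [[CD [CE ->]]|[CE [CD ->]]] := toggle_at_cases => /=.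
  rewrite cardsD cardsU (finset.setIidPr CD) (disjoint_setI0 _) ?cards0 //; last by rewrite disjoint_sym.
  by have := subset_leq_card CD; lia.
rewrite cardsD cardsU (finset.setIidPr CE) (disjoint_setI0 _) ?cards0 //; last by rewrite disjoint_sym.
by have := subset_leq_card CE; lia.
Qed.

Lemma toggle_atK : toggle_at (toggle_at q v) v = q.
Proof.
have cycE : cyc (toggle_at q v) v = Cv by rewrite /cyc toggle_at_prod.
rewrite {1}/toggle_at cycE toggle_at_prod -/s -/t -/p -/g.
have [[CD [CE ->]]|[CE [CD ->]]] := toggle_at_cases => /=.
  rewrite ifF; last first.
    apply/negP => /fintype.subsetP /(_ v (porbit_id _ _)).
    by rewrite inE porbit_id.
  rewrite mulgKV mulKg.
  rewrite [q]surjective_pairing [q.1]surjective_pairing [q.2]surjective_pairing.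
  congr ((_, _), (_, _)); apply/setP => x; rewrite !inE; case: (boolP (x \in Cv)) => //= xC.
  - by rewrite (fintype.subsetP CD).
  - by rewrite orbF.
  - by rewrite (disjointFr CE).
  - by rewrite orbF.
rewrite ifT; last exact: finset.subsetUr.
rewrite mulgK mulKVg.
rewrite [q]surjective_pairing [q.1]surjective_pairing [q.2]surjective_pairing.
congr ((_, _), (_, _)); apply/setP => x; rewrite !inE; case: (boolP (x \in Cv)) => //= xC.
- by rewrite (disjointFr CD).
- by rewrite orbF.
- by rewrite (fintype.subsetP CE).
- by rewrite orbF.
Qed.

(** The toggled cycle changes sides and stays isolated; any other cycle of the product is disjoint
    from it and sees the same domains. The choice made by [pick] in [toggle] is therefore stable,
    which makes [toggle] an involution. *)
Lemma isolated_toggle_at : isolated (toggle_at q v) =1 isolated q.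
Proof.
move=> u; rewrite /isolated /cyc toggle_at_prod -/s -/t -/p.
have [uC|uC] := boolP (u \in Cv).
  have -> : porbit p u = Cv by apply/eqP; rewrite eq_porbit_mem.
  have dC A : [disjoint Cv & A :\: Cv].
    by apply/pred0P => x /=; rewrite !inE; case: (x \in Cv).
  have [[CD [CE ->]]|[CE [CD ->]]] := toggle_at_cases => /=.
    by rewrite -/D -/E CD CE /= finset.subsetUr dC orbT.
  by rewrite -/D -/E CD CE orbT finset.subsetUr dC.
have dis : [disjoint porbit p u & Cv].
  apply/pred0Pn => -[x /= /andP[xu xv]]; move/negP: uC; apply.
  by rewrite -eq_porbit_mem; rewrite -!eq_porbit_mem in xu xv; rewrite -(eqP xu) (eqP xv).
have subD A : (porbit p u \subset A :\: Cv) = (porbit p u \subset A).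
  by rewrite finset.subsetD dis andbT.
have subU A : (porbit p u \subset A :|: Cv) = (porbit p u \subset A).
  apply/idP/idP => [/fintype.subsetP H|H]; last exact: fintype.subset_trans (finset.subsetUl _ _).
  by apply/fintype.subsetP => x xu; move: (H _ xu); rewrite inE (disjointFr dis xu) orbF.
have disD A : [disjoint porbit p u & A :\: Cv] = [disjoint porbit p u & A].
  apply/idP/idP => /pred0P H; apply/pred0P => x /=; have := H x => /=; rewrite !inE;
  case: (boolP (x \in porbit p u)) => //= xu; rewrite (disjointFr dis xu) //.
have disU A : [disjoint porbit p u & A :|: Cv] = [disjoint porbit p u & A].
  apply/idP/idP => /pred0P H; apply/pred0P => x /=; have := H x => /=; rewrite !inE;
  case: (boolP (x \in porbit p u)) => //= xu; rewrite (disjointFr dis xu) ?orbF //.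
have [[CD [CE ->]]|[CE [CD ->]]] := toggle_at_cases => /=; by rewrite !(subD, subU, disD, disU).
Qed.

Lemma toggle_at_psign (C : numFieldType) :
  psign C (toggle_at q v).1 = - psign C q.1.
Proof.
have sg := sign_restr_porbit p v C; rewrite -/Cv -/g in sg.
have ee : (-1) ^+ #|Cv| * (-1) ^+ #|Cv| = 1 :> C.
  by rewrite -exprMn mulrNN mulr1 expr1n.
have sg' : (-1) ^+ odd_perm g = - (-1) ^+ #|Cv| :> C.
  by rewrite -[LHS]mulr1 -[X in _ * X = _]ee mulrA sg mulN1r.
have [[CD [CE ->]]|[CE [CD ->]]] := toggle_at_cases; rewrite /psign /= odd_permM signr_addb.
  rewrite odd_permV sg' -[#|q.1.1|](cardsID Cv) (finset.setIidPr CD) exprD -/D -/s.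
  by rewrite mulrN mulNr mulrA.
rewrite cardsU disjoint_setI0 1?disjoint_sym // cards0 subn0 exprD sg'.
by rewrite mulrN mulNr -!mulrA [X in _ * X]mulrCA ee mulr1.
Qed.

Lemma toggle_at_pmono (C : numFieldType) (y : V -> V -> C) :
  pmono y (toggle_at q v).1 * pmono y (toggle_at q v).2 =
  pmono y q.1 * pmono y q.2.
Proof.
have [[CD [CE ->]]|[CE [CD ->]]] := toggle_at_cases; rewrite /pmono /= -/D -/E -/s -/t.
  have [E1 E2] := toggle_at1 CD CE.
  rewrite (prod_setU (A := E) (B := Cv)); last by rewrite disjoint_sym.
  rewrite [in RHS](big_setID Cv) /= (finset.setIidPr CD).
  rewrite (eq_bigr (fun x => y x (s x))); last first.
    by move=> x; rewrite inE E1 => /andP[/negbTE ->].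
  rewrite [X in _ * (X * _) = _](eq_bigr (fun x => y x (t x))); last first.
    by move=> x xE; rewrite E2 (disjointFl CE xE).
  rewrite [X in _ * (_ * X) = _](eq_bigr (fun x => y x (s x))); last first.
    by move=> x xC; rewrite E2 xC.
  by rewrite mulrA mulrC mulrA.
have [E1 E2] := toggle_at2 CE CD.
rewrite (prod_setU (A := D) (B := Cv)); last by rewrite disjoint_sym.
rewrite [X in _ = _ * X](big_setID Cv) /= (finset.setIidPr CE).
rewrite (eq_bigr (fun x => y x (s x))); last first.
  by move=> x xD; rewrite E1 (disjointFl CD xD).
rewrite [X in (_ * X) * _ = _](eq_bigr (fun x => y x (t x))); last first.
  by move=> x xC; rewrite E1 xC.
rewrite [X in _ * X = _](eq_bigr (fun x => y x (t x))); last first.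
  by move=> x; rewrite inE E2 => /andP[/negbTE ->].
by rewrite mulrA.
Qed.

End Fixed.

Lemma toggle_pperm_pair q : pperm_pair (toggle q) = pperm_pair q.
Proof.
rewrite /toggle; case: (boolP (pperm_pair q)) => [qP|/negbTE -> //].
by case: pickP => [v iso|_] //; rewrite toggle_at_pperm.
Qed.

Lemma toggleK : involutive toggle.
Proof.
move=> q; rewrite {1}/toggle toggle_pperm_pair /toggle.
case: (boolP (pperm_pair q)) => // qP.
case Ev: [pick v | isolated q v] => [v|]; last by rewrite Ev.
have iso : isolated q v by move: Ev; case: pickP => // u ? [<-].
by rewrite (eq_pick (isolated_toggle_at iso)) Ev toggle_atK.
Qed.

(** Only the first component carries a sign. Toggling reverses it and keeps the monomial and the
    total size, so the sum equals its own opposite. *)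
Lemma sum_isolated_eq0 (C : numFieldType) (y : V -> V -> C) k :
  \sum_(q | pperm_pair_of_size k q && [exists v, isolated q v])
    psign C q.1 * (pmono y q.1 * pmono y q.2) = 0.
Proof.
set S := \sum_(q | _) _.
suff /eqP : S = - S.
  by rewrite -subr_eq0 opprK -mulr2n -mulr_natl mulf_eq0 pnatr_eq0 => /orP[|/eqP].
rewrite {1}/S (reindex_inj (inv_inj toggleK)) /= -sumrN.
have H q : pperm_pair_of_size k q && [exists v, isolated q v] ->
    exists2 v, isolated q v & toggle q = toggle_at q v.
  move=> /andP[/andP[qP _] /existsP[v iso]]; rewrite /toggle qP.
  by case: pickP => [u isou|/(_ v)]; [exists u | rewrite iso].
have H1 q : pperm_pair_of_size k q && [exists v, isolated q v] ->
    pperm_pair_of_size k (toggle q) && [exists v, isolated (toggle q) v].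
  move=> qP; have [v iso ->] := H _ qP; case/andP: qP => /andP[qP kq] _.
  rewrite /pperm_pair_of_size toggle_at_pperm // toggle_at_card // kq /=.
  by apply/existsP; exists v; rewrite isolated_toggle_at.
rewrite [LHS](eq_bigl (fun q => pperm_pair_of_size k q && [exists v, isolated q v])); last first.
  by move=> q; apply/idP/idP => /H1 //; rewrite toggleK.
apply: eq_bigr => q qP; have [v iso ->] := H _ qP.
case/andP: qP => /andP[qP kq] _.
by rewrite toggle_at_psign // toggle_at_pmono // mulNr.
Qed.

End Toggle.

(** * Counting pairs that survive the cancellation *)

Section Counting.
Variable V : finType.
Let pair_of_pperms := (({set V} * {perm V}) * ({set V} * {perm V}))%type.
Implicit Types (q : pair_of_pperms) (v x : V).

Definition unlinked k q := pperm_pair_of_size k q && ~~ [exists v, isolated q v].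

Lemma conv_esum_psum (C : numFieldType) (y : V -> V -> C) k :
  \sum_(i < k.+1) esum y i * psum y (k - i)%N =
  \sum_(q | unlinked k q) psign C q.1 * (pmono y q.1 * pmono y q.2).
Proof.
transitivity (\sum_(q | pperm_pair_of_size k q)
    psign C q.1 * (pmono y q.1 * pmono y q.2)).
  under eq_bigr => i _.
    rewrite /esum /psum big_distrlr pair_big_dep /=.
    under eq_bigr do rewrite -mulrA.
    over.
  rewrite [RHS](partition_big (fun q : pair_of_pperms => inord #|q.1.1| : 'I_k.+1) predT) //=.
  apply: eq_bigr => i _; apply: eq_bigl => q.
  rewrite /pperm_of_size /pperm_pair_of_size /pperm_pair.
  case: (perm_on _ _) => //=; case: (perm_on _ _); rewrite ?andbF //=.
  apply/andP/andP => -[/eqP E1 /eqP E2]; split; apply/eqP.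
  - by rewrite E1 E2 subnKC // -ltnS.
  - by rewrite E1 inord_val.
  - by rewrite -E2 inordK // -E1 ltnS leq_addr.
  - by rewrite -E2 inordK -?E1 ?addKn // ltnS leq_addr.
rewrite (bigID (fun q => [exists v, isolated q v])) /= sum_isolated_eq0 add0r.
by [].
Qed.

Definition multiplicity q (t : V * V) : nat :=
  ((t.1 \in q.1.1) && (q.1.2 t.1 == t.2)) + ((t.1 \in q.2.1) && (q.2.2 t.1 == t.2)).

Definition support q := q.1.1 :|: q.2.1.

Let degree q v : nat := (v \in q.1.1) + (v \in q.2.1).

(** Let x lie in D but not in E. The edge from x to [s x] occurs once in q, so q' must use it as
    well; if [s x] were in E, it would have degree two from q and at least one from q', which is
    excluded. Hence the product permutation preserves the difference of the domains, and a point
    there would lie on an isolated cycle. *)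
Let domains_eq q q' :
  pperm_pair q -> pperm_pair q' -> ~~ [exists v, isolated q v] ->
  (forall v, degree q v + degree q' v = 2 \/ degree q v + degree q' v = 0)%N ->
  (forall t, multiplicity q t + multiplicity q' t != 1)%N ->
  q.1.1 = q.2.1.
Proof.
case: q => -[D s] [E t]; case: q' => -[D' s'] [E' t'].
rewrite /pperm_pair /= => /andP[Ds Et] /andP[Ds' Et'] /existsPn /= niso deg mul.
pose p := (s * t)%g.
have orbit_in (A : {set V}) v : (forall x, x \in A -> p x \in A) -> v \in A ->
    porbit p v \subset A.
  move=> AP vA; apply/fintype.subsetP => x /porbitP[i ->].
  elim: i => [|i IH]; first by rewrite expg0 perm1.
  by rewrite expgSr permM AP.
have stepD x : x \in D :\: E -> p x \in D :\: E.
  rewrite inE => /andP[xE xD].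
  have sxD : s x \in D by rewrite perm_closed.
  have sxE : s x \notin E.
    have := mul (x, s x); have := deg (s x); rewrite /multiplicity /degree /= xD (negbTE xE) eqxx sxD /=.
    case: (boolP (x \in D')) => xD' /=; case: (boolP (x \in E')) => xE' //=.
    - case: (eqVneq (s' x) (s x)) => [<-|_]; first by rewrite (perm_closed _ Ds') xD'; case: (_ \in E) => //; case: (_ \in E') => -[].
      by case: (eqVneq (t' x) (s x)) => [<-|_] //; rewrite (perm_closed _ Et') xE'; case: (_ \in E) => //; case: (_ \in D') => -[].
    - by case: (eqVneq (s' x) (s x)) => [<-|_] //; rewrite (perm_closed _ Ds') xD'; case: (_ \in E) => //; case: (_ \in E') => -[].
    - by case: (eqVneq (t' x) (s x)) => [<-|_] //; rewrite (perm_closed _ Et') xE'; case: (_ \in E) => //; case: (_ \in D') => -[].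
  by rewrite /p permM (out_perm Et sxE) inE sxD sxE.
have stepE x : x \in E :\: D -> p x \in E :\: D.
  rewrite inE => /andP[xD xE].
  have txE : t x \in E by rewrite perm_closed.
  have txD : t x \notin D.
    have := mul (x, t x); have := deg (t x); rewrite /multiplicity /degree /= xE (negbTE xD) eqxx txE /=.
    case: (boolP (x \in D')) => xD' /=; case: (boolP (x \in E')) => xE' //=.
    - case: (eqVneq (s' x) (t x)) => [<-|_]; first by rewrite (perm_closed _ Ds') xD'; case: (_ \in D) => //; case: (_ \in E') => -[].
      by case: (eqVneq (t' x) (t x)) => [<-|_] //; rewrite (perm_closed _ Et') xE'; case: (_ \in D) => //; case: (_ \in D') => -[].
    - by case: (eqVneq (s' x) (t x)) => [<-|_] //; rewrite (perm_closed _ Ds') xD'; case: (_ \in D) => //; case: (_ \in E') => -[].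
    - by case: (eqVneq (t' x) (t x)) => [<-|_] //; rewrite (perm_closed _ Et') xE'; case: (_ \in D) => //; case: (_ \in D') => -[].
  by rewrite /p permM (out_perm Ds xD) inE txE txD.
have sep (A B S : {set V}) : S \subset A :\: B -> (S \subset A) && [disjoint S & B].
  by rewrite finset.subsetD.
apply/eqP; rewrite finset.eqEsubset; apply/andP; split; apply/fintype.subsetP => v vA;
  apply/negPn/negP => vB; have /negP := niso v; apply; rewrite /isolated /=.
  by rewrite sep //; apply: orbit_in => //; rewrite inE vA vB.
by rewrite [X in _ || X]sep ?orbT //; apply: orbit_in => //; rewrite inE vA vB.
Qed.

(** The degrees add up to 2k and are at least two on the union, so the union has at most k points.
    In case of equality all degrees on it are two, [domains_eq] makes the two domains of each pair
    coincide, and the tail of a shared edge would have degree four. The vertex gained here is the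
    source of the factor 1/n in the variance. *)
Lemma card_support_lt k q q' :
  unlinked k q -> unlinked k q' ->
  (forall t, multiplicity q t + multiplicity q' t != 1)%N ->
  (exists t, (0 < multiplicity q t) && (0 < multiplicity q' t))%N ->
  (#|support q :|: support q'| < k)%N.
Proof.
move=> /andP[/andP[qP /eqP kq] niso] /andP[/andP[qP' /eqP kq'] niso'] mul [[u v] /= /andP[uq uq']].
rewrite ltnNge; apply/negP => kU; set U := _ :|: _ in kU.
pose d x := (degree q x + degree q' x)%N.
have sumd : (\sum_x d x = k.*2)%N.
  have cardE (A : {set V}) : #|A| = (\sum_x (x \in A))%N.
    by rewrite -sum1_card big_mkcond /=; apply: eq_bigr => x _; case: (x \in A).
  by rewrite -addnn -[in X in _ = (X + _)%N]kq -kq' !big_split /= -!cardE.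
have dU x : x \notin U -> d x = 0%N.
  by rewrite !inE !negb_or /d /degree => /andP[/andP[/negbTE -> /negbTE ->] /andP[/negbTE -> /negbTE ->]].
(* An edge that leaves x must be repeated, and its repetition leaves x too. *)
have d2 x : x \in U -> (2 <= d x)%N.
  move=> xU; have := mul (x, q.1.2 x); have := mul (x, q.2.2 x).
  have := mul (x, q'.1.2 x); have := mul (x, q'.2.2 x).
  move: xU; rewrite /d /degree /multiplicity !inE /= !eqxx.
  case: (x \in q.1.1); case: (x \in q.2.1);
  case: (x \in q'.1.1); case: (x \in q'.2.1) => //=.
have d2E x : x \in U -> d x = 2%N.
  move=> xU; apply/eqP; rewrite eqn_leq d2 // andbT leqNgt; apply/negP => dx.
  suff : (\sum_x d x > k.*2)%N by rewrite sumd ltnn.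
  apply: (@leq_ltn_trans (\sum_(y in U) 2)%N).
    by rewrite sum_nat_const muln2 leq_double.
  rewrite [X in (_ < X)%N](bigID (fun y => y \in U)) /=.
  rewrite [X in (_ < _ + X)%N]big1 ?addn0; last exact: dU.
  rewrite (bigD1 x) //= [X in (_ < X)%N](bigD1 x) //= -addSn leq_add //.
  by apply: leq_sum => y /andP[yU _]; exact: d2.
have deg x : d x = 2%N \/ d x = 0%N.
  by have [xU|xU] := boolP (x \in U); [left; exact: d2E|right; exact: dU].
have DE : q.1.1 = q.2.1 by exact: (domains_eq qP qP').
have DE' : q'.1.1 = q'.2.1.
  apply: (domains_eq qP' qP) => // [x|t]; last by rewrite addnC.
  by have := deg x; rewrite /d addnC.
have : d u = 4%N.
  move: uq uq'; rewrite /d /degree /multiplicity /= DE DE'.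
  by case: (u \in q.2.1) => //; case: (u \in q'.2.1).
by case: (deg u) => ->.
Qed.

(** A set of fewer than k points is chosen in at most [k * #|V| ^ k.-1] ways; each of the four
    partial permutations is then a subset of it and a permutation of it. With [#|V|] equal to m n,
    this is one power of n below the normalization n^k. *)
Lemma card_quads k : (0 < #|V|)%N ->
  (#|[set qq : pair_of_pperms * pair_of_pperms |
       [&& pperm_pair qq.1, pperm_pair qq.2 &
           #|support qq.1 :|: support qq.2| < k]]|
   <= k * #|V| ^ k.-1 * (2 ^ k * k`!) ^ 4)%N.
Proof.
move=> V0; rewrite -sum1_card.
rewrite (partition_big (fun qq => support qq.1 :|: support qq.2)
   (fun U : {set V} => #|U| < k)%N) /=; last by move=> qq; rewrite inE => /and3P[].
apply: (@leq_trans (\sum_(U : {set V} | #|U| < k) (2 ^ k * k`!) ^ 4)%N).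
  apply: leq_sum => U Uk; rewrite sum1_card.
  pose W := finset.setX (powerset U) [set s | perm_on U s].
  apply: (@leq_trans #|finset.setX (finset.setX W W) (finset.setX W W)|).
    apply: subset_leq_card; apply/fintype.subsetP => -[[[D s] [E t]] [[D' s'] [E' t']]].
    rewrite [in X in X -> _]unfold_in => /andP[]; rewrite inE => /and3P[H H' _] /eqP EqU.
    rewrite /W !inE /= -EqU.
    have [/andP[/= Ds Et] /andP[/= Ds' Et']] := conj H H'.
    rewrite /support /=.
    have sub1 (A B F : {set V}) : A :|: B \subset F -> (A \subset F) /\ (B \subset F).
      by rewrite finset.subUset => /andP.
    have [H1 H2] := sub1 _ _ _ (fintype.subxx (D :|: E :|: (D' :|: E'))).
    have [DU EU] := sub1 _ _ _ H1; have [DU' EU'] := sub1 _ _ _ H2.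
    have on (A : {set V}) (r : {perm V}) : perm_on A r -> A \subset D :|: E :|: (D' :|: E') ->
        perm_on (D :|: E :|: (D' :|: E')) r.
      by move=> Ar AF; apply: fintype.subset_trans Ar AF.
    by rewrite DU EU DU' EU' (on _ _ Ds) ?(on _ _ Et) ?(on _ _ Ds') ?(on _ _ Et').
  rewrite !cardsX card_powerset.
  have -> : #|[set s | perm_on U s]| = (#|U|)`! by rewrite -card_perm cardsE.
  have : (2 ^ #|U| * (#|U|)`! <= 2 ^ k * k`!)%N.
    by rewrite leq_mul ?leq_pexp2l ?leq_fact // ltnW.
  have pow4 a : (a ^ 4 = a * a * (a * a))%N by rewrite !expnS expn0; lia.
  by move=> H; rewrite pow4 !(leq_mul H H, leq_mul).
rewrite sum_nat_const leq_mul2r; apply/orP; right.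
rewrite -sum1_card (partition_big (fun U : {set V} => inord #|U| : 'I_k.-1.+1) predT) //=.
case: k => [|k]; first by rewrite big1 // => i _; rewrite big_pred0 // => U; rewrite ltn0.
rewrite /= -[X in (_ <= X * _)%N]card_ord -sum_nat_const; apply: leq_sum => i _.
rewrite sum1_card.
apply: (@leq_trans #|[set U : {set V} | #|U| == i :> nat]|).
  apply: subset_leq_card; apply/fintype.subsetP => U; rewrite !inE => /andP[Uk /eqP <-].
  by rewrite inordK.
rewrite card_draws; apply: (@leq_trans (#|V| ^ i)%N); last by rewrite leq_pexp2l // -ltnS.
apply: (@leq_trans ('C(#|V|, i) * i`!)%N); first by rewrite leq_pmulr ?fact_gt0.
rewrite bin_ffact; elim: (i : nat) => [|j IH]; first by rewrite ffactn0 expn0.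
by rewrite ffactnSr expnSr leq_mul // leq_subr.
Qed.

End Counting.

(** * Block-cyclic matrices *)

(** For each block, list the positions of the images of the domain elements of that block. Since the
    permutation maps its domain onto itself, the images recover the domain, and their order then
    recovers the permutation. The lengths of the lists cost [k.+1 ^ m], their concatenation [n ^ k].
    A count blind to the blocks would give (m n)^k, and the factor m^k would ruin convergence for
    radii close to one. *)
Lemma card_block_pperms (V : finType) m n k (blk : V -> 'I_m) (pos : V -> 'I_n)
    (shift : 'I_m -> 'I_m) :
  injective (fun v => (blk v, pos v)) ->
  (#|[set w : {set V} * {perm V} | pperm_of_size k w &
        [forall v in w.1, blk (w.2 v) == shift (blk v)]]| <= k.+1 ^ m * n ^ k)%N.
Proof.
move=> inj; set S := [set w | _ & _].
pose L (w : {set V} * {perm V}) s := [seq pos (w.2 v) | v <- enum [set v in w.1 | blk v == s]].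
pose LL w := [seq L w s | s <- enum 'I_m].
have szL w s : size (L w s) = #|[set v in w.1 | blk v == s]|.
  by rewrite size_map -cardE.
have szLL w : w \in S -> size (flatten (LL w)) == k.
  rewrite inE => /andP[/andP[_ /eqP <-] _]; apply/eqP.
  rewrite size_flatten /shape -map_comp sumnE big_map big_enum /=.
  rewrite -[RHS]sum1_card (partition_big blk predT) //=; apply: eq_bigr => s _.
  by rewrite szL -sum1_card; apply: eq_bigl => v; rewrite inE.
(* An element of [S] supplies the default tuple of [insubd]; by [szLL] the default is never taken on
   [S]. *)
have [->|[w0 /szLL t0]] := finset.set_0Vmem S; first by rewrite cards0.
pose f (w : {set V} * {perm V}) : {ffun 'I_m -> 'I_k.+1} * k.-tuple 'I_n :=
  ([ffun s => inord (size (L w s))], insubd (Tuple t0) (flatten (LL w))).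
have finj : {in S &, injective f}.
  move=> [D s] [D' s'] wS wS' [/ffunP Esz Efl].
  have shapeE b : size (L (D, s) b) = size (L (D', s') b).
    have := Esz b; rewrite !ffunE => /(congr1 val) /=.
    have szk w : w \in S -> (size (L w b) < k.+1)%N.
      rewrite szL inE => /andP[/andP[_ /eqP <-] _]; rewrite ltnS.
      by apply: subset_leq_card; apply/fintype.subsetP => v; rewrite inE => /andP[].
    by rewrite !inordK // szk.
  have EL b : L (D, s) b = L (D', s') b.
    have : LL (D, s) = LL (D', s').
      apply: eq_from_flatten_shape.
        move: Efl => /(congr1 val) /=; rewrite !val_insubd.
        by rewrite (eqP (szLL _ wS)) (eqP (szLL _ wS')) eqxx.
      by rewrite /shape -!map_comp; apply: eq_map => c /=; rewrite shapeE.
    by move=> /eq_in_map /(_ b); apply; rewrite mem_enum.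
  move: wS wS'; rewrite !inE /= => /andP[/andP[/= Ds _] /forallP Db].
  move=> /andP[/andP[/= Ds' _] /forallP Db'].
  have Es b : [seq s v | v <- enum [set v in D | blk v == b]] =
              [seq s' v | v <- enum [set v in D' | blk v == b]].
    have E1 (B : {set V}) (r : {perm V}) :
        (forall v, (v \in B) ==> (blk (r v) == shift (blk v))) ->
        [seq (blk (r v), pos (r v)) | v <- enum [set v in B | blk v == b]] =
        [seq (shift b, p) | p <- L (B, r) b].
      move=> Bb; rewrite -map_comp; apply/eq_in_map => v.
      rewrite mem_enum inE => /andP[vB /eqP vb] /=.
      by have /implyP /(_ vB) /eqP -> := Bb v; rewrite vb.
    by apply: (inj_map inj); rewrite -!map_comp (E1 _ _ Db) (E1 _ _ Db') EL.
  have DD : D = D'.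
    have mem (B : {set V}) (r : {perm V}) : perm_on B r -> forall x,
        (x \in B) = [exists b : 'I_m, x \in [seq r v | v <- enum [set v in B | blk v == b]]].
      move=> Br x; apply/idP/existsP => [xB|[b /mapP[v]]].
        exists (blk ((r^-1)%g x)); apply/mapP; exists ((r^-1)%g x); last by rewrite permKV.
        by rewrite mem_enum inE eqxx andbT perm_closed // perm_onV.
      by rewrite mem_enum inE => /andP[vB _] ->; rewrite perm_closed.
    apply/setP => x; rewrite (mem _ _ Ds) (mem _ _ Ds').
    by apply: eq_existsb => b; rewrite Es.
  congr (_, _) => //; apply/permP => x.
  have [xD|xD] := boolP (x \in D); last first.
    by rewrite (out_perm Ds) // (out_perm Ds') // -DD.
  have := Es (blk x); rewrite -DD => /eq_in_map; apply.
  by rewrite mem_enum inE xD eqxx.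
rewrite -(card_in_imset finj); apply: leq_trans (max_card _) _.
by rewrite card_prod card_ffun card_tuple !card_ord.
Qed.

Section BlockCyclic.
Variables (C : numFieldType) (m n : nat).
Let VT : finType := ('I_m * 'I_n)%type.

Definition block_cyclic (A : 'I_m -> 'M[C]_n) : 'M[C]_#|{: VT}| :=
  \matrix_(u, v) if (enum_val v).1 == ordS (enum_val u).1
                 then A (enum_val u).1 (enum_val u).2 (enum_val v).2 else 0.

(** A row eigenvector v of the product propagates around the cycle: block s receives y^s v A_0 ...
    A_(s-1), and the relation y^m l = 1 closes the cycle, which yields a left kernel vector. *)
Lemma det_block_cyclic_eq0 (A : 'I_m -> 'M[C]_n) y l : (0 < m)%N ->
  eigenvalue (\prod_(k < m) A k) l -> y ^+ m * l = 1 ->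
  \det (1%:M - y *: block_cyclic A) = 0.
Proof.
move=> m0 /eigenvalueP[v vA v0] yl.
pose A' (k : nat) : 'M[C]_n := if insub k is Some i then A i else 0.
have A'E (i : 'I_m) : A' i = A i by rewrite /A' valK.
have [w [wS wm wv]] : exists w : nat -> 'rV[C]_n,
    [/\ forall s : 'I_m, w s.+1 = y *: (w s *m A s), w m = w 0%N & w 0%N = v].
  exists (fun s => y ^+ s *: (v *m \prod_(0 <= k < s) A' k)); split.
  - move=> s; rewrite big_nat_recr //= A'E exprS -scalerA; congr (_ *: _).
    by rewrite -scalemxAl -mulmxE mulmxA.
  - rewrite [in RHS]big_geq // expr0 scale1r mulmx1 big_mkord.
    by under eq_bigr => i _ do rewrite A'E; rewrite vA scalerA yl scale1r.
  - by rewrite big_geq // expr0 scale1r mulmx1.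
pose u : 'rV[C]_#|{: VT}| :=
  \row_(t < #|{: VT}|) w (enum_val t : VT).1 0 (enum_val t : VT).2.
apply/eqP/det0P; exists u.
  apply: contra v0 => /eqP u0; apply/eqP/rowP => j.
  have := congr1 (fun r : 'rV__ => r 0 (enum_rank (Ordinal m0, j))) u0.
  by rewrite !mxE enum_rankK /= wv.
apply/rowP => t; rewrite mulmxBr mulmx1 -scalemxAr !mxE; apply/eqP.
rewrite subr_eq0; apply/eqP.
have [[b j] ->] : exists bj : VT, t = enum_rank bj by exists (enum_val t); rewrite enum_valK.
pose b' := ord_pred b.
have wb : w b 0 j = (y *: (w b' *m A b')) 0 j.
  rewrite -wS; have : ordS b' = b by exact: ord_predK.
  move=> /(congr1 val) /= bE; have : (b'.+1 <= m)%N := ltn_ord b'.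
  rewrite leq_eqVlt => /orP[/eqP E|E]; last by rewrite -{1}bE modn_small.
  by rewrite -{1}bE E modnn wm.
rewrite enum_rankK /= wb mxE; congr (_ * _); rewrite mxE.
under [RHS]eq_bigr => i _ do rewrite !mxE enum_rankK /=.
rewrite [RHS](reindex (fun i : VT => enum_rank i)) /=; last first.
  by exists enum_val => i _; rewrite ?enum_rankK ?enum_valK.
under [RHS]eq_bigr => i _ do rewrite enum_rankK.
rewrite -(pair_bigA _ (fun (c : 'I_m) (i : 'I_n) => w c 0 i * (if b == ordS c then A c i j else 0))) /=.
rewrite [RHS](bigD1 b') //= [X in _ = _ + X]big1 ?addr0; last first.
  move=> c cb; rewrite big1 // => i _; rewrite ifF ?mulr0 //.
  by apply: contraNF cb => /eqP bE; rewrite /b' bE ordSK.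
by apply: eq_bigr => i _; rewrite /b' ord_predK eqxx.
Qed.

Lemma det_sub_mulmx p q (X : 'M[C]_(p, q)) (Y : 'M[C]_(q, p)) :
  \det (1%:M - X *m Y) = \det (1%:M - Y *m X).
Proof.
have E1 : block_mx 1%:M X Y 1%:M =
    block_mx 1%:M 0 Y 1%:M *m block_mx 1%:M X 0 (1%:M - Y *m X).
  by rewrite mulmx_block !(mul1mx, mulmx1, mul0mx, mulmx0, addr0, add0r) addrC subrK.
have E2 : block_mx 1%:M X Y 1%:M =
    block_mx 1%:M X 0 1%:M *m block_mx (1%:M - X *m Y) 0 Y 1%:M.
  by rewrite mulmx_block !(mul1mx, mulmx1, mul0mx, mulmx0, addr0, add0r) subrK.
have := congr1 (fun M => \det M) E1; rewrite E2 /= !det_mulmx.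
by rewrite !det_ublock !det_lblock !det1 !mul1r !mulr1.
Qed.

(** The block-cyclic matrix of ones factors through the m indicators of blocks. Exchanging the two
    factors leaves n times a cyclic permutation matrix of size m, so the size of the determinant no
    longer depends on n. *)
Lemma det_block_cyclic_ones y :
  \det (1%:M - y *: block_cyclic (fun=> const_mx 1)) =
  \det (1%:M - (y * n%:R) *: perm_mx (perm (@ordS_inj m))).
Proof.
pose X : 'M[C]_(#|{: VT}|, m) := \matrix_(t, s) ((enum_val t).1 == s)%:R.
pose Y : 'M[C]_(m, #|{: VT}|) := \matrix_(s, t) ((enum_val t).1 == ordS s)%:R.
have -> : block_cyclic (fun=> const_mx 1) = X *m Y.
  apply/matrixP => u v; rewrite !mxE.
  rewrite (bigD1 (enum_val u).1) //= !mxE eqxx mul1r big1 ?addr0; last first.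
    by move=> s su; rewrite !mxE eq_sym (negbTE su) mul0r.
  by case: (_ == _).
rewrite scalemxAl det_sub_mulmx -scalemxAr -scalerA; congr (\det (_ - y *: _)).
apply/matrixP => s s'; rewrite !mxE permE.
under eq_bigr => i _ do rewrite !mxE.
rewrite (reindex (fun i : VT => enum_rank i)) /=; last first.
  by exists enum_val => i _; rewrite ?enum_rankK ?enum_valK.
under eq_bigr => i _ do rewrite enum_rankK.
rewrite -(pair_bigA _ (fun (c : 'I_m) (i : 'I_n) => (c == ordS s)%:R * (c == s')%:R)) /=.
rewrite (bigD1 (ordS s)) //= [X in _ + X]big1 ?addr0; last first.
  by move=> c /negbTE cs; rewrite big1 // => i _; rewrite cs mul0r.
by rewrite eqxx sumr_const card_ord mul1r mulr_natl.
Qed.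

End BlockCyclic.

(** Multiplying by the geometric sum [G] of the powers of t P gives the scalar matrix 1 - t^m,
    because P^m = 1. The entries of [G] are at most m in norm, and the Leibniz formula bounds its
    determinant by m! m^m, which is the constant lost here. *)
Lemma det_cyclic_ge (C : numFieldType) m (t : C) (r : C) : (0 < m)%N ->
  `|t| <= r -> r <= 1 ->
  (1 - r) ^+ m <= `|\det (1%:M - t *: perm_mx (perm (@ordS_inj m)))| * (m`!%:R * m%:R ^+ m).
Proof.
case: m => // m _ tr r1; set s := perm _; set P : 'M[C]_m.+1 := perm_mx s.
have Pj j : P ^+ j = perm_mx (s ^+ j)%g.
  elim: j => [|j IH]; first by rewrite expr0 expg0 perm_mx1.
  by rewrite exprSr IH expgSr perm_mxM.
have sX : (s ^+ m.+1)%g = 1%g.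
  have sj j (i : 'I_m.+1) : ((s ^+ j)%g i = (i + j) %% m.+1 :> nat)%N.
    elim: j => [|j IH]; first by rewrite expg0 perm1 addn0 modn_small.
    by rewrite expgSr permM permE /= IH -addn1 modnDml addn1 addnS.
  by apply/permP => i; apply/val_inj; rewrite /= sj perm1 modnDr modn_small.
pose G : 'M[C]_m.+1 := \sum_(j < m.+1) (t *: P) ^+ j.
have detE : \det (1%:M - t *: P) * \det G = (1 - t ^+ m.+1) ^+ m.+1.
  rewrite -det_mulmx -det_scalar; congr (\det _).
  have -> : (1%:M - t *: P) *m G = 1 - (t *: P) ^+ m.+1.
    by rewrite mulmxE -[1%:M]/(1 : 'M[C]_m.+1) -opprB mulNr -subrX1 opprB.
  by rewrite exprZn Pj sX perm_mx1 scalemx1 [RHS]raddfB.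
have r0 : 0 <= r by exact: le_trans tr.
have G1 i j : `|G i j| <= m.+1%:R.
  rewrite /G summxE; apply: le_trans (ler_norm_sum _ _ _) _.
  apply: (@le_trans _ _ (\sum_(k < m.+1) 1)); last by rewrite sumr_const card_ord.
  apply: ler_sum => k _; rewrite exprZn Pj !mxE normrM normrX.
  apply: mulr_ile1 => //; first by rewrite exprn_ile1 // (le_trans tr).
  by case: (_ == _); rewrite ?normr1 ?normr0.
have detG : `|\det G| <= (m.+1)`!%:R * m.+1%:R ^+ m.+1.
  apply: le_trans (ler_norm_sum _ _ _) _.
  apply: (@le_trans _ _ (\sum_(s : 'S_m.+1) m.+1%:R ^+ m.+1)).
    apply: ler_sum => s' _; rewrite normrM normrX normrN1 expr1n mul1r normr_prod.
    rewrite -[X in _ ^+ X]card_ord -prodr_const; apply: ler_prod => i _.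
    by rewrite normr_ge0 G1.
  by rewrite sumr_const card_Sn mulr_natl.
apply: le_trans (ler_wpM2l (normr_ge0 _) detG).
rewrite -normrM detE normrX.
have nt : `|t ^+ m.+1| <= r.
  rewrite normrX exprS; apply: (le_trans _ tr); apply: ler_piMr => //.
  by apply: exprn_ile1 => //; exact: le_trans tr r1.
apply: lerXn2r; rewrite ?nnegrE ?subr_ge0 //.
apply: le_trans (lerB_dist _ _); rewrite normr1 lerD2l lerN2.
by [].
Qed.

Local Open Scope classical_set_scope.
Local Open Scope ring_scope.
Local Open Scope complex_scope.

Local Notation "x ^*" := (Num.conj x) : complex_scope.

(** * Complex expectations and independence *)

Lemma measurable_fun_prodr d (T : measurableType d) (R : realType) (I : Type)
    (s : seq I) (Q : pred I) (h : I -> T -> R) :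
  (forall i, measurable_fun setT (h i)) ->
  measurable_fun setT (fun w => \prod_(i <- s | Q i) h i w).
Proof.
move=> mh; elim: s => [|i s IH].
  by under eq_fun do rewrite big_nil; exact: measurable_cst.
under eq_fun do rewrite big_cons; case: (Q i) => //.
exact: measurable_funM.
Qed.

Section IndependentProducts.
Local Open Scope ereal_scope.
Context d d' (T : measurableType d) (T' : measurableType d') (R : realType).
Variable P : probability T R.

Import HBNNSimple.

(* Equality of the two integrals for indicators [g] passes to simple functions
   and, by monotone convergence, to all nonnegative measurable [g]. *)
Lemma eq_integral_indic_ext (X : {RV P >-> T'}) (F1 F2 : T -> R) (g : T' -> R) :
  measurable_fun setT F1 -> measurable_fun setT F2 ->
  (forall w, 0 <= F1 w)%R -> (forall w, 0 <= F2 w)%R ->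
  measurable_fun setT g -> (forall y, 0 <= g y)%R ->
  (forall B, measurable B ->
    \int[P]_w (\1_B (X w) * F1 w)%:E = \int[P]_w (\1_B (X w) * F2 w)%:E) ->
  \int[P]_w (g (X w) * F1 w)%:E = \int[P]_w (g (X w) * F2 w)%:E.
Proof.
move=> mF1 mF2 F10 F20 mg g0 H.
have mEg : measurable_fun setT (EFin \o g) by exact/measurable_EFinP.
pose g_ := nnsfun_approx measurableT mEg.
have mX : measurable_fun setT X by exact: measurable_funPT.
have mgX n : measurable_fun setT (g_ n \o X).
  by apply: measurableT_comp => //; exact: measurable_funPT.
have lim (F : T -> R) : measurable_fun setT F -> (forall w, 0 <= F w)%R ->
    \int[P]_w (g (X w) * F w)%:E =
    limn (fun n => \int[P]_w (g_ n (X w) * F w)%:E).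
  move=> mF F0; rewrite -monotone_convergence //=.
  - apply: eq_integral => w _; apply/esym/cvg_lim => //.
    rewrite EFinM; under eq_fun do rewrite EFinM.
    apply: cvgeZr => //; apply: (@cvg_nnsfun_approx _ _ _ _ measurableT _ mEg) => //.
    by move=> x _; rewrite lee_fin g0.
  - by move=> n; apply/measurable_EFinP; apply: measurable_funM => //; exact: mgX.
  - by move=> n w _; rewrite lee_fin mulr_ge0.
  - move=> w _ a b ab; rewrite lee_fin ler_wpM2r //.
    exact/lefP/nd_nnsfun_approx.
rewrite !lim //; congr (limn _); apply/funext => n.
have simple (F : T -> R) : measurable_fun setT F -> (forall w, 0 <= F w)%R ->
    \int[P]_w (g_ n (X w) * F w)%:E =
    \sum_(k \in range (g_ n)) (k%:E * \int[P]_w (\1_(g_ n @^-1` [set k]) (X w) * F w)%:E).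
  move=> mF F0.
  transitivity (\int[P]_w (\sum_(k \in range (g_ n))
      (k * (\1_(g_ n @^-1` [set k]) (X w) * F w))%:E)).
    apply: eq_integral => w _; rewrite fimfunE fsumEFin // mulr_fsuml //.
    by congr (_ %:E); apply: eq_fsbigr => k _; rewrite mulrA.
  have mI k : measurable_fun setT (fun w => \1_(g_ n @^-1` [set k]) (X w) * F w)%R.
    apply: measurable_funM => //.
    have mA : measurable (g_ n @^-1` [set k]).
      by rewrite -[X in measurable X]setTI; exact: measurable_funPT.
    exact: (measurableT_comp (measurable_indic mA) mX).
  rewrite ge0_integral_fsum //.
  - apply: eq_fsbigr => k; rewrite inE => -[y _ <-].
    under eq_integral do rewrite EFinM.
    rewrite ge0_integralZl_EFin //.
    + by move=> w _; rewrite lee_fin mulr_ge0.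
    + exact/measurable_EFinP.
  - by move=> k; apply/measurable_EFinP; apply: measurable_funM.
  - move=> k w _; have [k0|k0] := leP 0%R k; first by rewrite lee_fin !mulr_ge0.
    by rewrite preimage_nnfun0 // indic0 mul0r mulr0.
by rewrite !simple //; apply: eq_fsbigr => k _; rewrite H.
Qed.

(** Induction on a list of the indices whose function need not be an indicator. For the empty list
    the claim is the independence of events; each step passes from an indicator to a general [g x],
    with the product of the other factors as weight on one side and its expectation on the other. *)
Lemma independent_ge0_integral (I : finType) (X : I -> {RV P >-> T'}) (g : I -> T' -> R) :
  mutually_independent X ->
  (forall i, measurable_fun setT (g i)) -> (forall i y, 0 <= g i y)%R ->
  (forall i, P.-integrable setT (EFin \o (g i \o X i))) ->
  \int[P]_w (\prod_i g i (X i w))%:E = (\prod_i \int[P]_w g i (X i w))%:E.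
Proof.
move=> indX.
suff main (s : seq I) : forall g : I -> T' -> R,
    (forall i, measurable_fun setT (g i)) -> (forall i y, 0 <= g i y)%R ->
    (forall i, P.-integrable setT (EFin \o (g i \o X i))) ->
    (forall i, i \notin s -> exists2 B, measurable B & g i = \1_B) ->
    \int[P]_w (\prod_i g i (X i w))%:E = (\prod_i \int[P]_w g i (X i w))%:E.
  by move=> mg g0 ig; apply: (main (enum I)) => // i; rewrite mem_enum.
elim: s => [|x s IH] {}g mg g0 ig gB.
  have /choice[B HB] : forall i, exists B, measurable B /\ g i = \1_B.
    by move=> i; have [B mB gi] := gB i isT; exists B.
  have mXB i : measurable (X i @^-1` B i).
    by rewrite -[X in measurable X]setTI; apply: measurable_funPT => //; case: (HB i).
  have := indX [set: I]%SET B (fun i => (HB i).1).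
  have -> : \bigcap_(i in [set` [set: I]%SET]) (X i @^-1` B i) =
            [set w | forall i, B i (X i w)].
    apply/seteqP; split => w /= H i; first by apply: H; rewrite /= inE.
    by move=> _; exact: H.
  move=> E.
  have mAll : measurable [set w | forall i, B i (X i w)].
    have -> : [set w | forall i, B i (X i w)] =
        \bigcap_(i in [set: I]) (X i @^-1` B i).
      by apply/seteqP; split => [w /= H i _|w /= H i]; [exact: H | exact: (H i Logic.I)].
    by apply: fin_bigcap_measurable => //; exact: finite_finset.
  transitivity (P [set w | forall i, B i (X i w)]).
    rewrite -[X in _ = P X]setIT -integral_indic //.
    apply: eq_integral => w _; congr (_%:E).
    rewrite (eq_bigr (fun i => \1_(B i) (X i w))); last first.
      by move=> i _; rewrite (HB i).2.
    rewrite [RHS]indicE; case: (boolP (w \in _)) => wB.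
      rewrite big1 // => i _; rewrite indicE mem_set //.
      by move: wB; rewrite inE /=; exact.
    have [i iB] : exists i, ~ B i (X i w).
      by apply/existsNP => H; move/negP: wB; apply; rewrite inE.
    by rewrite (bigD1 i) //= indicE memNset // mul0r.
  rewrite E; rewrite -prodEFin; apply: eq_big => i; first by rewrite inE.
  move=> _; rewrite (HB i).2 /Rintegral.
  rewrite [X in (fine X)%:E](_ : _ = P (X i @^-1` B i)) ?fineK ?fin_num_measure //.
  by rewrite -[X in _ = P X]setIT -integral_indic.
rewrite (bigD1 x) //=.
under eq_integral do rewrite (bigD1 x) //=.
set c := (\prod_(i | i != x) _)%R.
have c0 : (0 <= c)%R by apply: prodr_ge0 => i _; apply: Rintegral_ge0.
transitivity (\int[P]_w (g x (X x w) * c)%:E); last first.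
  under eq_integral do rewrite EFinM.
  rewrite ge0_integralZr //=.
  - by rewrite EFinM /Rintegral fineK //; exact: (integrable_fin_num _ (ig x)).
  - by apply/measurable_EFinP; apply: measurableT_comp => //; exact: measurable_funPT.
  - by move=> w _; rewrite lee_fin.
apply: eq_integral_indic_ext => //.
- apply: measurable_fun_prodr => i; apply: measurableT_comp => //; exact: measurable_funPT.
- by move=> w; apply: prodr_ge0.
move=> B mB.
pose g' i := if i == x then \1_B else g i.
have g'P i : i != x -> g' i = g i by move=> /negbTE ix; rewrite /g' ix.
have g'x : g' x = \1_B by rewrite /g' eqxx.
have E : \int[P]_w (\prod_i g' i (X i w))%:E = (\prod_i \int[P]_w g' i (X i w))%:E.
  apply: IH => i.
  - by have [->|/g'P ->] := eqVneq i x; rewrite ?g'x //; exact: measurable_indic.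
  - by have [->|/g'P ->] := eqVneq i x; rewrite ?g'x // => y; rewrite indicE.
  - have [->|/g'P ->] := eqVneq i x; rewrite ?g'x //.
    rewrite (_ : _ \o _ = EFin \o \1_(X x @^-1` B)) //.
    by apply: integrable_indic => //; rewrite -[X in measurable X]setTI; exact: measurable_funPT.
  - have [->|ix] := eqVneq i x; first by rewrite g'x; exists B.
    by rewrite g'P // => si; apply: gB; rewrite inE negb_or ix.
transitivity (\int[P]_w (\prod_i g' i (X i w))%:E).
  apply: eq_integral => w _; rewrite [in RHS](bigD1 x) //= g'x.
  by under [in RHS]eq_bigr => i ix do rewrite g'P //.
rewrite E (bigD1 x) //= g'x.
rewrite (eq_bigr (fun i => \int[P]_w g i (X i w))%R); last first.
  by move=> i ix; rewrite g'P.
under [RHS]eq_integral do rewrite EFinM.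
have mXB : measurable (X x @^-1` B).
  by rewrite -[X in measurable X]setTI; exact: measurable_funPT.
rewrite ge0_integralZr //=.
- by rewrite EFinM /Rintegral fineK // integral_indic // fin_num_measure // setIT.
- by apply/measurable_EFinP; apply: (measurable_indic mXB).
Qed.

End IndependentProducts.

Section ComplexExpectation.
Context d (T : measurableType d) (R : realType) (P : probability T R).
Implicit Types (f g : T -> R[i]).

Definition cmeasurable d' (S : measurableType d') (f : S -> R[i]) :=
  measurable_fun setT (fun w => complex.Re (f w)) /\
  measurable_fun setT (fun w => complex.Im (f w)).

Definition cintegrable f :=
  P.-integrable setT (EFin \o (fun w => complex.Re (f w))) /\
  P.-integrable setT (EFin \o (fun w => complex.Im (f w))).

Definition cexpectation f : R[i] :=
  (\int[P]_w complex.Re (f w)) +i* (\int[P]_w complex.Im (f w)).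

Lemma complexReM (x y : R[i]) : complex.Re (x * y) =
  complex.Re x * complex.Re y - complex.Im x * complex.Im y.
Proof. by case: x => a b; case: y. Qed.

Lemma complexImM (x y : R[i]) : complex.Im (x * y) =
  complex.Re x * complex.Im y + complex.Im x * complex.Re y.
Proof. by case: x => a b; case: y. Qed.

Lemma complexReD (x y : R[i]) : complex.Re (x + y) = complex.Re x + complex.Re y.
Proof. by case: x => a b; case: y. Qed.

Lemma complexImD (x y : R[i]) : complex.Im (x + y) = complex.Im x + complex.Im y.
Proof. by case: x => a b; case: y. Qed.

Lemma complexReJ (x : R[i]) : complex.Re (x^*) = complex.Re x.
Proof. by case: x. Qed.

Lemma complexImJ (x : R[i]) : complex.Im (x^*) = - complex.Im x.
Proof. by case: x. Qed.

Lemma normc_sqr (x : R[i]) : Normc.normc x ^+ 2 = complex.Re x ^+ 2 + complex.Im x ^+ 2.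
Proof. by case: x => a b /=; rewrite sqr_sqrtr // addr_ge0 // sqr_ge0. Qed.

Lemma normc_ge0 (x : R[i]) : 0 <= Normc.normc x.
Proof. by case: x => a b /=; exact: sqrtr_ge0. Qed.

Lemma normc_sqrE (x : R[i]) : Normc.normc x ^+ 2 = complex.Re (x * x^*).
Proof. by rewrite normc_sqr complexReM complexReJ complexImJ mulrN opprK. Qed.

Lemma ler_ReIm_normc (x : R[i]) :
  `|complex.Re x| <= Normc.normc x /\ `|complex.Im x| <= Normc.normc x.
Proof.
split; rewrite -(ler_pXn2r (n := 2)) ?nnegrE ?normc_ge0 // normc_sqr real_normK ?num_real //.
  by rewrite lerDl sqr_ge0.
by rewrite lerDr sqr_ge0.
Qed.

Lemma normc_le_ReIm (x : R[i]) : Normc.normc x <= `|complex.Re x| + `|complex.Im x|.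
Proof.
rewrite -(ler_pXn2r (n := 2)) ?nnegrE ?normc_ge0 ?addr_ge0 // normc_sqr sqrrD.
by rewrite !real_normK ?num_real // lerD2r lerDl mulrn_wge0 // mulr_ge0.
Qed.

Lemma integrable_dom (f : T -> R) (g : T -> R) : measurable_fun setT f ->
  P.-integrable setT (EFin \o g) -> (forall w, `|f w| <= g w) ->
  P.-integrable setT (EFin \o f).
Proof.
move=> mf ig fg; apply: (le_integrable measurableT _ _ ig).
  exact/measurable_EFinP.
by move=> w _ /=; rewrite lee_fin (le_trans (fg w)) // ler_norm.
Qed.

Lemma integrable_cst (r : R) : P.-integrable setT (EFin \o (fun=> r)).
Proof. exact: finite_measure_integrable_cst. Qed.

Lemma integrable_addr (f g : T -> R) : P.-integrable setT (EFin \o f) ->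
  P.-integrable setT (EFin \o g) -> P.-integrable setT (EFin \o (fun w => f w + g w)).
Proof. by move=> hf hg; have := integrableD measurableT hf hg. Qed.

Lemma integrable_mull (r : R) (f : T -> R) : P.-integrable setT (EFin \o f) ->
  P.-integrable setT (EFin \o (fun w => r * f w)).
Proof. by move=> hf; have := integrableZl measurableT r hf. Qed.

Lemma integrable_oppr (f : T -> R) : P.-integrable setT (EFin \o f) ->
  P.-integrable setT (EFin \o (fun w => - f w)).
Proof. by move=> hf; have := integrableN hf. Qed.

Lemma RintD (f g : T -> R) : P.-integrable setT (EFin \o f) ->
  P.-integrable setT (EFin \o g) ->
  \int[P]_w (f w + g w) = \int[P]_w f w + \int[P]_w g w.
Proof. by move=> hf hg; rewrite RintegralD. Qed.

Lemma RintZ (r : R) (f : T -> R) : P.-integrable setT (EFin \o f) ->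
  \int[P]_w (r * f w) = r * \int[P]_w f w.
Proof. by move=> hf; rewrite RintegralZl. Qed.

Lemma Rint_cst (r : R) : \int[P]_w r = r.
Proof.
rewrite Rintegral_cst //; have /= -> := @probability_setT _ _ _ P.
by rewrite mulr1.
Qed.

Lemma cintegrableD f g : cintegrable f -> cintegrable g ->
  cintegrable (fun w => f w + g w).
Proof.
move=> [f1 f2] [g1 g2]; split.
  by under eq_fun do rewrite complexReD; exact: integrable_addr.
by under eq_fun do rewrite complexImD; exact: integrable_addr.
Qed.

Lemma cintegrableZ (a : R[i]) f : cintegrable f -> cintegrable (fun w => a * f w).
Proof.
move=> [f1 f2]; split.
  under eq_fun do rewrite complexReM -mulNr.
  by apply: integrable_addr; exact: integrable_mull.
under eq_fun do rewrite complexImM.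
by apply: integrable_addr; exact: integrable_mull.
Qed.

Lemma cexpectationD f g : cintegrable f -> cintegrable g ->
  cexpectation (fun w => f w + g w) = cexpectation f + cexpectation g.
Proof.
move=> [f1 f2] [g1 g2]; rewrite /cexpectation.
under eq_Rintegral do rewrite complexReD; under [X in _ +i* X]eq_Rintegral do rewrite complexImD.
by rewrite !RintD.
Qed.

Lemma cexpectationZ (a : R[i]) f : cintegrable f ->
  cexpectation (fun w => a * f w) = a * cexpectation f.
Proof.
move=> [f1 f2]; rewrite /cexpectation.
under eq_Rintegral do rewrite complexReM -mulNr; under [X in _ +i* X]eq_Rintegral do rewrite complexImM.
rewrite !RintD ?RintZ //; try exact: integrable_mull.
by case: a => x y /=; rewrite mulNr.
Qed.

Lemma cintegrable_cst (a : R[i]) : cintegrable (fun=> a).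
Proof. by split; exact: integrable_cst. Qed.

Lemma cexpectation_cst (a : R[i]) : cexpectation (fun=> a) = a.
Proof. by rewrite /cexpectation !Rint_cst; case: a. Qed.

Lemma cexpectation_sum (I : Type) (s : seq I) (Q : pred I) (a : I -> R[i]) (F : I -> T -> R[i]) :
  (forall i, Q i -> cintegrable (F i)) ->
  cintegrable (fun w => \sum_(i <- s | Q i) a i * F i w) /\
  cexpectation (fun w => \sum_(i <- s | Q i) a i * F i w) =
  \sum_(i <- s | Q i) a i * cexpectation (F i).
Proof.
move=> iF; elim: s => [|i s [IH1 IH2]].
  rewrite (_ : (fun w => _) = (fun=> 0)); last by apply/funext => w; rewrite big_nil.
  by rewrite big_nil cexpectation_cst; split => //; exact: cintegrable_cst.
case Qi : (Q i); last first.
  by split; [under eq_fun do rewrite big_cons Qi|under eq_fun do rewrite big_cons Qi;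
     rewrite big_cons Qi].
have iFi := cintegrableZ (a i) (iF i Qi).
split; under eq_fun do rewrite big_cons Qi; first exact: cintegrableD.
by rewrite big_cons Qi cexpectationD // IH2 cexpectationZ //; exact: iF.
Qed.

Lemma RintN (f : T -> R) : P.-integrable setT (EFin \o f) ->
  \int[P]_w (- f w) = - \int[P]_w f w.
Proof. by move=> hf; under eq_Rintegral do rewrite -mulN1r; rewrite RintZ // mulN1r. Qed.

Lemma cexpectationJ f : cintegrable f ->
  cintegrable (fun w => (f w)^*) /\
  cexpectation (fun w => (f w)^*) = (cexpectation f)^*.
Proof.
move=> [f1 f2]; split.
  split; first by under eq_fun do rewrite complexReJ.
  by under eq_fun do rewrite complexImJ; exact: integrable_oppr.
rewrite /cexpectation; under eq_Rintegral do rewrite complexReJ.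
by under [X in _ +i* X]eq_Rintegral do rewrite complexImJ; rewrite RintN.
Qed.

Lemma cintegrable_real (h : T -> R) : P.-integrable setT (EFin \o h) ->
  cintegrable (fun w => (h w)%:C) /\
  cexpectation (fun w => (h w)%:C) = (\int[P]_w h w)%:C.
Proof.
move=> ih; split; first by split => //; exact: integrable_cst.
by rewrite /cexpectation /= Rint_cst.
Qed.

Lemma cintegrable_dom f (g : T -> R) : cmeasurable f ->
  P.-integrable setT (EFin \o g) -> (forall w, Normc.normc (f w) <= g w) ->
  cintegrable f.
Proof.
move=> [m1 m2] ig fg; split; apply: (integrable_dom _ ig) => // w;
  apply: le_trans (fg w); by case: (ler_ReIm_normc (f w)).
Qed.

Lemma ler_Rint (f g : T -> R) : P.-integrable setT (EFin \o f) ->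
  P.-integrable setT (EFin \o g) -> (forall w, f w <= g w) ->
  \int[P]_w f w <= \int[P]_w g w.
Proof. by move=> hf hg fg; apply: le_Rintegral. Qed.

Lemma normc_cexpectation_le f (g : T -> R) : cintegrable f ->
  P.-integrable setT (EFin \o g) -> (forall w, Normc.normc (f w) <= g w) ->
  Normc.normc (cexpectation f) <= 2 * \int[P]_w g w.
Proof.
move=> [f1 f2] ig fg; apply: le_trans (normc_le_ReIm _) _ => /=.
have abs_le (h : T -> R) : P.-integrable setT (EFin \o h) -> (forall w, `|h w| <= g w) ->
    `|\int[P]_w h w| <= \int[P]_w g w.
  move=> ih hg; rewrite ler_norml; apply/andP; split.
    rewrite -RintN //; apply: ler_Rint => //; first exact: integrable_oppr.
    by move=> w; have := hg w; rewrite ler_norml => /andP[].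
  by apply: ler_Rint => // w; exact: le_trans (ler_norm _) (hg w).
by rewrite mulr2n mulrDl mul1r lerD //; apply: abs_le => // w;
  apply: le_trans (fg w); case: (ler_ReIm_normc (f w)).
Qed.

Lemma cmeasurable_cst d' (S : measurableType d') (a : R[i]) : @cmeasurable d' S (fun=> a).
Proof. by split; exact: measurable_cst. Qed.

Lemma cmeasurableD d' (S : measurableType d') (f g : S -> R[i]) :
  cmeasurable f -> cmeasurable g -> cmeasurable (fun w => f w + g w).
Proof.
move=> [f1 f2] [g1 g2]; split.
  by under eq_fun do rewrite complexReD; exact: measurable_funD.
by under eq_fun do rewrite complexImD; exact: measurable_funD.
Qed.

Lemma cmeasurableM d' (S : measurableType d') (f g : S -> R[i]) :
  cmeasurable f -> cmeasurable g -> cmeasurable (fun w => f w * g w).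
Proof.
move=> [f1 f2] [g1 g2]; split.
  under eq_fun do rewrite complexReM; apply: measurable_funB; exact: measurable_funM.
by under eq_fun do rewrite complexImM; apply: measurable_funD; exact: measurable_funM.
Qed.

Lemma cmeasurableJ d' (S : measurableType d') (f : S -> R[i]) :
  cmeasurable f -> cmeasurable (fun w => (f w)^*).
Proof.
move=> [f1 f2]; split; first by under eq_fun do rewrite complexReJ.
by under eq_fun do rewrite complexImJ; exact: measurableT_comp.
Qed.

Lemma cmeasurable_sum d' (S : measurableType d') (I : Type) (s : seq I) (Q : pred I)
    (F : I -> S -> R[i]) : (forall i, cmeasurable (F i)) ->
  cmeasurable (fun w => \sum_(i <- s | Q i) F i w).
Proof.
move=> mF; elim: s => [|i s IH].
  by under eq_fun do rewrite big_nil; exact: cmeasurable_cst.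
under eq_fun do rewrite big_cons; case: (Q i) => //; exact: cmeasurableD.
Qed.

Lemma cmeasurable_prod d' (S : measurableType d') (I : Type) (s : seq I) (Q : pred I)
    (F : I -> S -> R[i]) : (forall i, cmeasurable (F i)) ->
  cmeasurable (fun w => \prod_(i <- s | Q i) F i w).
Proof.
move=> mF; elim: s => [|i s IH].
  by under eq_fun do rewrite big_nil; exact: cmeasurable_cst.
under eq_fun do rewrite big_cons; case: (Q i) => //; exact: cmeasurableM.
Qed.

Lemma measurable_normc_sqr d' (S : measurableType d') (f : S -> R[i]) :
  cmeasurable f -> measurable_fun setT (fun w => Normc.normc (f w) ^+ 2).
Proof.
move=> [f1 f2]; under eq_fun do rewrite normc_sqr !expr2.
by apply: measurable_funD; exact: measurable_funM.
Qed.

Lemma cmeasurable_RV (X : {RV P >-> R[i]}) : cmeasurable X.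
Proof.
have mid : measurable_fun setT (@complex_pair R : R[i] -> _).
  move=> _ B mB; rewrite setTI; exists B => //; by rewrite setTI.
have mX : measurable_fun setT (fun w => complex_pair (X w)).
  by apply: (measurableT_comp mid); exact: measurable_funPT.
split; first by apply: (measurableT_comp measurable_fst mX).
by apply: (measurableT_comp measurable_snd mX).
Qed.

Lemma cmeasurable_idfun : @cmeasurable _ R[i] id.
Proof.
have mid : measurable_fun setT (@complex_pair R : R[i] -> _).
  move=> _ B mB; rewrite setTI; exists B => //; by rewrite setTI.
split; first by apply: (measurableT_comp measurable_fst mid).
by apply: (measurableT_comp measurable_snd mid).
Qed.

(** The four nonnegative parts of a complex number: [q.1] selects the imaginary part, [q.2] the
    negative part. *)
Definition part (q : bool * bool) (z : R[i]) : R :=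
  let x := if q.1 then complex.Im z else complex.Re z in
  if q.2 then Num.max (- x) 0 else Num.max x 0.

Definition part_unit (q : bool * bool) : R[i] := (if q.1 then 'i%C else 1) * (-1) ^+ q.2.

Lemma sum_parts (z : R[i]) : z = \sum_q part_unit q * (part q z)%:C.
Proof.
have maxB (x : R) : Num.max x 0 - Num.max (- x) 0 = x.
  have [x0|x0] := leP 0 x; first by rewrite (max_idPr _) ?oppr_le0 // subr0.
  by rewrite (max_idPl _) ?oppr_ge0 ?ltW // sub0r opprK.
rewrite -(pair_bigA _ (fun a b => part_unit (a, b) * (part (a, b) z)%:C)) /=.
rewrite !big_bool /part_unit /part /= !expr1 !expr0.
rewrite [LHS]complexE -[in LHS](maxB (complex.Re z)) -[in LHS](maxB (complex.Im z)).
rewrite !rmorphB /=; ring.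
Qed.

Lemma part_ge0 q z : 0 <= part q z.
Proof. by rewrite /part; case: q.2; rewrite le_max lexx orbT. Qed.

Lemma part_le q z : part q z <= `|if q.1 then complex.Im z else complex.Re z|.
Proof.
by rewrite /part; case: q.2; rewrite ge_max normr_ge0 andbT ?ler_norm // -normrN ler_norm.
Qed.

Lemma measurable_part d' (S : measurableType d') (f : S -> R[i]) q :
  cmeasurable f -> measurable_fun setT (fun w => part q (f w)).
Proof.
move=> [f1 f2]; rewrite /part; case: q => -[] [] /=;
  by apply: measurable_maxr => //; exact: measurableT_comp.
Qed.

Lemma integrable_part f q : cintegrable f -> P.-integrable setT (EFin \o (fun w => part q (f w))).
Proof.
move=> [f1 f2].
have mf : cmeasurable f.
  by split; apply/measurable_EFinP; [case/integrableP: f1|case/integrableP: f2].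
have iabs : P.-integrable setT
    (EFin \o (fun w => `|if q.1 then complex.Im (f w) else complex.Re (f w)|)).
  by case: q.1; [have := integrable_norm f2 | have := integrable_norm f1].
apply: (integrable_dom (measurable_part q mf) iabs) => w.
by rewrite ger0_norm ?part_ge0 // part_le.
Qed.

(** Splitting every factor into its four nonnegative parts turns the product into a finite sum over
    choice functions. [independent_ge0_integral] treats each term and also gives its integrability,
    the product of the integrals being finite; the same distributivity regroups the result. *)
Lemma cexpectation_prod (I : finType) (X : I -> {RV P >-> R[i]}) (g : I -> R[i] -> R[i]) :
  mutually_independent X -> (forall i, cmeasurable (g i)) ->
  (forall i, cintegrable (fun w => g i (X i w))) ->
  cintegrable (fun w => \prod_i g i (X i w)) /\
  cexpectation (fun w => \prod_i g i (X i w)) = \prod_i cexpectation (fun w => g i (X i w)).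
Proof.
move=> indX mg ig.
pose h (f : {ffun I -> bool * bool}) w : R := \prod_i part (f i) (g i (X i w)).
have mpart q i : measurable_fun setT (fun z => part q (g i z)) by exact: measurable_part.
have Eh (f : {ffun I -> bool * bool}) : P.-integrable setT (EFin \o h f) /\
    \int[P]_w h f w = \prod_i \int[P]_w part (f i) (g i (X i w)).
  have E := @independent_ge0_integral _ _ _ _ _ P I X (fun i z => part (f i) (g i z)) indX
     (fun i => mpart (f i) i) (fun i y => part_ge0 _ _) (fun i => integrable_part (f i) (ig i)).
  have mh : measurable_fun setT (h f).
    apply: measurable_fun_prodr => i.
    by apply: (measurableT_comp (mpart (f i) i)); exact: measurable_funPT.
  split; last by rewrite /Rintegral E.
  apply/integrableP; split; first exact/measurable_EFinP.
  under eq_integral => w _.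
    rewrite /= ger0_norm; last by apply: prodr_ge0 => i _; exact: part_ge0.
    over.
  by rewrite E ltry.
have gE : (fun w => \prod_i g i (X i w)) = (fun w =>
    \sum_(f : {ffun I -> bool * bool}) (\prod_i part_unit (f i)) * (h f w)%:C).
  apply/funext => w; under eq_bigr => i _ do rewrite [g i _]sum_parts.
  rewrite bigA_distr_bigA /=; apply: eq_bigr => f _.
  by rewrite big_split /= rmorph_prod.
have ic (f : {ffun I -> bool * bool}) : cintegrable (fun w => (h f w)%:C) by case: (cintegrable_real (Eh f).1).
have [i1 i2] := @cexpectation_sum _ (index_enum _) predT
   (fun f : {ffun I -> bool * bool} => \prod_i part_unit (f i)) _ (fun F _ => ic F).
rewrite gE; split => //; rewrite i2.
transitivity (\prod_i \sum_q part_unit q * (\int[P]_w part q (g i (X i w)))%:C).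
  rewrite bigA_distr_bigA /=; apply: eq_bigr => f _.
  rewrite [in RHS]big_split /=; congr (_ * _).
  by rewrite (cintegrable_real (Eh f).1).2 (Eh f).2 rmorph_prod.
apply: eq_bigr => i _.
have ip q : cintegrable (fun w => (part q (g i (X i w)))%:C).
  by case: (cintegrable_real (integrable_part q (ig i))).
have [_ j2] := @cexpectation_sum _ (index_enum _) predT part_unit _ (fun q _ => ip q).
rewrite [in RHS](_ : (fun w => g i (X i w)) = (fun w =>
   \sum_q part_unit q * (part q (g i (X i w)))%:C)); last first.
  by apply/funext => w; rewrite -sum_parts.
rewrite j2; apply: eq_bigr => q _.
by rewrite (cintegrable_real (integrable_part q (ig i))).2.
Qed.

End ComplexExpectation.

(** * Upper bounds on expectations *)

Section UpperExpectation.
Context d (T : measurableType d) (R : realType) (P : probability T R).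
Implicit Types (f g : T -> R).

(** An upper expectation, which asks no measurability of [f]. Norms, their products and their sums
    can thus be estimated as soon as their squares are dominated by integrable functions. *)
Definition uexp_le f (b : R) := exists g,
  [/\ P.-integrable setT (EFin \o g), forall w, f w <= g w & \int[P]_w g w <= b].

Lemma uexp_leS f f' b b' : (forall w, f w <= f' w) -> b' <= b ->
  uexp_le f' b' -> uexp_le f b.
Proof.
move=> ff bb [g [ig fg gb]]; exists g; split => //; last exact: le_trans bb.
by move=> w; exact: le_trans (fg w).
Qed.

Lemma uexp_le_cst b : uexp_le (fun=> b) b.
Proof. by exists (fun=> b); split => //; [exact: integrable_cst|rewrite Rint_cst]. Qed.

Lemma uexp_leD f f' b b' : uexp_le f b -> uexp_le f' b' ->
  uexp_le (fun w => f w + f' w) (b + b').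
Proof.
move=> [g [ig fg gb]] [g' [ig' fg' gb']]; exists (fun w => g w + g' w); split.
- exact: integrable_addr.
- by move=> w; rewrite lerD.
- by rewrite RintD // lerD.
Qed.

Lemma uexp_leZ f b c : 0 <= c -> uexp_le f b -> uexp_le (fun w => c * f w) (c * b).
Proof.
move=> c0 [g [ig fg gb]]; exists (fun w => c * g w); split.
- exact: integrable_mull.
- by move=> w; rewrite ler_wpM2l.
- by rewrite RintZ // ler_wpM2l.
Qed.

Lemma uexp_le_sum (I : Type) (s : seq I) (Q : pred I) (F : I -> T -> R) (b : I -> R) :
  (forall i, Q i -> uexp_le (F i) (b i)) ->
  uexp_le (fun w => \sum_(i <- s | Q i) F i w) (\sum_(i <- s | Q i) b i).
Proof.
move=> H; elim: s => [|i s IH].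
  rewrite big_nil; under [X in uexp_le X _]eq_fun do rewrite big_nil.
  exact: uexp_le_cst.
rewrite big_cons; under [X in uexp_le X _]eq_fun do rewrite big_cons.
by case: ifPn => // Qi; apply: uexp_leD => //; exact: H.
Qed.

(** A weighted arithmetic-geometric inequality in place of Cauchy-Schwarz: it is linear in the two
    bounds, and the weight [t] stays free until all errors are balanced. *)
Lemma uexp_leM f f' b b' t : 0 < t ->
  uexp_le (fun w => f w ^+ 2) b -> uexp_le (fun w => f' w ^+ 2) b' ->
  uexp_le (fun w => f w * f' w) (t * b + t^-1 * b').
Proof.
move=> t0 H H'; have ti : 0 <= t^-1 by rewrite invr_ge0 ltW.
have := uexp_leD (uexp_leZ (ltW t0) H) (uexp_leZ ti H'); apply: uexp_leS => // w.
have -> : t * f w ^+ 2 + t^-1 * f' w ^+ 2 =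
    f w * f' w + t^-1 * ((t * f w - 2^-1 * f' w) ^+ 2 + (3 / 4) * f' w ^+ 2).
  by field; rewrite gt_eqF.
by rewrite lerDl mulr_ge0 // addr_ge0 ?sqr_ge0 // mulr_ge0 ?sqr_ge0 // divr_ge0.
Qed.

Lemma uexp_markov f b (A : set T) : measurable A -> (forall w, 0 <= f w) ->
  (forall w, A w -> 1 <= f w) -> uexp_le f b -> (P A <= b%:E)%E.
Proof.
move=> mA f0 fA [g [ig fg gb]].
have E : P A = (\int[P]_w \1_A w)%:E.
  by rewrite /Rintegral integral_indic // setIT fineK // fin_num_measure.
rewrite E lee_fin; apply: le_trans gb; apply: ler_Rint => //.
  exact: integrable_indic.
move=> w; rewrite indicE; case: (boolP (w \in A)).
  by rewrite inE => /fA h; exact: le_trans (fg w).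
by move=> _; exact: le_trans (fg w).
Qed.

Lemma sqr_normc_sum (I : finType) (Q : pred I) (a : I -> R[i]) (F : I -> T -> R[i]) :
  (forall i j, Q i -> Q j -> cintegrable P (fun w => F i w * (F j w)^*)) ->
  P.-integrable setT (EFin \o (fun w => Normc.normc (\sum_(i | Q i) a i * F i w) ^+ 2)) /\
  \int[P]_w (Normc.normc (\sum_(i | Q i) a i * F i w) ^+ 2) =
  complex.Re (\sum_(i | Q i) \sum_(j | Q j)
     a i * (a j)^* * cexpectation P (fun w => F i w * (F j w)^*)).
Proof.
move=> iF.
have iF' (p : I * I) : Q p.1 && Q p.2 -> cintegrable P (fun w => F p.1 w * (F p.2 w)^*).
  by move=> /andP[Q1 Q2]; exact: iF.
have [[i1 _] i2] := @cexpectation_sum _ T R P _ (index_enum _)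
  (fun p : I * I => Q p.1 && Q p.2) (fun p => a p.1 * (a p.2)^*)
  (fun p w => F p.1 w * (F p.2 w)^*) iF'.
have E w : Normc.normc (\sum_(i | Q i) a i * F i w) ^+ 2 =
    complex.Re (\sum_(p : I * I | Q p.1 && Q p.2) a p.1 * (a p.2)^* * (F p.1 w * (F p.2 w)^*)).
  rewrite normc_sqrE rmorph_sum big_distrlr /= pair_big /=; congr complex.Re.
  by apply: eq_bigr => p _; rewrite rmorphM mulrACA.
split; first by under eq_fun do rewrite E.
by under eq_Rintegral do rewrite E; rewrite pair_big /= -i2.
Qed.

End UpperExpectation.

(** * Transfer of expectations to the common law *)

Section LawTransfer.
Context d (T : measurableType d) (R : realType) (P : probability T R).
Variables (mu : probability R[i] R) (X : {RV P >-> R[i]}).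
Hypothesis law : has_law X mu.

Lemma law_ge0_integral (h : R[i] -> R) : measurable_fun setT h -> (forall z, 0 <= h z) ->
  (\int[P]_w (h (X w))%:E = \int[mu]_z (h z)%:E)%E.
Proof.
move=> mh h0.
rewrite [RHS](eq_measure_integral (distribution P X)); last first.
  by move=> A mA _; rewrite /= law.
by rewrite ge0_integral_distribution //; exact/measurable_EFinP.
Qed.

Lemma law_integral (h : R[i] -> R) : measurable_fun setT h ->
  mu.-integrable setT (EFin \o h) ->
  P.-integrable setT (EFin \o (fun w => h (X w))) /\
  \int[P]_w h (X w) = \int[mu]_z h z.
Proof.
move=> mh ih.
have mhX : measurable_fun setT (fun w => h (X w)).
  by apply: (measurableT_comp mh); exact: measurable_funPT.
have ihX : P.-integrable setT (EFin \o (fun w => h (X w))).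
  apply/integrableP; split; first exact/measurable_EFinP.
  rewrite (law_ge0_integral (h := fun z => `|h z|)) //; last exact: measurableT_comp.
  by case/integrableP: ih.
split => //; rewrite /Rintegral; congr fine.
rewrite [RHS](eq_measure_integral (distribution P X)); last first.
  by move=> A mA _; rewrite /= law.
by rewrite integral_distribution //; exact/measurable_EFinP.
Qed.

Lemma law_cexpectation (g : R[i] -> R[i]) : cmeasurable g -> cintegrable mu g ->
  cintegrable P (fun w => g (X w)) /\
  cexpectation P (fun w => g (X w)) = cexpectation mu g.
Proof.
move=> [m1 m2] [i1 i2].
have [j1 e1] := law_integral m1 i1; have [j2 e2] := law_integral m2 i2.
by split => //; rewrite /cexpectation e1 e2.
Qed.

End LawTransfer.

Section Jensen.
Context d (T : measurableType d) (R : realType) (P : probability T R).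

(** Multiplying by the conjugate of the expectation makes it real, so that only a real part has to
    be compared. No factor 2 is lost, as it would be by treating the coordinates separately; the
    bound by 1 on the mean of the squared entry relies on this. *)
Lemma normc_cexpectation (f : T -> R[i]) (g : T -> R) : cintegrable P f ->
  P.-integrable setT (EFin \o g) -> (forall w, Normc.normc (f w) <= g w) ->
  Normc.normc (cexpectation P f) <= \int[P]_w g w.
Proof.
move=> iF ig fg; set c := cexpectation P f.
have [c0|c0] := eqVneq (Normc.normc c) 0.
  by rewrite c0; apply: Rintegral_ge0 => w _; exact: le_trans (normc_ge0 _) (fg w).
have cp : 0 < Normc.normc c by rewrite lt_def c0 normc_ge0.
rewrite -(ler_pM2l cp) -expr2 normc_sqrE mulrC -cexpectationZ // /cexpectation /=.
have [i1 _] := cintegrableZ (c^*) iF.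
rewrite -RintZ //; apply: ler_Rint => //; first exact: integrable_mull.
move=> w; apply: le_trans (ler_norm _) _.
apply: le_trans (ler_ReIm_normc _).1 _; rewrite Normc.normcM.
have -> : Normc.normc (c^*) = Normc.normc c.
  by case: (c) => x y /=; rewrite sqrrN.
by rewrite ler_wpM2l // normc_ge0.
Qed.

End Jensen.

(** * Truncation of the common law *)

Section Truncation.
Context (R : realType) (mu : probability R[i] R).
Hypothesis mean0 : cexpectation mu id = 0.
Hypothesis sqr_int : mu.-integrable setT (EFin \o (fun z => Normc.normc z ^+ 2)).
Hypothesis sqr1 : \int[mu]_z (Normc.normc z ^+ 2) = 1.
Implicit Types (M : R) (z : R[i]).

(** The threshold is put on the squared norm, a polynomial in the coordinates and hence directly
    measurable. *)
Definition truncate M z : R[i] := if Normc.normc z ^+ 2 <= M then z else 0.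

Definition centered_truncation M z : R[i] := truncate M z - cexpectation mu (truncate M).

Definition truncated_moment M : R := \int[mu]_z (Normc.normc (truncate M z) ^+ 2).

Let mid : cmeasurable (id : R[i] -> R[i]). Proof. exact: cmeasurable_idfun. Qed.

Let normc_le1 z : Normc.normc z <= 1 + Normc.normc z ^+ 2.
Proof.
have [z1|z1] := leP (Normc.normc z) 1; first by rewrite (le_trans z1) // lerDl sqr_ge0.
by rewrite expr2 (le_trans (ler_peMr (normc_ge0 _) (ltW z1))) // lerDr.
Qed.

Let i1sqr : mu.-integrable setT (EFin \o (fun z => 1 + Normc.normc z ^+ 2)).
Proof. by apply: integrable_addr => //; exact: integrable_cst. Qed.

Lemma cintegrable_id : cintegrable mu id.
Proof. exact: (cintegrable_dom mid i1sqr normc_le1). Qed.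

Lemma cmeasurable_truncate M : cmeasurable (truncate M).
Proof.
have mS : measurable [set z : R[i] | Normc.normc z ^+ 2 <= M].
  have -> : [set z : R[i] | Normc.normc z ^+ 2 <= M] =
      (fun z => Normc.normc z ^+ 2) @^-1` `]-oo, M].
    by apply/seteqP; split => z /=; rewrite in_itv.
  rewrite -[X in measurable X]setTI.
  by apply: (measurable_normc_sqr mid measurableT); exact: measurable_itv.
have E : truncate M = (fun z => (\1_[set z : R[i] | Normc.normc z ^+ 2 <= M] z : R)%:C * z).
  apply/funext => z; rewrite /truncate indicE; case: ifPn => zM.
    by rewrite mem_set // mul1r.
  by rewrite memNset ?mul0r //=; exact/negP.
rewrite E; apply: cmeasurableM => //; split => /=; last exact: measurable_cst.
exact: measurable_indic.
Qed.

Lemma cmeasurable_centered_truncation M : cmeasurable (centered_truncation M).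
Proof.
by apply: cmeasurableD; [exact: cmeasurable_truncate|exact: cmeasurable_cst].
Qed.

Lemma normc_truncate_le M z : Normc.normc (truncate M z) <= Normc.normc z.
Proof. by rewrite /truncate; case: ifPn => // _; rewrite Normc.normc0 normc_ge0. Qed.

Lemma normc_truncate_bound M z : 0 <= M -> Normc.normc (truncate M z) <= 1 + M.
Proof.
move=> M0; rewrite /truncate; case: ifPn => zM; last by rewrite Normc.normc0 addr_ge0.
by rewrite (le_trans (normc_le1 z)) // lerD2l.
Qed.

Lemma cintegrable_truncate M : cintegrable mu (truncate M).
Proof.
apply: (cintegrable_dom (cmeasurable_truncate M) i1sqr) => z.
exact: le_trans (normc_truncate_le M z) (normc_le1 z).
Qed.

Let c M := cexpectation mu (truncate M).

Lemma normc_centered_truncation M z : 0 <= M ->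
  Normc.normc (centered_truncation M z) <= 2 * (1 + M).
Proof.
move=> M0; rewrite /centered_truncation; apply: le_trans (le_normcD _ _) _.
rewrite normcN mulr2n mulrDl mul1r lerD ?normc_truncate_bound //.
rewrite -[leRHS](Rint_cst mu); apply: normc_cexpectation => //.
- exact: cintegrable_truncate.
- exact: integrable_cst.
- by move=> ?; exact: normc_truncate_bound.
Qed.

Lemma cintegrable_bounded (g : R[i] -> R[i]) (b : R) : cmeasurable g ->
  (forall z, Normc.normc (g z) <= b) -> cintegrable mu g.
Proof. by move=> mg gb; apply: (cintegrable_dom mg _ gb); exact: integrable_cst. Qed.

Lemma cexpectation_centered_truncation M : cexpectation mu (centered_truncation M) = 0.
Proof.
rewrite /centered_truncation cexpectationD ?cexpectation_cst ?subrr //.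
- exact: cintegrable_truncate.
- exact: cintegrable_cst.
Qed.

Let mt_int M : mu.-integrable setT (EFin \o (fun z => Normc.normc (truncate M z) ^+ 2)).
Proof.
apply: (integrable_dom _ sqr_int).
  by apply: measurable_normc_sqr; exact: cmeasurable_truncate.
by move=> z; rewrite ger0_norm ?sqr_ge0 // lerXn2r ?nnegrE ?normc_ge0 // normc_truncate_le.
Qed.

Lemma truncated_moment_le1 M : truncated_moment M <= 1.
Proof.
rewrite -sqr1; apply: ler_Rint => // z.
by rewrite lerXn2r ?nnegrE ?normc_ge0 // normc_truncate_le.
Qed.

Lemma truncated_moment_ge0 M : 0 <= truncated_moment M.
Proof. by apply: Rintegral_ge0 => z _; exact: sqr_ge0. Qed.

Lemma mulcJ_normc z : z * z^* = (Normc.normc z ^+ 2)%:C.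
Proof.
apply/eqP; rewrite normc_sqrE eq_complex; apply/andP; split => //.
by rewrite complexImM complexReJ complexImJ /= mulrN addrC mulrC subrr.
Qed.

Let truncJ_int M : cintegrable mu (fun z => z * (truncate M z)^*) /\
  cexpectation mu (fun z => z * (truncate M z)^*) = (truncated_moment M)%:C.
Proof.
have E : (fun z => z * (truncate M z)^*) = (fun z => (Normc.normc (truncate M z) ^+ 2)%:C).
  apply/funext => z; rewrite /truncate; case: ifPn => _; first exact: mulcJ_normc.
  by rewrite rmorph0 mulr0 Normc.normc0 expr0n.
by rewrite E; exact: cintegrable_real.
Qed.

(** The product of z with the conjugate of its truncation is the squared norm of the truncation, and
    centering does not alter the mixed moment because z has mean zero. *)
Lemma cexpectation_mul_truncation M :
  cintegrable mu (fun z => z * (centered_truncation M z)^*) /\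
  cexpectation mu (fun z => z * (centered_truncation M z)^*) = (truncated_moment M)%:C.
Proof.
have E : (fun z => z * (centered_truncation M z)^*) =
         (fun z => z * (truncate M z)^* + - (c M)^* * z).
  by apply/funext => z; rewrite /centered_truncation rmorphB mulrBr mulNr [_ * z]mulrC.
have [i1 e1] := truncJ_int M; have i2 := cintegrableZ (- (c M)^*) cintegrable_id.
rewrite E; split; first exact: cintegrableD.
by rewrite cexpectationD // e1 cexpectationZ ?mean0 ?mulr0 ?addr0 //; exact: cintegrable_id.
Qed.

Lemma sqr_centered_truncation M :
  mu.-integrable setT (EFin \o (fun z => Normc.normc (centered_truncation M z) ^+ 2)) /\
  \int[mu]_z (Normc.normc (centered_truncation M z) ^+ 2) <= truncated_moment M.
Proof.
have pw z : Normc.normc (centered_truncation M z) ^+ 2 =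
    Normc.normc (truncate M z) ^+ 2 +
    (Normc.normc (c M) ^+ 2 + -2 * complex.Re ((c M)^* * truncate M z)).
  rewrite /centered_truncation -/(c M); move: (truncate M z) (c M) => [x y] [x' y'].
  by rewrite !normc_sqr /=; ring.
have [iRe _] := cintegrableZ ((c M)^*) (cintegrable_truncate M).
have iA : mu.-integrable setT (EFin \o (fun z =>
    Normc.normc (c M) ^+ 2 + -2 * complex.Re ((c M)^* * truncate M z))).
  apply: integrable_addr; first exact: integrable_cst.
  exact: integrable_mull.
split; first by under eq_fun do rewrite pw; apply: integrable_addr.
under eq_Rintegral do rewrite pw.
rewrite RintD // RintD //; [|exact: integrable_cst|exact: integrable_mull].
rewrite Rint_cst RintZ //.
have -> : \int[mu]_z complex.Re ((c M)^* * truncate M z) = Normc.normc (c M) ^+ 2.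
  transitivity (complex.Re (cexpectation mu (fun z => (c M)^* * truncate M z))) => //.
  rewrite (cexpectationZ ((c M)^*) (cintegrable_truncate M)) -/(c M) normc_sqrE.
  by rewrite [in LHS]mulrC.
have := sqr_ge0 (Normc.normc (c M)); rewrite /truncated_moment; lra.
Qed.

Lemma cexpectation_sqr_truncation M : 0 <= M ->
  Normc.normc (cexpectation mu (fun z => centered_truncation M z ^+ 2)) <= 1.
Proof.
move=> M0; have [i1 i2] := sqr_centered_truncation M.
apply: (le_trans _ (truncated_moment_le1 M)); apply: (le_trans _ i2).
have nsq z : Normc.normc (centered_truncation M z ^+ 2) <=
    Normc.normc (centered_truncation M z) ^+ 2 by rewrite !expr2 Normc.normcM.
apply: normc_cexpectation => //; apply: cintegrable_dom i1 nsq.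
by under eq_fun do rewrite expr2; apply: cmeasurableM; exact: cmeasurable_centered_truncation.
Qed.

(** Dominated convergence, with the squared norm as dominating function. A second moment gives no
    rate, so the level has to be fixed before n. *)
Lemma truncated_moment_cvg (e : R) : 0 < e -> exists2 M, 0 <= M & 1 - e <= truncated_moment M.
Proof.
move=> e0.
pose F (n : nat) z : \bar R := (Normc.normc (truncate n%:R z) ^+ 2)%:E.
have : (\int[mu]_z F n z @[n --> \oo] --> \int[mu]_z (Normc.normc z ^+ 2)%:E)%E.
  apply: (dominated_cvg measurableT _ _ _ sqr_int) => //.
  - by move=> n; apply/measurable_EFinP; apply: measurable_normc_sqr; exact: cmeasurable_truncate.
  - move=> z _; apply: cvg_near_cst.
    near=> n; rewrite /F /truncate ifT //.
    near: n; exact: nbhs_infty_ger.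
  - move=> n z _; rewrite /F /= !lee_fin ger0_norm ?sqr_ge0 //.
    by rewrite lerXn2r ?nnegrE ?normc_ge0 // normc_truncate_le.
have E n : (\int[mu]_z F n z = (truncated_moment n%:R)%:E)%E.
  by rewrite /truncated_moment /Rintegral fineK //; exact: (integrable_fin_num measurableT (mt_int _)).
have -> : (\int[mu]_z (Normc.normc z ^+ 2)%:E = 1%:E)%E.
  by rewrite -sqr1 /Rintegral fineK //; exact: (integrable_fin_num measurableT sqr_int).
under eq_fun do rewrite E.
move=> /fine_cvgP[_ /cvgr_ge] /(_ (1 - e)).
rewrite /= ltrBlDr ltrDl => /(_ e0) [N _ /(_ N (leqnn N)) /= H].
by exists N%:R.
Unshelve. all: end_near.
Qed.

End Truncation.

(** * Measurability of events on eigenvalues *)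

Section EigenvalueEvents.
Context (R : realType).

Lemma normc_prod (I : Type) (s : seq I) (F : I -> R[i]) :
  Normc.normc (\prod_(i <- s) F i) = \prod_(i <- s) Normc.normc (F i).
Proof. by apply: (big_morph _ (@Normc.normcM R)); exact: Normc.normc1. Qed.

Lemma normcB_sym (x y : R[i]) : Normc.normc (x - y) = Normc.normc (y - x).
Proof. by rewrite -normcN opprB. Qed.

Lemma char_roots n (A : 'M[R[i]]_n) : exists rs : seq R[i],
  [/\ forall z, eigenvalue A z = (z \in rs), size rs = n &
      forall q, Normc.normc (\det (q%:M - A)) = \prod_(l <- rs) Normc.normc (q - l)].
Proof.
have [rs] := closed_field_poly_normal (char_poly A).
rewrite (monicP (char_poly_monic A)) scale1r => prs; exists rs; split.
- by move=> z; rewrite eigenvalue_root_char prs root_prod_XsubC.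
- by have := size_char_poly A; rewrite prs size_prod_XsubC => -[].
- move=> q; rewrite -normc_prod; congr Normc.normc.
  transitivity (char_poly A).[q]; last first.
    by rewrite prs horner_prod; apply: eq_bigr => l _; rewrite !hornerE.
  rewrite /char_poly -[RHS]/(horner_eval q (\det (char_poly_mx A))) -det_map_mx.
  congr (\det _); apply/matrixP => i j; rewrite !mxE /horner_eval /=.
  rewrite -[RHS]/(('X *+ (i == j) - (A i j)%:P).[q]).
  by rewrite hornerD hornerN hornerC hornerMn hornerX.
Qed.

Lemma complex_rat_dense (z : R[i]) (e : R) : 0 < e ->
  exists q : rat * rat, Normc.normc ((ratr q.1 +i* ratr q.2) - z) < e.
Proof.
move=> e0; have e2 : 0 < e / 2 by rewrite divr_gt0.
have dense (x : R) : exists q : rat, `|ratr q - x| < e / 2.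
  have : x - e / 2 < x + e / 2 by rewrite ltrD2l gtrN.
  move=> /rat_in_itvoo[q]; rewrite in_itv /= => /andP[q1 q2]; exists q.
  by rewrite ltr_norml; apply/andP; split; lra.
have [q1 h1] := dense (complex.Re z); have [q2 h2] := dense (complex.Im z).
exists (q1, q2); apply: le_lt_trans (normc_le_ReIm _) _.
by case: z h1 h2 => x y /= h1 h2; lra.
Qed.

(** This makes the condition countable. The determinant of q - A is the product of the n distances
    from q to the eigenvalues: if each is at least 1/(j+1), its norm is at least (j+1)^-n, so a
    smaller value reveals an eigenvalue within 1/(j+1) of q. The squares keep the condition
    polynomial in the entries. *)
Lemma eigenvalue_ge_approx n (A : 'M[R[i]]_n) (r : R) :
  (exists2 z, eigenvalue A z & r <= Normc.normc z) <->
  (forall j : nat, exists q : rat * rat,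
     r - j.+1%:R^-1 <= Normc.normc (ratr q.1 +i* ratr q.2 : R[i]) /\
     Normc.normc (\det ((ratr q.1 +i* ratr q.2)%:M - A)) ^+ 2 < (j.+1%:R^-1 ^+ n) ^+ 2).
Proof.
have [rs [rsE szrs detE]] := char_roots A.
have ij j : 0 < j.+1%:R^-1 :> R by rewrite invr_gt0 ltr0n.
split=> [[z]|H].
  rewrite rsE => zrs rz j.
  pose B : R := \prod_(l <- rem z rs) (1 + Normc.normc (z - l)).
  have B0 : 0 <= B by apply: prodr_ge0 => l _; rewrite addr_ge0 ?normc_ge0.
  (* The bound 1 keeps the other factors below those of [B], the bound 1/(j+1) controls the modulus
     of the approximation, and the last one brings the determinant below the threshold. *)
  pose e : R := Num.min (Num.min 1 j.+1%:R^-1) (j.+1%:R^-1 ^+ n / (1 + B)).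
  have e0 : 0 < e.
    by rewrite !lt_min ltr01 ij /= divr_gt0 ?exprn_gt0 // ltr_pwDl.
  have [q qz] := complex_rat_dense z e0; exists q.
  set u := _ +i* _ in qz *.
  have := qz; rewrite !lt_min => /andP[/andP[q1 qj] qn]; split.
    have : Normc.normc z <= Normc.normc u + Normc.normc (u - z).
      by rewrite normcB_sym -{1}(subrK u z) addrC le_normcD.
    by move=> nz; rewrite lerBlDr (le_trans rz) // (le_trans nz) // lerD2l ltW.
  rewrite ltr_pXn2r ?nnegrE ?normc_ge0 ?exprn_ge0 ?(ltW (ij _)) //.
  rewrite detE (perm_big _ (perm_to_rem zrs)) big_cons /=.
  have PB : \prod_(l <- rem z rs) Normc.normc (u - l) <= B.
    apply: ler_prod => l _; rewrite normc_ge0 /=.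
    by rewrite -(subrK z u) -addrA (le_trans (le_normcD _ _)) // lerD2r ltW.
  apply: (@le_lt_trans _ _ (Normc.normc (u - z) * (1 + B))).
    by rewrite ler_wpM2l ?normc_ge0 // (le_trans PB) // lerDr.
  by rewrite -ltr_pdivlMr // ltr_pwDl.
apply: contrapT => no.
have lt_r l : l \in rs -> Normc.normc l < r.
  by move=> lrs; rewrite ltNge; apply/negP => rl; apply: no; exists l; rewrite ?rsE.
(* There are finitely many eigenvalues, so they share a gap below [r]. *)
have [g g0 gP] : exists2 g : R, 0 < g & forall l, l \in rs -> Normc.normc l + g <= r.
  elim: (rs) lt_r => [|l s IH] lr; first by exists 1.
  have [|g g0 gP] := IH; first by move=> x xs; apply: lr; rewrite inE xs orbT.
  exists (Num.min g (r - Normc.normc l)).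
    by rewrite lt_min g0 subr_gt0 lr // inE eqxx.
  move=> x; rewrite inE => /orP[/eqP ->|xs].
    by rewrite -lerBrDl ge_min lexx orbT.
  by apply: le_trans (gP x xs); rewrite lerD2l ge_min lexx.
(* The quantity 1/(j+1) is spent twice: in the modulus of q and in its distance to an eigenvalue. *)
have [j jg] : exists j : nat, j.+1%:R^-1 + j.+1%:R^-1 < g.
  have [j] := ltr_add_invr g0.
  rewrite add0r => jg; exists (j.+1).*2.+1.
  have h : (j.+1).*2.+2%:R^-1 <= j.+1%:R^-1 / 2 :> R.
    rewrite -invfM lef_pV2 ?posrE ?ltr0n ?mulr_gt0 // -natrM ler_nat; lia.
  by move: h jg; move: ((j.+1).*2.+2%:R^-1) (j.+1%:R^-1) => x y; lra.
have [q [q1 q2]] := H j; set u := _ +i* _ in q1 q2.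
move: q2; rewrite ltr_pXn2r ?nnegrE ?normc_ge0 ?exprn_ge0 ?(ltW (ij _)) // detE.
apply/negP; rewrite -leNgt -szrs.
have big_c l : l \in rs -> j.+1%:R^-1 <= Normc.normc (u - l).
  move=> lrs; have := gP l lrs.
  have : Normc.normc u <= Normc.normc (u - l) + Normc.normc l.
    by rewrite -{1}(subrK l u) le_normcD.
  by move: (j.+1%:R^-1) q1 jg => x q1 jg nu ln; lra.
elim: (rs) big_c => [|l s IH] hl; first by rewrite big_nil expr0.
rewrite big_cons exprS ler_pM ?(ltW (ij _)) ?exprn_ge0 ?(ltW (ij _)) //.
  by apply: hl; rewrite inE eqxx.
by apply: IH => x xs; apply: hl; rewrite inE xs orbT.
Qed.

Lemma measurable_eigenvalues_lt d (T : measurableType d) n (A : T -> 'M[R[i]]_n) (r : R) :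
  (forall i j, cmeasurable (fun w => A w i j)) ->
  measurable [set w | forall z, eigenvalue (A w) z -> Normc.normc z < r].
Proof.
move=> mA.
pose q_ (k : nat) : rat * rat := odflt (0, 0) (unpickle k).
pose u_ k : R[i] := ratr (q_ k).1 +i* ratr (q_ k).2.
pose E j k := [set w | r - j.+1%:R^-1 <= Normc.normc (u_ k) /\
   Normc.normc (\det ((u_ k)%:M - A w)) ^+ 2 < (j.+1%:R^-1 ^+ n) ^+ 2].
have -> : [set w | forall z, eigenvalue (A w) z -> Normc.normc z < r] =
    ~` (\bigcap_(j in [set: nat]) \bigcup_(k in [set: nat]) E j k).
  apply/seteqP; split => w /=.
    move=> H Hc; case: (eigenvalue_ge_approx (A w) r) => _ back.
    case: back => [j|z zA rz].
      have [k _ Ek] := Hc j Logic.I; exists (q_ k); exact: Ek.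
    by have := H z zA; rewrite ltNge rz.
  move=> H z zA; rewrite ltNge; apply/negP => rz; apply: H => j _.
  case: (eigenvalue_ge_approx (A w) r) => fwd _.
  case: (fwd _ j) => [|q Hq]; first by exists z.
  have uE : u_ (pickle q) = ratr q.1 +i* ratr q.2 by rewrite /u_ /q_ pickleK.
  exists (pickle q) => //; case: Hq; rewrite -uE => h1 h2; exact: (conj h1 h2).
apply: measurableC; apply: bigcapT_measurable => j; apply: bigcupT_measurable => k.
have mdet : cmeasurable (fun w => \det ((u_ k)%:M - A w)).
  apply: cmeasurable_sum => s; apply: cmeasurableM; first exact: cmeasurable_cst.
  apply: cmeasurable_prod => i; under eq_fun do rewrite !mxE.
  apply: cmeasurableD; first exact: cmeasurable_cst.
  by under eq_fun do rewrite -mulN1r; apply: cmeasurableM; [exact: cmeasurable_cst|exact: mA].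
have [h|h] := pselect (r - j.+1%:R^-1 <= Normc.normc (u_ k)); last first.
  by rewrite (_ : E j k = set0) //; apply/seteqP; split => w // [].
rewrite (_ : E j k = (fun w => Normc.normc (\det ((u_ k)%:M - A w)) ^+ 2) @^-1`
    `]-oo, (j.+1%:R^-1 ^+ n) ^+ 2[); last first.
  apply/seteqP; split => [w [_ h2]|w]; first by rewrite /= in_itv.
  by rewrite /= in_itv /= => h2; exact: (conj h h2).
rewrite -[X in measurable X]setTI.
by apply: (measurable_normc_sqr mdet measurableT); exact: measurable_itv.
Qed.

End EigenvalueEvents.

(** * Moments of the coefficients *)

Section Monomials.
Variables (R : realType) (m n : nat).
Let VT : finType := ('I_m * 'I_n)%type.
Let V : finType := 'I_#|{: VT}|.
Let I : finType := ('I_m * 'I_n * 'I_n)%type.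
Implicit Types (w : {set V} * {perm V}) (t : I).

(** The entry (k, i, j) is the edge from vertex i of block k to vertex j of the next block. *)
Definition tail t : V := enum_rank ((t.1.1, t.1.2) : VT).
Definition head t : V := enum_rank ((ordS t.1.1, t.2) : VT).

Definition allowed w : bool :=
  [forall v in w.1, (enum_val (w.2 v) : VT).1 == ordS (enum_val v : VT).1].

Definition uses w t : bool := (tail t \in w.1) && (w.2 (tail t) == head t).

Let edge w (v : V) : I :=
  ((enum_val v : VT).1, (enum_val v : VT).2, (enum_val (w.2 v) : VT).2).

Lemma tail_edge w v : tail (edge w v) = v.
Proof. by rewrite /tail /edge /= -surjective_pairing enum_valK. Qed.

Lemma head_edge w v : allowed w -> v \in w.1 -> head (edge w v) = w.2 v.
Proof.
move=> /forallP /(_ v) /implyP h /h /eqP E.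
by rewrite /head /edge /= -E -surjective_pairing enum_valK.
Qed.

Lemma uses_edge w v : allowed w -> uses w (edge w v) = (v \in w.1).
Proof.
move=> aw; rewrite /uses tail_edge; case: (boolP (v \in w.1)) => //= vw.
by rewrite head_edge // eqxx.
Qed.

Lemma edge_tail w t : uses w t -> edge w (tail t) = t.
Proof.
move=> /andP[_ /eqP E]; rewrite /edge E /tail /head !enum_rankK /=.
by case: t {E} => -[].
Qed.

Lemma prod_uses (C : comPzRingType) w (f : I -> C) : allowed w ->
  \prod_(t | uses w t) f t = \prod_(v in w.1) f (edge w v).
Proof.
move=> aw; rewrite (reindex_onto (edge w) tail) => [|t]; last exact: edge_tail.
by apply: eq_bigl => v; rewrite uses_edge // tail_edge eqxx andbT.
Qed.

Lemma prod_uses_if (C : comPzRingType) w (f : I -> C) :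
  \prod_t (if uses w t then f t else 1) = \prod_(t | uses w t) f t.
Proof. by rewrite [RHS]big_mkcond. Qed.

(** Fixed points in a domain count as loops, so the edges determine both domain and permutation. Two
    distinct partial permutations therefore differ by an entry that occurs in only one of them,
    whence the orthogonality of monomials. *)
Lemma uses_inj w w' : perm_on w.1 w.2 -> perm_on w'.1 w'.2 ->
  allowed w -> allowed w' -> uses w =1 uses w' -> w = w'.
Proof.
case: w => D s; case: w' => D' s' /= Ds Ds' aw aw' E.
have sub (D1 D2 : {set V}) (s1 s2 : {perm V}) : allowed (D1, s1) ->
    uses (D1, s1) =1 uses (D2, s2) -> forall v, v \in D1 -> v \in D2 /\ s2 v = s1 v.
  move=> a1 E1 v vD; have := uses_edge v a1; rewrite vD E1.
  rewrite /uses tail_edge head_edge // => /andP[/= vD2 /eqP ->].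
  by [].
have DD : D = D'.
  apply/setP => v; apply/idP/idP => vD; first by case: (sub _ _ _ _ aw E v vD).
  by case: (sub _ _ _ _ aw' (fsym E) v vD).
congr (_, _) => //; apply/permP => v.
have [vD|vD] := boolP (v \in D); first by case: (sub _ _ _ _ aw E v vD).
by rewrite (out_perm Ds) // (out_perm Ds') // -DD.
Qed.

Definition entry_matrix (A : I -> R[i]) : 'M[R[i]]_#|{: VT}| :=
  block_cyclic (fun k => \matrix_(i, j) A (k, i, j)).

Lemma pmono_entries (A : I -> R[i]) w : allowed w ->
  pmono (entry_matrix A) w = \prod_t (if uses w t then A t else 1).
Proof.
move=> aw; rewrite prod_uses_if prod_uses //; apply: eq_bigr => v vw.
by rewrite !mxE ifT //; have /forallP /(_ v) /implyP := aw; exact.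
Qed.

Lemma pmono_not_allowed (A : I -> R[i]) w : ~~ allowed w -> pmono (entry_matrix A) w = 0.
Proof.
rewrite negb_forall => /existsP[v]; rewrite negb_imply => /andP[vw /negbTE nv].
by rewrite /pmono (bigD1 v) //= !mxE nv mul0r.
Qed.

Lemma card_allowed k :
  (#|[set w | pperm_of_size k w & allowed w]| <= k.+1 ^ m * n ^ k)%N.
Proof.
apply: (@card_block_pperms _ m n k (fun v : V => (enum_val v : VT).1)
  (fun v : V => (enum_val v : VT).2) (@ordS m)).
by move=> u v /= [e1 e2]; apply: enum_val_inj; rewrite [LHS]surjective_pairing
  [RHS]surjective_pairing e1 e2.
Qed.

Definition edge_mult (q : ({set V} * {perm V}) * ({set V} * {perm V})) t : nat :=
  (uses q.1 t + uses q.2 t)%N.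

(** The count on pairs of vertices applies to entries, since allowed partial permutations use no
    other pairs of vertices than the edges of entries. *)
Lemma card_support_edges k q q' :
  allowed q.1 -> allowed q.2 -> allowed q'.1 -> allowed q'.2 ->
  unlinked k q -> unlinked k q' ->
  (forall t, edge_mult q t + edge_mult q' t != 1)%N ->
  (exists t, (0 < edge_mult q t) && (0 < edge_mult q' t))%N ->
  (#|support q :|: support q'| < k)%N.
Proof.
move=> a1 a2 a1' a2' uq uq' mul [t tq].
have multE (p : _ * _) s : multiplicity p (tail s, head s) = edge_mult p s by [].
apply: card_support_lt => //; last by exists (tail t, head t); rewrite !multE.
move=> [u v]; have [uv|uv] := eqVneq (enum_val v : VT).1 (ordS (enum_val u : VT).1).
  pose s : I := ((enum_val u : VT).1, (enum_val u : VT).2, (enum_val v : VT).2).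
  have -> : (u, v) = (tail s, head s).
    by rewrite /tail /head /= -uv -!surjective_pairing !enum_valK.
  by rewrite !multE.
have no w : allowed w -> (u \in w.1) && (w.2 u == v) = false.
  move=> /forallP /(_ u) /implyP h; apply/negbTE/negP => /andP[/h /eqP E /eqP wv].
  by move: uv; rewrite -wv E eqxx.
by rewrite /multiplicity /= !no.
Qed.

End Monomials.

Section MonomialMoments.
Context d (T : measurableType d) (R : realType) (P : probability T R) (m n : nat).
Let VT : finType := ('I_m * 'I_n)%type.
Let V : finType := 'I_#|{: VT}|.
Let I : finType := ('I_m * 'I_n * 'I_n)%type.
Variables (a : I -> {RV P >-> R[i]}) (mu : probability R[i] R).
Hypothesis indep : mutually_independent a.
Hypothesis law : forall t, has_law (a t) mu.
Implicit Types (p : {set V} * {perm V}) (q : ({set V} * {perm V}) * ({set V} * {perm V})).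

Definition entries (f : R[i] -> R[i]) (w : T) : 'M[R[i]]_#|{: VT}| :=
  entry_matrix (fun t => f (a t w)).

Definition scale : R[i] := ((Num.sqrt n%:R)^-1)%:C.

Lemma normcX (x : R[i]) k : Normc.normc (x ^+ k) = Normc.normc x ^+ k.
Proof.
elim: k => [|k IH]; first by rewrite !expr0 Normc.normc1.
by rewrite !exprS Normc.normcM IH.
Qed.

Lemma normc_real (x : R) : Normc.normc x%:C = `|x|.
Proof. by rewrite /= expr0n /= addr0 sqrtr_sqr. Qed.

Lemma normc_psign p : Normc.normc (psign R[i] p) = 1.
Proof. by rewrite /psign Normc.normcM !normcX normcN Normc.normc1 !expr1n mulr1. Qed.

Lemma normc_scaleX k : (0 < n)%N -> Normc.normc (scale ^+ k) ^+ 2 = n%:R ^- k.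
Proof.
move=> n0; rewrite normcX normc_real exprAC real_normK ?num_real // exprVn sqr_sqrtr //.
by rewrite exprVn.
Qed.

(** If the two partial permutations differ, an entry present in only one monomial contributes its
    mean, zero. This form without conjugates gives the mean of P Q; the conjugated form below gives
    the second moments. *)
Lemma pair_moment (f g : R[i] -> R[i]) p p' :
  cmeasurable f -> cmeasurable g -> cintegrable mu f -> cintegrable mu g ->
  cintegrable mu (fun z => f z * g z) ->
  cexpectation mu f = 0 -> cexpectation mu g = 0 ->
  perm_on p.1 p.2 -> perm_on p'.1 p'.2 -> allowed p -> allowed p' ->
  cintegrable P (fun w => pmono (entries f w) p * pmono (entries g w) p') /\
  cexpectation P (fun w => pmono (entries f w) p * pmono (entries g w) p') =
  if p == p' then cexpectation mu (fun z => f z * g z) ^+ #|p.1| else 0.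
Proof.
move=> mf mg i_f i_g i_fg f0 g0 pP pP' ap ap'.
pose h t z : R[i] := (if uses p t then f z else 1) * (if uses p' t then g z else 1).
have E : (fun w => pmono (entries f w) p * pmono (entries g w) p') =
         (fun w => \prod_t h t (a t w)).
  by apply/funext => w; rewrite !pmono_entries // big_split.
have mh t : cmeasurable (h t).
  apply: cmeasurableM; [case: (uses p t)|case: (uses p' t)] => //; exact: cmeasurable_cst.
have ih t : cintegrable mu (h t).
  rewrite /h; case: (uses p t); case: (uses p' t) => //.
  - by under eq_fun do rewrite mulr1.
  - by under eq_fun do rewrite mul1r.
  - exact: cintegrable_cst.
have la t := law_cexpectation (law t) (mh t) (ih t).
have [iP eP] := cexpectation_prod indep mh (fun t => (la t).1).
rewrite E; split => //; rewrite eP.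
under eq_bigr => t _ do rewrite (la t).2.
case: eqVneq => [pp|pp].
  transitivity (\prod_t (if uses p t then cexpectation mu (fun z => f z * g z) else 1)).
    apply: eq_bigr => t _; rewrite /h -pp; case: (uses p t) => //.
    by under [X in cexpectation _ X]eq_fun do rewrite mul1r; rewrite cexpectation_cst.
  by rewrite prod_uses_if prod_uses // prodr_const.
have /existsP[t ut] : [exists t, uses p t != uses p' t].
  apply: contraNT pp => /existsPn H; apply/eqP; apply: uses_inj => // t.
  by apply/eqP; rewrite -[_ == _]negbK H.
rewrite (bigD1 t) //=; move: ut; rewrite /h.
case: (uses p t); case: (uses p' t) => // _.
  by under [X in cexpectation _ X]eq_fun do rewrite mulr1; rewrite f0 mul0r.
by under [X in cexpectation _ X]eq_fun do rewrite mul1r; rewrite g0 mul0r.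
Qed.

Lemma pmonoJ (f : R[i] -> R[i]) w p : allowed p ->
  (pmono (entries f w) p)^* = pmono (entries (fun z => (f z)^*) w) p.
Proof.
move=> ap; rewrite !pmono_entries // rmorph_prod; apply: eq_bigr => t _.
by case: (uses p t); rewrite // rmorph1.
Qed.

Lemma pair_momentJ (f g : R[i] -> R[i]) p p' :
  cmeasurable f -> cmeasurable g -> cintegrable mu f -> cintegrable mu g ->
  cintegrable mu (fun z => f z * (g z)^*) ->
  cexpectation mu f = 0 -> cexpectation mu g = 0 ->
  perm_on p.1 p.2 -> perm_on p'.1 p'.2 -> allowed p -> allowed p' ->
  cintegrable P (fun w => pmono (entries f w) p * (pmono (entries g w) p')^*) /\
  cexpectation P (fun w => pmono (entries f w) p * (pmono (entries g w) p')^*) =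
  if p == p' then cexpectation mu (fun z => f z * (g z)^*) ^+ #|p.1| else 0.
Proof.
move=> mf mg i_f i_g i_fg f0 g0 pP pP' ap ap'.
under [X in cintegrable _ X]eq_fun do rewrite pmonoJ //.
under [X in cexpectation _ X]eq_fun do rewrite pmonoJ //.
have [iJ eJ] := cexpectationJ i_g.
by apply: pair_moment => //; [exact: cmeasurableJ|rewrite eJ g0 rmorph0].
Qed.

(* [F p] are orthogonal with common squared norm [S <= S']; the number of admissible
   [p] is at most [(k+1)^m n^k], which the factor [scale ^+ k] normalizes. *)
Lemma uexp_orthogonal k (F : {set V} * {perm V} -> T -> R[i]) (s : {set V} * {perm V} -> R[i]) (S S' : R) :
  (0 < n)%N -> 0 <= S' -> S <= S' -> (forall p, Normc.normc (s p) = 1) ->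
  (forall p p', pperm_of_size k p -> pperm_of_size k p' -> allowed p -> allowed p' ->
     cintegrable P (fun w => F p w * (F p' w)^*) /\
     cexpectation P (fun w => F p w * (F p' w)^*) = if p == p' then S%:C else 0) ->
  uexp_le P (fun w => Normc.normc (scale ^+ k *
      \sum_(p | pperm_of_size k p && allowed p) s p * F p w) ^+ 2)
    (k.+1%:R ^+ m * S').
Proof.
move=> n0 S0 SS s1 H.
have iF p p' : pperm_of_size k p && allowed p -> pperm_of_size k p' && allowed p' ->
    cintegrable P (fun w => F p w * (F p' w)^*).
  by move=> /andP[k1 a1] /andP[k2 a2]; case: (H p p').
have [i1 e1] := sqr_normc_sum (fun p => scale ^+ k * s p) iF.
have E w : \sum_(p | pperm_of_size k p && allowed p) scale ^+ k * s p * F p w =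
    scale ^+ k * \sum_(p | pperm_of_size k p && allowed p) s p * F p w.
  by rewrite big_distrr; apply: eq_bigr => p _; rewrite -mulrA.
under eq_fun do rewrite -E.
exists (fun w => Normc.normc (\sum_(p | pperm_of_size k p && allowed p)
   scale ^+ k * s p * F p w) ^+ 2); split => //.
rewrite e1.
have -> : \sum_(p | pperm_of_size k p && @allowed m n p)
   \sum_(p' | pperm_of_size k p' && @allowed m n p')
      scale ^+ k * s p * (scale ^+ k * s p')^* * cexpectation P (fun w => F p w * (F p' w)^*) =
   (\sum_(p | pperm_of_size k p && @allowed m n p) n%:R ^- k * S)%:C.
  rewrite rmorph_sum; apply: eq_bigr => p /[dup] pP /andP[kp ap].
  rewrite (bigD1 p) //= big1 => [|p' /andP[/andP[kp' ap'] pp]]; last first.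
    by rewrite (H _ _ kp kp' ap ap').2 eq_sym (negbTE pp) mulr0.
  rewrite (H _ _ kp kp ap ap).2 eqxx addr0 mulcJ_normc Normc.normcM s1 mulr1.
  by rewrite normc_scaleX // rmorphM.
rewrite /= -mulr_suml; apply: (@le_trans _ _ (
  (\sum_(p | pperm_of_size k p && @allowed m n p) n%:R ^- k) * S')).
  by rewrite ler_wpM2l // sumr_ge0 // => p _; rewrite invr_ge0 exprn_ge0.
rewrite ler_wpM2r // sumr_const -[X in X <= _]mulr_natl.
rewrite ler_pdivrMr ?exprn_gt0 ?ltr0n // -!natrX -natrM ler_nat.
by have := card_allowed m n k; rewrite cardsE.
Qed.

End MonomialMoments.

Lemma cmeasurableX d (T : measurableType d) (R : realType) (f : T -> R[i]) k :
  cmeasurable f -> cmeasurable (fun w => f w ^+ k).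
Proof.
move=> mf; elim: k => [|k IH].
  by under eq_fun do rewrite expr0; exact: cmeasurable_cst.
by under eq_fun do rewrite exprS; exact: cmeasurableM.
Qed.

Lemma sum_pperm_sizes (C : numFieldType) (V : finType) N (x : C) (f : {set V} * {perm V} -> C) :
  #|V| = N ->
  \sum_(i < N.+1) x ^+ i * (\sum_(p | pperm_of_size i p) f p) =
  \sum_(p : {set V} * {perm V} | perm_on p.1 p.2) x ^+ #|p.1| * f p.
Proof.
move=> VN.
rewrite [RHS](partition_big (fun p : {set V} * {perm V} => inord #|p.1| : 'I_N.+1) predT) //=.
apply: eq_bigr => i _; rewrite big_distrr /=.
have cardi (D : {set V}) : (inord #|D| == i :> 'I_N.+1) = (#|D| == i :> nat).
  by rewrite -(inj_eq val_inj) /= inordK // ltnS -VN max_card.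
rewrite [RHS](eq_bigl (fun p => pperm_of_size i p)); last by move=> p; rewrite cardi.
by apply: eq_bigr => p /andP[_ /eqP ->].
Qed.

Lemma cauchy_product (C : numFieldType) N (x y : nat -> C) :
  (forall i, (N < i)%N -> x i = 0) -> (forall i, (N < i)%N -> y i = 0) ->
  (\sum_(i < N.+1) x i) * (\sum_(i < N.+1) y i) =
  \sum_(k < N.*2.+1) \sum_(i < k.+1) x i * y (k - i)%N.
Proof.
move=> x0 y0; pose p := \poly_(i < N.+1) x i; pose q := \poly_(i < N.+1) y i.
have coefP (z : nat -> C) i : (forall i, (N < i)%N -> z i = 0) -> (\poly_(i < N.+1) z i)`_i = z i.
  by move=> z0; rewrite coef_poly; case: ltnP => // Ni; rewrite z0.
have sz (z : nat -> C) : (size (\poly_(i < N.+1) z i) <= N.+1)%N by exact: size_poly.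
have h1 (z : nat -> C) : \sum_(i < N.+1) z i = (\poly_(i < N.+1) z i).[1].
  by rewrite horner_poly; apply: eq_bigr => i _; rewrite expr1n mulr1.
rewrite !h1 -hornerM (@horner_coef_wide _ N.*2.+1); last first.
  apply: leq_trans (size_polyMleq _ _) _; rewrite -subn1 leq_subLR.
  by apply: leq_trans (leq_add (sz x) (sz y)) _; rewrite -addnn; lia.
apply: eq_bigr => k _; rewrite expr1n mulr1 coefM.
by apply: eq_bigr => i _; rewrite !coefP.
Qed.

Lemma esum_gt0 (C : numFieldType) (V : finType) (y : V -> V -> C) k : (#|V| < k)%N ->
  esum y k = 0 /\ psum y k = 0.
Proof.
move=> Vk; have no (w : {set V} * {perm V}) : pperm_of_size k w = false.
  apply/negP => /andP[_ /eqP E]; move: Vk; rewrite -E ltnNge max_card //.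
by rewrite /esum /psum !big_pred0.
Qed.

(** * Second moments for true and truncated entries *)

Section TruncatedProducts.
Context d (T : measurableType d) (R : realType) (P : probability T R) (m n : nat).
Let VT : finType := ('I_m * 'I_n)%type.
Let V : finType := 'I_#|{: VT}|.
Let I : finType := ('I_m * 'I_n * 'I_n)%type.
Variables (a : I -> {RV P >-> R[i]}) (mu : probability R[i] R).
Hypothesis indep : mutually_independent a.
Hypothesis law : forall t, has_law (a t) mu.
Hypothesis mean0 : cexpectation mu id = 0.
Hypothesis sqr_int : mu.-integrable setT (EFin \o (fun z => Normc.normc z ^+ 2)).
Hypothesis sqr1 : \int[mu]_z (Normc.normc z ^+ 2) = 1.
Hypothesis n0 : (0 < n)%N.
Variable M : R.
Hypothesis M0 : 0 <= M.
Implicit Types (p : {set V} * {perm V}) (q : ({set V} * {perm V}) * ({set V} * {perm V})).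

Let phi := centered_truncation mu M.
Let v := truncated_moment mu M.
Let b : R := 2 * (1 + M).
Let c : R[i] := scale R n.
Let X w := entries a id w.
Let Y w := entries a phi w.

Let mphi : cmeasurable phi. Proof. exact: cmeasurable_centered_truncation. Qed.
Let mid : cmeasurable (id : R[i] -> R[i]). Proof. exact: cmeasurable_idfun. Qed.
Let b0 : 0 <= b. Proof. by rewrite /b mulr_ge0 // addr_ge0. Qed.
Let phib z : Normc.normc (phi z) <= b. Proof. exact: normc_centered_truncation. Qed.
Let iphi : cintegrable mu phi. Proof. exact: (cintegrable_dom mphi (integrable_cst mu b) phib). Qed.
Let iid : cintegrable mu id. Proof. by apply: cintegrable_id. Qed.
Let phi0 : cexpectation mu phi = 0. Proof. exact: cexpectation_centered_truncation. Qed.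

Let s : R := \int[mu]_z (Normc.normc (phi z) ^+ 2).

Let sJ (f : R[i] -> R[i]) : mu.-integrable setT (EFin \o (fun z => Normc.normc (f z) ^+ 2)) ->
  cintegrable mu (fun z => f z * (f z)^*) /\
  cexpectation mu (fun z => f z * (f z)^*) = (\int[mu]_z (Normc.normc (f z) ^+ 2))%:C.
Proof.
move=> h; under [X in cintegrable _ X]eq_fun do rewrite mulcJ_normc.
by under [X in cexpectation _ X]eq_fun do rewrite mulcJ_normc; exact: cintegrable_real.
Qed.

Let s0 : 0 <= s. Proof. by apply: Rintegral_ge0 => z _; exact: sqr_ge0. Qed.
Let sv : s <= v. Proof. by case: (sqr_centered_truncation sqr_int M). Qed.
Let v0 : 0 <= v. Proof. exact: truncated_moment_ge0. Qed.
Let v1 : v <= 1. Proof. by apply: truncated_moment_le1. Qed.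

Lemma esum_allowed (f : R[i] -> R[i]) w k : esum (entries a f w) k =
  \sum_(p | pperm_of_size k p && allowed p) psign R[i] p * pmono (entries a f w) p.
Proof.
rewrite /esum (bigID (fun p => @allowed m n p)) /= [X in _ + X]big1 ?addr0 // => p /andP[_ ap].
by rewrite /entries pmono_not_allowed // mulr0.
Qed.

Lemma psum_allowed (f : R[i] -> R[i]) w k : psum (entries a f w) k =
  \sum_(p | pperm_of_size k p && allowed p) 1 * pmono (entries a f w) p.
Proof.
rewrite /psum (bigID (fun p => @allowed m n p)) /= [X in _ + X]big1 ?addr0; last first.
  by move=> p /andP[_ ap]; rewrite /entries pmono_not_allowed.
by apply: eq_bigr => p _; rewrite mul1r.
Qed.

Let phi_orth k p p' : pperm_of_size k p -> pperm_of_size k p' -> allowed p -> allowed p' ->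
  cintegrable P (fun w => pmono (Y w) p * (pmono (Y w) p')^*) /\
  cexpectation P (fun w => pmono (Y w) p * (pmono (Y w) p')^*) =
  if p == p' then (s ^+ k)%:C else 0.
Proof.
move=> /andP[pP /eqP pk] /andP[pP' _] ap ap'.
have [i1 e1] := sJ (sqr_centered_truncation sqr_int M).1.
have [h1 h2] := pair_momentJ indep law mphi mphi iphi iphi i1 phi0 phi0 pP pP' ap ap'.
by split => //; rewrite h2 e1 pk rmorphXn.
Qed.

Lemma sqr_esum k :
  uexp_le P (fun w => Normc.normc (c ^+ k * esum (Y w) k) ^+ 2) (k.+1%:R ^+ m).
Proof.
under [X in uexp_le _ X]eq_fun do rewrite esum_allowed.
rewrite -[X in uexp_le _ _ X]mulr1; apply: uexp_orthogonal (@phi_orth k) => //.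
  by apply: exprn_ile1 => //; exact: le_trans sv v1.
exact: normc_psign.
Qed.

Lemma sqr_psum k :
  uexp_le P (fun w => Normc.normc (c ^+ k * psum (Y w) k) ^+ 2) (k.+1%:R ^+ m).
Proof.
under [X in uexp_le _ X]eq_fun do rewrite psum_allowed.
rewrite -[X in uexp_le _ _ X]mulr1; apply: uexp_orthogonal (@phi_orth k) => //.
  by apply: exprn_ile1 => //; exact: le_trans sv v1.
by move=> _; exact: Normc.normc1.
Qed.

Lemma sqr_esumB k :
  uexp_le P (fun w => Normc.normc (c ^+ k * (esum (X w) k - esum (Y w) k)) ^+ 2)
    (k.+1%:R ^+ m * (2 * (1 - v ^+ k))).
Proof.
under [X in uexp_le _ X]eq_fun => w.
  rewrite !esum_allowed -sumrB.
  under eq_bigr => p _ do rewrite -mulrBr.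
  over.
have sk1 : s ^+ k <= 1 by apply: exprn_ile1 => //; exact: le_trans sv v1.
have vk1 : v ^+ k <= 1 by apply: exprn_ile1.
(* The squared norm of a difference of two monomials: 1 for the true entries, [v ^+ k] subtracted
   for each mixed moment, and [s ^+ k] for the truncated entries. As [s ^+ k <= 1], it is at most
   [2 * (1 - v ^+ k)]. *)
apply: (uexp_orthogonal (S := 1 - v ^+ k - v ^+ k + s ^+ k)) => //.
- by rewrite mulr_ge0 // subr_ge0.
- by lra.
- exact: normc_psign.
move=> p p' /[dup] kp /andP[pP /eqP pk] /[dup] kp' /andP[pP' /eqP pk'] ap ap'.
have [i1 e1] := sJ sqr_int.
have [i2 e2] := cexpectation_mul_truncation mean0 sqr_int M.
have [i3 e3] : cintegrable mu (fun z => phi z * z^*) /\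
    cexpectation mu (fun z => phi z * z^*) = v%:C.
  have EJ : (fun z => (z * (centered_truncation mu M z)^*)^*) = (fun z => phi z * z^*).
    by apply/funext => z; rewrite rmorphM /= conjCK mulrC.
  have := cexpectationJ i2; rewrite e2 EJ.
  by case=> h1 h2; split => //; rewrite h2; exact: conjc_real.
have [h1 g1] := pair_momentJ indep law mid mid iid iid i1 mean0 mean0 pP pP' ap ap'.
have [h2 g2] := pair_momentJ indep law mid mphi iid iphi i2 mean0 phi0 pP pP' ap ap'.
have [h3 g3] := pair_momentJ indep law mphi mid iphi iid i3 phi0 mean0 pP pP' ap ap'.
have [h4 g4] := phi_orth kp kp' ap ap'.
have E : (fun w => (pmono (X w) p - pmono (Y w) p) * (pmono (X w) p' - pmono (Y w) p')^*) =
  (fun w => (pmono (X w) p * (pmono (X w) p')^* + -1 * (pmono (X w) p * (pmono (Y w) p')^*)) +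
            (-1 * (pmono (Y w) p * (pmono (X w) p')^*) + pmono (Y w) p * (pmono (Y w) p')^*)).
  by apply/funext => w; rewrite rmorphB; ring.
have j2 := cintegrableZ (-1) h2; have j3 := cintegrableZ (-1) h3.
have k1 := cintegrableD h1 j2; have k2 := cintegrableD j3 h4.
rewrite [X in cintegrable _ X]E [X in cexpectation _ X]E; split; first exact: cintegrableD.
rewrite cexpectationD // !cexpectationD // !cexpectationZ // g1 g2 g3 g4 e1 sqr1 e2 e3 pk.
case: eqP => _; last by rewrite !mulr0 !addr0.
by rewrite rmorph1 expr1n !rmorphD !rmorphN !rmorphXn rmorph1 /=; ring.
Qed.

End TruncatedProducts.

Lemma normc_sum_le (R : realType) (J : Type) (r : seq J) (Q : pred J) (F : J -> R[i]) :
  Normc.normc (\sum_(j <- r | Q j) F j) <= \sum_(j <- r | Q j) Normc.normc (F j).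
Proof.
elim: r => [|j r IH]; first by rewrite !big_nil Normc.normc0.
rewrite !big_cons; case: (Q j) => //.
by apply: le_trans (le_normcD _ _) _; rewrite lerD2l.
Qed.

Lemma complexRe_le_normc (R : realType) (x : R[i]) : complex.Re x <= Normc.normc x.
Proof. by apply: le_trans (ler_norm _) _; case: (ler_ReIm_normc x). Qed.

Lemma normcJ_eq (R : realType) (x : R[i]) : Normc.normc (x^*) = Normc.normc x.
Proof. by case: x => x y /=; rewrite sqrrN. Qed.

(** * Covariances and the variance of the coefficients of P Q *)

Section Covariance.
Context d (T : measurableType d) (R : realType) (P : probability T R).
Variables (f g : T -> R[i]).
Hypotheses (iF : cintegrable P f) (iG : cintegrable P g)
  (iFG : cintegrable P (fun w => f w * (g w)^*)).

Lemma covariance_cexpectation :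
  cintegrable P (fun w => (f w - cexpectation P f) * (g w - cexpectation P g)^*) /\
  cexpectation P (fun w => (f w - cexpectation P f) * (g w - cexpectation P g)^*) =
  cexpectation P (fun w => f w * (g w)^*) - cexpectation P f * (cexpectation P g)^*.
Proof.
set x := cexpectation P f; set y := cexpectation P g.
have [iJ eJ] := cexpectationJ iG.
have E : (fun w => (f w - x) * (g w - y)^*) =
  (fun w => (f w * (g w)^* + (- y^*) * f w) + ((- x) * (g w)^* + x * y^*)).
  by apply/funext => w; rewrite rmorphB; ring.
have i1 := cintegrableZ (- y^*) iF; have i2 := cintegrableZ (- x) iJ.
have i3 := cintegrable_cst P (x * y^*).
have j1 := cintegrableD iFG i1; have j2 := cintegrableD i2 i3.
rewrite E; split; first exact: cintegrableD.
rewrite (cexpectationD j1 j2) (cexpectationD iFG i1) (cexpectationD i2 i3).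
by rewrite (cexpectationZ _ iF) (cexpectationZ _ iJ) cexpectation_cst eJ -/x -/y; ring.
Qed.

End Covariance.

Section Variance.
Context d (T : measurableType d) (R : realType) (P : probability T R) (m n : nat).
Let VT : finType := ('I_m * 'I_n)%type.
Let V : finType := 'I_#|{: VT}|.
Let I : finType := ('I_m * 'I_n * 'I_n)%type.
Variables (a : I -> {RV P >-> R[i]}) (mu : probability R[i] R).
Hypothesis indep : mutually_independent a.
Hypothesis law : forall t, has_law (a t) mu.
Variables (phi : R[i] -> R[i]) (b : R).
Hypothesis mphi : cmeasurable phi.
Hypothesis b0 : 0 <= b.
Hypothesis phib : forall z, Normc.normc (phi z) <= b.
Hypothesis phi0 : cexpectation mu phi = 0.
Hypothesis n0 : (0 < n)%N.
Hypothesis m0 : (0 < m)%N.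
Implicit Types (p : {set V} * {perm V}) (q : ({set V} * {perm V}) * ({set V} * {perm V})).

Let c : R[i] := scale R n.
Let Y w := entries a phi w.

Definition conv_coef w k : R[i] :=
  c ^+ k * \sum_(i < k.+1) esum (Y w) i * psum (Y w) (k - i)%N.

Let F q w := pmono (Y w) q.1 * pmono (Y w) q.2.

Let good k q := unlinked k q && (allowed q.1 && allowed q.2).

Let conv_coefE w k : conv_coef w k = \sum_(q | good k q) c ^+ k * psign R[i] q.1 * F q w.
Proof.
rewrite /conv_coef conv_esum_psum big_distrr /=.
rewrite (bigID (fun q => allowed q.1 && allowed q.2)) /= [X in _ + X]big1 ?addr0.
  by apply: eq_bigr => q _; rewrite -[RHS]mulrA.
move=> q /andP[_]; rewrite negb_and => /orP[] na.
  by rewrite /Y /entries (pmono_not_allowed _ na) mul0r !mulr0.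
by rewrite /Y /entries [X in _ * (_ * (_ * X))](pmono_not_allowed _ na) !mulr0.
Qed.

Let F_power q w : allowed q.1 -> allowed q.2 ->
  F q w = \prod_t phi (a t w) ^+ edge_mult q t.
Proof.
move=> a1 a2; rewrite /F /Y !pmono_entries // -big_split; apply: eq_bigr => t _.
by rewrite /edge_mult exprD; case: (uses q.1 t); case: (uses q.2 t).
Qed.

Let mu_ x y := cexpectation mu (fun z => phi z ^+ x * (phi z ^+ y)^*).

Let power_moment (e e' : I -> nat) :
  let G w := \prod_t phi (a t w) ^+ e t * (\prod_t phi (a t w) ^+ e' t)^* in
  cintegrable P G /\ cexpectation P G = \prod_t mu_ (e t) (e' t).
Proof.
move=> G.
pose h t z := phi z ^+ e t * (phi z ^+ e' t)^*.
have -> : G = (fun w => \prod_t h t (a t w)).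
  by apply/funext => w; rewrite /G rmorph_prod -big_split.
have mh t : cmeasurable (h t).
  by apply: cmeasurableM; [|apply: cmeasurableJ]; exact: cmeasurableX.
have ih t : cintegrable mu (h t).
  apply: (cintegrable_dom (mh t) (integrable_cst mu (b ^+ e t * b ^+ e' t))) => z.
  rewrite Normc.normcM normcJ_eq !normcX ler_pM ?exprn_ge0 ?normc_ge0 //;
    by rewrite lerXn2r ?nnegrE ?normc_ge0.
have la t := law_cexpectation (law t) (mh t) (ih t).
have [i1 e1] := cexpectation_prod indep mh (fun t => (la t).1).
by split => //; rewrite e1; apply: eq_bigr => t _; rewrite (la t).2.
Qed.

Let FF q q' : allowed q.1 -> allowed q.2 -> allowed q'.1 -> allowed q'.2 ->
  cintegrable P (fun w => F q w * (F q' w)^*) /\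
  cexpectation P (fun w => F q w * (F q' w)^*) =
    \prod_t mu_ (edge_mult q t) (edge_mult q' t).
Proof.
move=> a1 a2 a1' a2'.
have -> : (fun w => F q w * (F q' w)^*) = (fun w =>
    \prod_t phi (a t w) ^+ edge_mult q t * (\prod_t phi (a t w) ^+ edge_mult q' t)^*).
  by apply/funext => w; rewrite !F_power.
exact: power_moment.
Qed.

Let F1 q : allowed q.1 -> allowed q.2 ->
  cintegrable P (F q) /\ cexpectation P (F q) = \prod_t mu_ (edge_mult q t) 0.
Proof.
move=> a1 a2; have := power_moment (edge_mult q) (fun=> 0%N).
rewrite /= (_ : (fun w => _) = F q) //; apply/funext => w.
by rewrite [X in _ * X^*]big1 ?rmorph1 ?mulr1 // F_power.
Qed.

Let mu00 : mu_ 0 0 = 1.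
Proof.
rewrite /mu_; under [X in cexpectation _ X]eq_fun do rewrite !expr0 rmorph1 mulr1.
exact: cexpectation_cst.
Qed.

Let iphi : cintegrable mu phi.
Proof. exact: (cintegrable_dom mphi (integrable_cst mu b) phib). Qed.

Let mu10 : mu_ 1 0 = 0.
Proof.
rewrite /mu_; under [X in cexpectation _ X]eq_fun do rewrite expr0 rmorph1 mulr1 expr1.
exact: phi0.
Qed.

Let mu0J x : mu_ 0 x = (mu_ x 0)^*.
Proof.
have ih : cintegrable mu (fun z => phi z ^+ x).
  apply: (cintegrable_dom (cmeasurableX x mphi) (integrable_cst mu (b ^+ x))) => z.
  by rewrite normcX lerXn2r ?nnegrE ?normc_ge0.
rewrite /mu_; under [X in cexpectation _ X = _]eq_fun do rewrite expr0 mul1r.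
under [X in _ = (cexpectation _ X)^*]eq_fun do rewrite expr0 rmorph1 mulr1.
by rewrite (cexpectationJ ih).2.
Qed.

Let cov q q' := \prod_t mu_ (edge_mult q t) (edge_mult q' t) -
  \prod_t mu_ (edge_mult q t) 0 * (\prod_t mu_ (edge_mult q' t) 0)^*.

(** An entry of total multiplicity one has mean zero and kills both terms. If no entry is shared,
    the two monomials are independent. In the remaining case, where an entry is shared and none
    occurs just once, [card_support_edges] makes the support small. *)
Let cov_eq0 k q q' : good k q -> good k q' ->
  ~~ (#|support q :|: support q'| < k)%N -> cov q q' = 0.
Proof.
move=> /andP[uq /andP[a1 a2]] /andP[uq' /andP[a1' a2']] large.
have [/existsP[t /eqP t1]|/existsPn mul] :=
    boolP [exists t, (edge_mult q t + edge_mult q' t == 1)%N].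
  rewrite /cov (bigD1 t) //= [X in _ - X * _](bigD1 t) //= [X in _ - _ * X^*](bigD1 t) //=.
  move: t1; case: (edge_mult q t) => [|[|x]]; case: (edge_mult q' t) => [|[|y]] // _.
    by rewrite mu0J mu10 rmorph0 !mul0r rmorph0 !mulr0 subrr.
  by rewrite mu10 !mul0r subrr.
have [/existsP[t tt]|/existsPn no] :=
    boolP [exists t, (0 < edge_mult q t)%N && (0 < edge_mult q' t)%N].
  by move/negP: large; case; apply: card_support_edges => //; exists t.
rewrite /cov rmorph_prod -big_split; apply/eqP; rewrite subr_eq0; apply/eqP.
apply: eq_bigr => t _ /=; have := no t.
case: (edge_mult q t) => [|x]; first by rewrite mu0J mu00 mul1r.
by case: (edge_mult q' t) => // _; rewrite mu00 rmorph1 mulr1.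
Qed.

Let F_bound k q w : good k q -> Normc.normc (F q w) <= b ^+ k.
Proof.
move=> /andP[/andP[/andP[_ /eqP <-] _] _].
have pb p : Normc.normc (pmono (Y w) p) <= b ^+ #|p.1|.
  rewrite /pmono (big_morph _ (@Normc.normcM R) (@Normc.normc1 R)) -prodr_const.
  apply: ler_prod => u _; rewrite normc_ge0 /= !mxE; case: ifP => _ //.
  by rewrite Normc.normc0.
by rewrite Normc.normcM exprD ler_pM ?normc_ge0.
Qed.

Let G q w := F q w - cexpectation P (F q).

Let GG k q q' : good k q -> good k q' ->
  cintegrable P (fun w => G q w * (G q' w)^*) /\
  cexpectation P (fun w => G q w * (G q' w)^*) = cov q q'.
Proof.
move=> /andP[_ /andP[a1 a2]] /andP[_ /andP[a1' a2']].
have [i1 e1] := F1 a1 a2; have [i2 e2] := F1 a1' a2'.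
have [i3 e3] := FF a1 a2 a1' a2'.
have [h1 h2] := covariance_cexpectation i1 i2 i3.
by split => //; rewrite h2 e1 e2 e3.
Qed.

Let cov_bound k q q' : good k q -> good k q' -> Normc.normc (cov q q') <= 4 * b ^+ k * b ^+ k.
Proof.
move=> gq gq'; have [h1 <-] := GG gq gq'.
have Gb q1 w : good k q1 -> Normc.normc (G q1 w) <= 2 * b ^+ k.
  move=> g1; rewrite /G; apply: le_trans (le_normcD _ _) _; rewrite normcN mulr2n mulrDl mul1r.
  rewrite lerD ?(F_bound w g1) // -[leRHS](Rint_cst P).
  apply: normc_cexpectation; last by move=> w'; exact: F_bound g1.
    by case/andP: g1 => _ /andP[a1 a2]; case: (F1 a1 a2).
  exact: integrable_cst.
rewrite -[leRHS](Rint_cst P); apply: normc_cexpectation => //; first exact: integrable_cst.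
move=> w; rewrite Normc.normcM normcJ_eq.
have -> : 4 * b ^+ k * b ^+ k = (2 * b ^+ k) * (2 * b ^+ k) by ring.
by rewrite ler_pM ?normc_ge0 ?Gb.
Qed.

(** The count of [card_quads] for m n vertices, stripped of its power of n, times the bound on one
    covariance. It depends on the truncation level through [b], but not on n. *)
Definition variance_const k : R :=
  k%:R * m%:R ^+ k.-1 * ((2 ^ k * k`!) ^ 4)%:R * (4 * b ^+ k * b ^+ k).

Lemma cintegrable_conv_coef k : cintegrable P (conv_coef ^~ k).
Proof.
have iF q : good k q -> cintegrable P (F q).
  by move=> /andP[_ /andP[a1 a2]]; case: (F1 a1 a2).
have [h _] := cexpectation_sum (index_enum _) (fun q => c ^+ k * psign R[i] q.1) iF.
have -> : conv_coef ^~ k = (fun w => \sum_(q | good k q) c ^+ k * psign R[i] q.1 * F q w).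
  by apply/funext => w; exact: conv_coefE.
by [].
Qed.

Lemma variance_conv_coef k :
  uexp_le P (fun w => Normc.normc (conv_coef w k - cexpectation P (conv_coef ^~ k)) ^+ 2)
    (variance_const k / n%:R).
Proof.
pose al q := c ^+ k * psign R[i] q.1.
have iF q : good k q -> cintegrable P (F q).
  by move=> /andP[_ /andP[a1 a2]]; case: (F1 a1 a2).
have [_ e0] := cexpectation_sum (index_enum _) al iF.
have E w : conv_coef w k - cexpectation P (conv_coef ^~ k) = \sum_(q | good k q) al q * G q w.
  rewrite conv_coefE (_ : conv_coef ^~ k = (fun w => \sum_(q | good k q) al q * F q w)); last first.
    by apply/funext => w'; exact: conv_coefE.
  by rewrite e0 -sumrB; apply: eq_bigr => q _; rewrite -mulrBr.
under [X in uexp_le _ X]eq_fun do rewrite E.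
have iGG q q' : good k q -> good k q' -> cintegrable P (fun w => G q w * (G q' w)^*).
  by move=> gq gq'; case: (GG gq gq').
have [i1 e1] := @sqr_normc_sum _ T R P _ (good k) al G iGG.
exists (fun w => Normc.normc (\sum_(q | good k q) al q * G q w) ^+ 2); split => //.
rewrite e1; apply: le_trans (complexRe_le_normc _) _.
rewrite pair_big /=; apply: le_trans (normc_sum_le _ _ _) _.
have nal q : Normc.normc (al q) = Normc.normc (c ^+ k).
  by rewrite (Normc.normcM (c ^+ k)) normc_psign mulr1.
pose Sq := [set qq : (({set V} * {perm V}) * ({set V} * {perm V})) *
                     (({set V} * {perm V}) * ({set V} * {perm V})) |
       [&& pperm_pair qq.1, pperm_pair qq.2 & (#|support qq.1 :|: support qq.2| < k)%N]]%SET.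
pose B : R := n%:R ^- k * (4 * b ^+ k * b ^+ k).
have B0 : 0 <= B by rewrite /B mulr_ge0 ?invr_ge0 ?mulr_ge0 ?exprn_ge0.
apply: (@le_trans _ _ (\sum_(qq in Sq) B)).
  rewrite big_mkcond [leRHS]big_mkcond; apply: ler_sum => qq _.
  case: ifPn => [/andP[g1 g2]|_]; last by case: ifP.
  rewrite (GG g1 g2).2; case: ifPn => [_|].
    rewrite (Normc.normcM (al qq.1 * _)) (Normc.normcM (al qq.1)) normcJ_eq !nal -expr2.
    by rewrite normc_scaleX // ler_wpM2l ?invr_ge0 ?exprn_ge0 // (cov_bound g1 g2).
  rewrite inE; case/andP: (g1) => /andP[/andP[-> _] _] _.
  case/andP: (g2) => /andP[/andP[-> _] _] _ /= large.
  by rewrite (cov_eq0 g1 g2 large) mulr0 Normc.normc0.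
rewrite sumr_const -[X in X <= _]mulr_natl.
have cV : #|V| = (m * n)%N by rewrite card_ord card_prod !card_ord.
have := @card_quads V k; rewrite cV muln_gt0 m0 n0 => /(_ isT).
rewrite -(ler_nat R) => cS.
apply: le_trans (ler_wpM2r B0 cS) _; rewrite /variance_const /B.
case: k {al iF e0 E iGG i1 e1 nal Sq B B0 cS} => [|k]; first by rewrite mul0n !mul0r.
(* One factor 1/n is split off; the rest of the normalization cancels the power of n in the
   count. *)
have nE : n%:R ^- k.+1 = n%:R^-1 * n%:R ^- k :> R by rewrite exprS invfM.
rewrite nE /=; move: ((2 ^ k.+1 * _) ^ 4)%N (b ^+ k.+1) => W B.
rewrite !natrM natrX natrM exprMn.
have nk : n%:R ^+ k != 0 :> R by rewrite expf_neq0 // pnatr_eq0 -lt0n.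
rewrite le_eqVlt; apply/orP; left; apply/eqP.
move: (n%:R ^+ k : R) nk (n%:R^-1 : R) (m%:R ^+ k : R) (k.+1%:R : R) (W%:R : R) => x1 nk x2 x3 x4 x5.
by field.
Qed.

Lemma sum_conv_coef w (z : R[i]) :
  \sum_(k < (#|V|).*2.+1) z ^+ k * conv_coef w k =
  (\sum_(i < (#|V|).+1) (z * c) ^+ i * esum (Y w) i) *
  (\sum_(i < (#|V|).+1) (z * c) ^+ i * psum (Y w) i).
Proof.
rewrite (cauchy_product (x := fun i => (z * c) ^+ i * esum (Y w) i)
  (y := fun i => (z * c) ^+ i * psum (Y w) i)); last 2 first.
- by move=> i iV; have [-> _] := esum_gt0 (Y w) iV; rewrite mulr0.
- by move=> i iV; have [_ ->] := esum_gt0 (Y w) iV; rewrite mulr0.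
apply: eq_bigr => k _; rewrite /conv_coef mulrA big_distrr /=; apply: eq_bigr => i _.
rewrite [RHS]mulrACA -exprD subnKC; last by rewrite -ltnS.
by rewrite exprMn.
Qed.

(** Orthogonality leaves only the pairs with equal components. Each contributes its sign times a
    power of [(z * c) ^+ 2 * ka], and the sum is again a determinantal expansion, now with all
    entries equal to 1. *)
Lemma mean_conv_coef (z : R[i]) :
  \sum_(k < (#|V|).*2.+1) z ^+ k * cexpectation P (conv_coef ^~ k) =
  \det (1%:M - ((z * c) ^+ 2 * cexpectation mu (fun x => phi x * phi x)) *:
     block_cyclic (fun _ : 'I_m => (const_mx 1 : 'M[R[i]]_n))).
Proof.
set ka := cexpectation mu _; set y := (z * c).
have iphi2 : cintegrable mu (fun x => phi x * phi x).
  apply: (cintegrable_dom (cmeasurableM mphi mphi) (integrable_cst mu (b * b))) => x.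
  by rewrite Normc.normcM ler_pM ?normc_ge0.
have [_ <-] := @cexpectation_sum _ T R P _ (index_enum _) predT (fun k : 'I_(#|V|).*2.+1 => z ^+ k)
  (fun k w => conv_coef w k) (fun k _ => cintegrable_conv_coef k).
pose ok p := perm_on p.1 p.2 && @allowed m n p.
have full (w : T) (s : {set V} * {perm V} -> R[i]) :
    \sum_(p | perm_on p.1 p.2) y ^+ #|p.1| * (s p * pmono (Y w) p) =
    \sum_(p | ok p) y ^+ #|p.1| * s p * pmono (Y w) p.
  rewrite (bigID (fun p => @allowed m n p)) /= [X in _ + X]big1 ?addr0; last first.
    by move=> p /andP[_ ap]; rewrite /Y /entries pmono_not_allowed // !mulr0.
  by apply: eq_bigr => p _; rewrite mulrA.
have PQ w : \sum_(k < (#|V|).*2.+1) z ^+ k * conv_coef w k =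
    \sum_(pp | ok pp.1 && ok pp.2)
      (y ^+ #|pp.1.1| * psign R[i] pp.1 * (y ^+ #|pp.2.1| * 1)) *
      (pmono (Y w) pp.1 * pmono (Y w) pp.2).
  rewrite sum_conv_coef -/y /esum /psum !(sum_pperm_sizes y _ erefl) full.
  under [X in _ * X]eq_bigr do rewrite -[pmono _ _]mul1r.
  rewrite (full w (fun=> 1)) big_distrlr pair_big /=; apply: eq_bigr => pp _.
  by rewrite mulrACA.
have pm p p' : ok p -> ok p' ->
    cintegrable P (fun w => pmono (Y w) p * pmono (Y w) p') /\
    cexpectation P (fun w => pmono (Y w) p * pmono (Y w) p') =
    if p == p' then ka ^+ #|p.1| else 0.
  by move=> /andP[h1 h2] /andP[h3 h4]; exact: pair_moment.
have ipm pp : ok pp.1 && ok pp.2 -> cintegrable P (fun w => pmono (Y w) pp.1 * pmono (Y w) pp.2).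
  by move=> /andP[h1 h2]; case: (pm _ _ h1 h2).
under [X in cexpectation _ X]eq_fun do rewrite PQ.
have [_ ->] := cexpectation_sum (index_enum _) (fun pp : ({set V} * {perm V}) * ({set V} * {perm V}) =>
  y ^+ #|pp.1.1| * psign R[i] pp.1 * (y ^+ #|pp.2.1| * 1)) ipm.
rewrite -(pair_big ok ok (fun p p' => y ^+ #|p.1| * psign R[i] p * (y ^+ #|p'.1| * 1) *
  cexpectation P (fun w => pmono (Y w) p * pmono (Y w) p'))) /=.
have cI : #|V| = #|{: VT}| by rewrite card_ord.
rewrite det_sub_scale /esum (sum_pperm_sizes _ _ cI).
rewrite [RHS](bigID (fun p => @allowed m n p)) /= [X in _ = _ + X]big1 ?addr0; last first.
  move=> p /andP[_ ap].
  have -> : block_cyclic (fun _ : 'I_m => (const_mx 1 : 'M[R[i]]_n)) = entry_matrix (fun=> 1).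
    by apply/matrixP => u u'; rewrite !mxE; case: ifP => // _; rewrite !mxE.
  by rewrite pmono_not_allowed // !mulr0.
apply: eq_bigr => p okp.
rewrite (bigD1 p) //= big1 ?addr0 => [|p' /andP[okp' pp]]; last first.
  by rewrite (pm _ _ okp okp').2 eq_sym (negbTE pp) mulr0.
have -> : block_cyclic (fun _ : 'I_m => (const_mx 1 : 'M[R[i]]_n)) = entry_matrix (fun=> 1).
  by apply/matrixP => u u'; rewrite !mxE; case: ifP => // _; rewrite !mxE.
case/andP: (okp) => _ ap; rewrite (pm _ _ okp okp).2 eqxx pmono_entries //.
rewrite [\prod_t _]big1 => [|t _]; last by case: ifP.
have e2 (x : R[i]) k : (x ^+ 2 * ka) ^+ k = x ^+ k * x ^+ k * ka ^+ k.
  by rewrite exprMn exprAC expr2.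
have e3 (x x' x'' : R[i]) : x * x' * x * x'' = x * x * x'' * x' by ring.
by rewrite !mulr1 e2 e3.
Qed.

End Variance.

(** * Errors forced by a large eigenvalue *)

Section BadEvent.
Context d (T : measurableType d) (R : realType) (P : probability T R) (m n : nat).
Let VT : finType := ('I_m * 'I_n)%type.
Let V : finType := 'I_#|{: VT}|.
Let I : finType := ('I_m * 'I_n * 'I_n)%type.
Variables (a : I -> {RV P >-> R[i]}) (mu : probability R[i] R).
Hypothesis indep : mutually_independent a.
Hypothesis law : forall t, has_law (a t) mu.
Hypothesis mean0 : cexpectation mu id = 0.
Hypothesis sqr_int : mu.-integrable setT (EFin \o (fun z => Normc.normc z ^+ 2)).
Hypothesis sqr1 : \int[mu]_z (Normc.normc z ^+ 2) = 1.
Hypothesis n0 : (0 < n)%N.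
Hypothesis m0 : (0 < m)%N.
Variable M : R.
Hypothesis M0 : 0 <= M.
Variable r : R.
Hypothesis r0 : 0 <= r.
Hypothesis r1 : r < 1.

Let phi := centered_truncation mu M.
Let v := truncated_moment mu M.
Let b : R := 2 * (1 + M).
Let c : R[i] := scale R n.
Let mphi : cmeasurable phi. Proof. exact: cmeasurable_centered_truncation. Qed.
Let b0 : 0 <= b. Proof. by rewrite /b mulr_ge0 // addr_ge0. Qed.
Let phib z : Normc.normc (phi z) <= b. Proof. exact: normc_centered_truncation. Qed.
Let phi0 : cexpectation mu phi = 0. Proof. exact: cexpectation_centered_truncation. Qed.
Let v0 : 0 <= v. Proof. exact: truncated_moment_ge0. Qed.
Let v1 : v <= 1. Proof. by apply: truncated_moment_le1. Qed.

Let cv w k := conv_coef a phi w k.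
Let dk k := cexpectation P (cv ^~ k).
Let eX w i := c ^+ i * (esum (entries a id w) i - esum (entries a phi w) i).
Let pY w j := c ^+ j * psum (entries a phi w) j.
Let eY w j := c ^+ j * esum (entries a phi w) j.
(** The error in degree k: the fluctuation of the truncated coefficient, plus the effect of
    truncating the determinantal factor alone. *)
Let S w k : R := Normc.normc (cv w k - dk k) +
  \sum_(i < k.+1) Normc.normc (eX w i) * Normc.normc (pY w (k - i)%N).

Definition det_bound : R := (1 - r) ^+ m / (m`!%:R * m%:R ^+ m).

Lemma det_bound_gt0 : 0 < det_bound.
Proof.
by rewrite divr_gt0 ?exprn_gt0 ?subr_gt0 // mulr_gt0 ?exprn_gt0 ?ltr0n ?fact_gt0.
Qed.

Let c2n : c ^+ 2 * n%:R = 1.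
Proof.
rewrite /c /scale -rmorphXn -(rmorph_nat (real_complex R)) -rmorphM exprVn sqr_sqrtr //.
by rewrite mulVf ?rmorph1 // pnatr_eq0 -lt0n.
Qed.

Let det_lower (z : R[i]) : Normc.normc z <= r ->
  det_bound <= Normc.normc (\sum_(k < (#|V|).*2.+1) z ^+ k * dk k).
Proof.
move=> zr; rewrite /dk /cv (mean_conv_coef indep law mphi b0 phib phi0).
rewrite det_block_cyclic_ones; set ka := cexpectation mu _; set t := _ * n%:R.
have kaE : Normc.normc ka <= 1.
  rewrite /ka (_ : (fun x => _) = (fun x => phi x ^+ 2)); last first.
    by apply/funext => x; rewrite expr2.
  exact: cexpectation_sqr_truncation.
(* As [c ^+ 2 * n%:R = 1], the size n disappears from the argument of the cyclic determinant. *)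
have tE : t = z ^+ 2 * ka.
  rewrite /t exprMn -/c; have -> : z ^+ 2 * c ^+ 2 * ka * n%:R = z ^+ 2 * ka * (c ^+ 2 * n%:R) by ring.
  by rewrite c2n mulr1.
have tr : `|t| <= r%:C.
  have -> : `|t| = (Normc.normc t)%:C by case: (t).
  rewrite lecR tE Normc.normcM normcX expr2 -mulrA; apply: (le_trans _ zr).
  apply: ler_piMr (normc_ge0 _) _; apply: mulr_ile1; rewrite ?normc_ge0 //.
  exact: le_trans zr (ltW r1).
have r1C : r%:C <= 1 :> R[i] by rewrite -(rmorph1 (real_complex R)) lecR ltW.
have := det_cyclic_ge m0 tr r1C.
set D := \det _.
have -> : `|D| = (Normc.normc D)%:C by case: (D).
rewrite -(rmorph1 (real_complex R)) -rmorphB -rmorphXn.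
rewrite -!(rmorph_nat (real_complex R)) -[(m%:R)%:C ^+ m]rmorphXn -!rmorphM lecR.
by rewrite /det_bound ler_pdivrMr // mulr_gt0 ?exprn_gt0 ?ltr0n ?fact_gt0.
Qed.

(** P vanishes at this point, so (P - P') Q' = - P' Q', with primes for truncated entries. The mean
    of P' Q' then equals its deviation from P' Q' minus (P - P') Q', and [S] bounds both terms
    degree by degree. *)
Lemma eigenvalue_sum_lower w (z l : R[i]) :
  eigenvalue (\prod_(k < m) (\matrix_(i, j) a (k, i, j) w) : 'M[R[i]]_n) l ->
  (z * c) ^+ m * l = 1 -> Normc.normc z <= r ->
  det_bound <= \sum_(k < (#|V|).*2.+1) r ^+ k * S w k.
Proof.
move=> eig zl zr; have := det_block_cyclic_eq0 m0 eig zl.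
have -> : block_cyclic (fun k => \matrix_(i, j) a (k, i, j) w) = entries a id w by [].
rewrite det_sub_scale => PX0.
have cV : #|V| = #|{: VT}| by rewrite card_ord.
have {}PX0 : \sum_(i < (#|V|).+1) (z * c) ^+ i * esum (entries a id w) i = 0.
  by rewrite cV; exact: PX0.
have main : \sum_(k < (#|V|).*2.+1) z ^+ k * dk k =
    \sum_(k < (#|V|).*2.+1) z ^+ k *
      ((dk k - cv w k) - \sum_(i < k.+1) eX w i * pY w (k - i)%N).
  rewrite [RHS](eq_bigr (fun k : 'I_ _ => (z ^+ k * dk k - z ^+ k * cv w k) -
     z ^+ k * \sum_(i < k.+1) eX w i * pY w (k - i)%N)); last first.
    by move=> k _; rewrite !mulrBr.
  rewrite !sumrB -addrA -opprD [X in _ - X](_ : _ = 0) ?subr0 //.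
  have -> : \sum_(k < (#|V|).*2.+1) z ^+ k * (\sum_(i < k.+1) eX w i * pY w (k - i)%N) =
     (\sum_(i < (#|V|).+1) z ^+ i * eX w i) * (\sum_(i < (#|V|).+1) z ^+ i * pY w i).
    rewrite (cauchy_product (x := fun i => z ^+ i * eX w i) (y := fun i => z ^+ i * pY w i)).
    - apply: eq_bigr => k _; rewrite big_distrr /=; apply: eq_bigr => i _.
      by rewrite [RHS]mulrACA -exprD subnKC // -ltnS.
    - move=> i iV; have [h1 _] := esum_gt0 (entries a id w) iV.
      by have [h2 _] := esum_gt0 (entries a phi w) iV; rewrite /eX h1 h2 subrr !mulr0.
    - by move=> i iV; have [_ h] := esum_gt0 (entries a phi w) iV; rewrite /pY h !mulr0.
  rewrite /cv sum_conv_coef.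
  have -> : \sum_(i < (#|V|).+1) z ^+ i * pY w i =
      \sum_(i < (#|V|).+1) (z * scale R n) ^+ i * psum (entries a phi w) i.
    by apply: eq_bigr => i _; rewrite /pY exprMn mulrA.
  rewrite -mulrDl -big_split /=.
  rewrite [X in X * _](_ : _ = 0) ?mul0r // -[RHS]PX0; apply: eq_bigr => i _.
  by rewrite /eX mulrA -exprMn -mulrDr addrC subrK.
apply: le_trans (det_lower zr) _; rewrite main.
apply: le_trans (normc_sum_le _ _ _) _; apply: ler_sum => k _.
rewrite Normc.normcM normcX; apply: ler_pM; rewrite ?exprn_ge0 ?normc_ge0 //.
  by rewrite lerXn2r ?nnegrE ?normc_ge0.
apply: le_trans (le_normcD _ _) _; rewrite normcN normcB_sym lerD2l.
apply: le_trans (normc_sum_le _ _ _) _; apply: ler_sum => i _.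
by rewrite Normc.normcM.
Qed.

Let W k : R := k.+1%:R ^+ m.

Let W_ge0 k : 0 <= W k. Proof. by rewrite exprn_ge0. Qed.

Let W_mono i k : (i <= k)%N -> W i <= W k.
Proof. by move=> ik; rewrite lerXn2r ?nnegrE // ler_nat. Qed.

Let prod_bound t i j : 0 < t ->
  uexp_le P (fun w => Normc.normc (eX w i) * Normc.normc (pY w j))
    (t^-1 * (W i * (2 * (1 - v ^+ i))) + t * W j).
Proof.
move=> t0; have h1 := sqr_esumB indep law mean0 sqr_int sqr1 n0 M0 i.
have h2 := sqr_psum indep law sqr_int sqr1 n0 M0 j.
have ti : 0 < t^-1 by rewrite invr_gt0.
by have := uexp_leM ti h1 h2; rewrite invrK.
Qed.

Let var K := \sum_(k < K.+1) variance_const m b k.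

Let var_ge K k : (k <= K)%N -> variance_const m b k <= var K.
Proof.
move=> kK; have kK' : (k < K.+1)%N by [].
rewrite /var (bigD1 (Ordinal kK')) //= lerDl sumr_ge0 // => i _.
by rewrite /variance_const !mulr_ge0 ?exprn_ge0.
Qed.

Lemma small_coef_bound t K k : 0 < t -> (k <= K)%N ->
  uexp_le P (S ^~ k) (t^-1 * (var K / n%:R) + t +
    K.+1%:R * (W K * (t^-1 * (2 * (K%:R * (1 - v))) + t))).
Proof.
move=> t0 kK; have ti : 0 < t^-1 by rewrite invr_gt0.
have nv : (n%:R : R)^-1 >= 0 by rewrite invr_ge0.
apply: uexp_leD.
  have h1 := variance_conv_coef indep law mphi b0 phib phi0 n0 m0 k.
  (* Taking the constant 1 as second factor, [uexp_leM] bounds a first moment by a second one. *)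
  have h2 : uexp_le P (fun=> 1 ^+ 2) 1 by rewrite expr1n; exact: uexp_le_cst.
  have := uexp_leM ti h1 h2; rewrite invrK mulr1.
  apply: uexp_leS => [w|]; first by rewrite mulr1.
  by rewrite lerD2r ler_wpM2l ?(ltW ti) // ler_wpM2r // var_ge.
(* Bernoulli's inequality: the single small number [1 - v] controls all degrees up to [K]. *)
have bern i : (i <= K)%N -> 1 - v ^+ i <= K%:R * (1 - v).
  move=> iK; apply: (@le_trans _ _ (i%:R * (1 - v))); last first.
    by rewrite ler_wpM2r ?subr_ge0 // ler_nat.
  elim: i {iK} => [|i IH]; first by rewrite expr0 subrr mul0r.
  have vi : v ^+ i <= 1 by apply: exprn_ile1.
  have vi0 : 0 <= v ^+ i by apply: exprn_ge0.
  rewrite exprS -natr1 mulrDl mul1r.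
  have -> : 1 - v * v ^+ i = (1 - v ^+ i) + v ^+ i * (1 - v) by ring.
  by apply: lerD => //; apply: ler_piMl => //; rewrite subr_ge0.
have H := @uexp_le_sum _ T R P _ (index_enum _) predT
  (fun (i : 'I_k.+1) w => Normc.normc (eX w i) * Normc.normc (pY w (k - i)%N)) _
  (fun i _ => prod_bound i (k - i)%N t0).
apply: uexp_leS H => //.
apply: (@le_trans _ _ (\sum_(i < k.+1) W K * (t^-1 * (2 * (K%:R * (1 - v))) + t))).
  apply: ler_sum => i _; have iK : (i <= K)%N by rewrite (leq_trans _ kK) // -ltnS.
  rewrite [leRHS]mulrDr; apply: lerD.
    rewrite [leLHS]mulrCA; apply: ler_pM => //; last first.
    - by rewrite ler_wpM2l ?(ltW ti) // ler_wpM2l // bern.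
    - exact: W_mono.
    by rewrite !mulr_ge0 ?(ltW ti) // subr_ge0 exprn_ile1.
  by rewrite [leLHS]mulrC ler_wpM2r ?(ltW t0) // W_mono // (leq_trans (leq_subr _ _)).
rewrite sumr_const card_ord -[X in X <= _]mulr_natl ler_wpM2r ?ler_nat //.
by rewrite mulr_ge0 // addr_ge0 ?(ltW t0) // !mulr_ge0 ?(ltW ti) ?subr_ge0.
Qed.

(** The constant is 2 for the coefficient, 2 for its mean and 3 for the truncation error. Neither n
    nor [M] enters, so the tail can be cut before either is chosen. *)
Lemma coef_bound k : uexp_le P (S ^~ k) (7 * k.+1%:R ^+ m.+1).
Proof.
have Wk : k.+1%:R * W k = k.+1%:R ^+ m.+1 by rewrite exprS.
have cvb w : Normc.normc (cv w k) <=
    \sum_(i < k.+1) Normc.normc (eY w i) * Normc.normc (pY w (k - i)%N).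
  have -> : cv w k = \sum_(i < k.+1) eY w i * pY w (k - i)%N.
    rewrite /cv /conv_coef big_distrr /=; apply: eq_bigr => i _.
    by rewrite /eY /pY [RHS]mulrACA -exprD subnKC // -ltnS.
  apply: le_trans (normc_sum_le _ _ _) _; apply: ler_sum => i _.
  by rewrite Normc.normcM.
have sum_le (B : nat -> nat -> R) (x : R) : (forall i, (i < k.+1)%N -> B i (k - i)%N <= x) ->
    \sum_(i < k.+1) B i (k - i)%N <= k.+1%:R * x.
  move=> Bx; apply: (@le_trans _ _ (\sum_(i < k.+1) x)); first by apply: ler_sum => i _; exact: Bx.
  by rewrite sumr_const card_ord mulr_natl.
have h1 : uexp_le P (fun w => Normc.normc (cv w k)) (2 * k.+1%:R ^+ m.+1).
  have H := @uexp_le_sum _ T R P _ (index_enum _) predT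
    (fun (i : 'I_k.+1) w => Normc.normc (eY w i) * Normc.normc (pY w (k - i)%N)) _
    (fun i _ => uexp_leM ltr01 (sqr_esum indep law sqr_int sqr1 n0 M0 i)
       (sqr_psum indep law sqr_int sqr1 n0 M0 (k - i)%N)).
  apply: uexp_leS H => //; rewrite -Wk mulrCA.
  apply: (sum_le (fun i j => 1 * i.+1%:R ^+ m + 1^-1 * j.+1%:R ^+ m)) => i ik.
  rewrite invr1 !mul1r mulr2n mulrDl mul1r lerD ?W_mono // ?leq_subr //.
have dkb : Normc.normc (dk k) <= 2 * k.+1%:R ^+ m.+1.
  have [g [ig cg gb]] := h1; apply: le_trans gb; apply: normc_cexpectation => //.
  exact: (cintegrable_conv_coef indep law mphi b0 phib).
have h3 : uexp_le P (fun w => \sum_(i < k.+1) Normc.normc (eX w i) * Normc.normc (pY w (k - i)%N))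
    (3 * k.+1%:R ^+ m.+1).
  have H := @uexp_le_sum _ T R P _ (index_enum _) predT
    (fun (i : 'I_k.+1) w => Normc.normc (eX w i) * Normc.normc (pY w (k - i)%N)) _
    (fun i _ => prod_bound i (k - i)%N ltr01).
  apply: uexp_leS H => //; rewrite -Wk mulrCA.
  apply: (sum_le (fun i j => 1^-1 * (W i * (2 * (1 - v ^+ i))) + 1 * W j)) => i ik.
  have vi0 : 0 <= v ^+ i by apply: exprn_ge0.
  have ik' : (i <= k)%N by [].
  have h := W_mono ik'; have h' := W_mono (leq_subr i k); have hi := W_ge0 i.
  rewrite invr1 !mul1r.
  have : W i * (2 * (1 - v ^+ i)) <= W i * 2.
    by apply: ler_wpM2l => //; apply: ler_piMr => //; rewrite lerBlDr lerDl.
  by lra.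
have h2 := uexp_le_cst P (2 * k.+1%:R ^+ m.+1).
have := uexp_leD (uexp_leD h1 h2) h3; apply: uexp_leS => [w|]; last by lra.
rewrite /S lerD2r; apply: le_trans (le_normcD _ _) _.
by rewrite normcN lerD2l.
Qed.

(* The tail [k > K] is controlled by a geometric series once
   [(k+1)^(m+1) r^k <= C x^k], uniformly in [n] and [M]. *)
Lemma bad_event_bound (C x t : R) K (A : set T) : 0 < t -> 0 <= C -> 0 <= x -> x < 1 ->
  (forall k, k.+1%:R ^+ m.+1 * r ^+ k <= C * x ^+ k) ->
  measurable A ->
  (forall w, A w -> exists z l, [/\
     eigenvalue (\prod_(k < m) (\matrix_(i, j) a (k, i, j) w) : 'M[R[i]]_n) l,
     (z * c) ^+ m * l = 1 & Normc.normc z <= r]) ->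
  (P A <= (det_bound^-1 * (K.+1%:R * (t^-1 * (var K / n%:R) + t +
    K.+1%:R * (W K * (t^-1 * (2 * (K%:R * (1 - v))) + t))) +
    7 * C * x ^+ K / (1 - x)))%:E)%E.
Proof.
move=> t0 C0 x0 x1 geo mA HA.
set A0 := t^-1 * _ + t + _.
have db := det_bound_gt0.
have S0 w k : 0 <= S w k.
  by rewrite addr_ge0 ?normc_ge0 // sumr_ge0 // => i _; rewrite mulr_ge0 ?normc_ge0.
have ti : 0 < t^-1 by rewrite invr_gt0.
have A00 : 0 <= A0.
  have nv : (n%:R : R)^-1 >= 0 by rewrite invr_ge0.
  rewrite /A0 !addr_ge0 ?(ltW t0) // ?mulr_ge0 ?(ltW ti) // ?addr_ge0 ?(ltW t0) //.
    apply: sumr_ge0 => i _; by rewrite /variance_const !mulr_ge0 ?exprn_ge0.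
  by rewrite !mulr_ge0 ?(ltW ti) ?subr_ge0.
apply: (@uexp_markov _ _ _ _ (fun w => det_bound^-1 * \sum_(k < (#|V|).*2.+1) r ^+ k * S w k)) => //.
- move=> w; rewrite mulr_ge0 ?invr_ge0 ?(ltW db) // sumr_ge0 // => k _.
  by rewrite mulr_ge0 ?exprn_ge0.
- move=> w /HA[z [l [h1 h2 h3]]]; rewrite mulrC ler_pdivlMr // mul1r.
  exact: eigenvalue_sum_lower h1 h2 h3.
apply: uexp_leZ; first by rewrite invr_ge0 ltW.
(* The fine bound serves up to [K]; beyond, the polynomial one is left to the decay of [r ^+ k]. *)
pose beta k : R := if (k <= K)%N then A0 else 7 * k.+1%:R ^+ m.+1.
have Sb k : uexp_le P (S ^~ k) (beta k).
  by rewrite /beta; case: ifP => kK; [exact: small_coef_bound|exact: coef_bound].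
have H := @uexp_le_sum _ T R P _ (index_enum _) predT
  (fun (k : 'I_(#|V|).*2.+1) w => r ^+ k * S w k) _
  (fun k _ => uexp_leZ (exprn_ge0 k r0) (Sb k)).
apply: uexp_leS H => //.
have step N : \sum_(k < N) r ^+ k * beta k <=
    (minn N K.+1)%:R * A0 + 7 * C * \sum_(K.+1 <= k < N) x ^+ k.
  elim: N => [|N IH].
    by rewrite big_ord0 min0n mul0r big_geq // mulr0 addr0.
  rewrite big_ord_recr /=; have [NK|KN] := leqP N K.
    rewrite (minn_idPl _) // big_geq // mulr0 addr0 -natr1 mulrDl mul1r.
    move: IH; rewrite (minn_idPl (leqW NK)) big_geq ?leqW // mulr0 addr0 => IH.
    apply: lerD => //; rewrite /beta NK; apply: ler_piMl => //.
    by apply: exprn_ile1 => //; exact: ltW.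
  rewrite (minn_idPr (ltnW _)) // big_nat_recr //= [7 * C * (_ + _)]mulrDr addrA.
  move: IH; rewrite (minn_idPr KN) => IH; apply: lerD => //.
  rewrite /beta leqNgt KN /= mulrCA -mulrA ler_wpM2l // mulrC; exact: geo.
apply: le_trans (step _) _; apply: lerD.
  by rewrite ler_wpM2r // ler_nat geq_minr.
rewrite -[leRHS]mulrA; apply: ler_wpM2l; first by rewrite mulr_ge0.
have xs N : (1 - x) * \sum_(K.+1 <= k < N) x ^+ k <= x ^+ K.
  elim: N => [|N IH]; first by rewrite big_geq // mulr0 exprn_ge0.
  have [NK|KN] := leqP N K; first by rewrite big_geq // mulr0 exprn_ge0.
  have E : forall N', (K.+1 <= N')%N -> (1 - x) * \sum_(K.+1 <= k < N') x ^+ k = x ^+ K.+1 - x ^+ N'.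
    elim=> [|N' IH']; first by [].
    rewrite leq_eqVlt => /orP[/eqP <-|KN']; first by rewrite big_geq // mulr0 subrr.
    rewrite big_nat_recr //= mulrDr IH' // [x ^+ N'.+1]exprS; ring.
  rewrite E ?leqW // (@le_trans _ _ (x ^+ K.+1)) ?gerBl ?exprn_ge0 //.
  by rewrite exprS ler_piMl ?exprn_ge0 ?(ltW x1).
by rewrite ler_pdivlMr ?subr_gt0 // mulrC; exact: xs.
Qed.

End BadEvent.

(** * The limit *)

Lemma cvg_probability1 (R : realType) (d : nat -> measure_display)
    (T : forall n, measurableType (d n)) (P : forall n, probability (T n) R)
    (A : forall n, set (T n)) :
  (forall e : R, 0 < e -> exists N, forall n, (N <= n)%N ->
     measurable (A n) /\ ((1 - e)%:E <= P n (A n))%E) ->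
  P n (A n) @[n --> \oo] --> 1%E.
Proof.
move=> H; apply/fine_cvgP; split.
  have [N HN] := H 1 ltr01; exists N => // n /= /HN[mA _].
  exact: fin_num_measure.
apply/cvgrPdist_le => e e0; have [N HN] := H e e0; exists N => // n /= /HN[mA h].
have h1 := probability_le1 (P n) mA.
have hf := fin_num_measure (P n) _ mA.
rewrite -(fineK hf) lee_fin in h; rewrite -(fineK hf) lee_fin in h1.
by rewrite ger0_norm ?subr_ge0 // lerBlDr addrC -lerBlDr.
Qed.

Lemma cmeasurable_prodmx d (T : measurableType d) (R : realType) (J : Type) (s : seq J) n
    (A : J -> T -> 'M[R[i]]_n) : (forall k i j, cmeasurable (fun w => A k w i j)) ->
  forall i j, cmeasurable (fun w => (\prod_(k <- s) A k w) i j).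
Proof.
move=> mA; elim: s => [|k s IH] i j.
  by under eq_fun do rewrite big_nil; exact: cmeasurable_cst.
under eq_fun do rewrite big_cons -mulmxE mxE.
by apply: cmeasurable_sum => l; apply: cmeasurableM.
Qed.

Lemma image_unit_disk (R : realType) (x : R) (z : R[i]) : 0 < x ->
  [set x%:C * u | u in @unit_disk R] z <-> Normc.normc z < x.
Proof.
move=> x0; split=> [[u /= u1 <-]|zx].
  by rewrite Normc.normcM normc_real gtr0_norm // gtr_pMr.
have xn : x%:C != 0 :> R[i] by rewrite -(rmorph0 (real_complex R)) (inj_eq (@complexI R)) gt_eqF.
exists (x%:C^-1 * z); last by rewrite mulrA mulfV // mul1r.
by rewrite /unit_disk /= Normc.normcM Normc.normcV normc_real gtr0_norm // mulrC ltr_pdivrMr // mul1r.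
Qed.

Lemma spectral_radius_le (R : realType) n (A : 'M[R[i]]_n) (x : R) : (0 < n)%N ->
  spectral_radius A <= x <-> forall z, eigenvalue A z -> Normc.normc z <= x.
Proof.
move=> n0; have [rs [rsE szrs _]] := char_roots A.
rewrite /spectral_radius; set E := [set _ | _ in _].
have E0 : E !=set0.
  case: rs rsE szrs => [|l rs] rsE szrs; first by move: n0; rewrite -szrs.
  by exists (Normc.normc l); exists l => //=; rewrite rsE inE eqxx.
have hub : has_ubound E.
  exists (\sum_(l <- rs) Normc.normc l) => _ [z /= zA <-]; rewrite rsE in zA.
  rewrite (perm_big _ (perm_to_rem zA)) big_cons lerDl sumr_ge0 // => l _.
  exact: normc_ge0.
split=> [h z zA|h]; last by apply: ge_sup => // _ [z zA <-]; exact: h.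
by apply: le_trans h; apply: ub_le_sup => //; exists z.
Qed.

(** The radius is written r = x^(m+2). Of the m + 2 factors [x ^+ k] in [r ^+ k], m + 1 absorb the
    polynomial and one remains for summation. The last clause allows an archimedean choice of the
    degree cutoff. *)
Lemma exists_geometric_rate (R : realType) (m : nat) (eps : R) : (0 < m)%N -> 0 < eps ->
  exists x C r : R, [/\ 0 < x < 1, 0 <= C, 0 <= r < 1, r ^+ m = (1 + eps)^-1 &
    (forall k, k.+1%:R ^+ m.+1 * r ^+ k <= C * x ^+ k) /\
    (forall k, x ^+ k <= C / k.+1%:R)].
Proof.
move=> m0 e0; have p0 : 0 < 1 + eps by rewrite addr_gt0.
pose N := (m.+2 * m)%N; pose t : R := (1 + eps) `^ N%:R^-1.
have N0 : (N%:R : R) != 0 by rewrite pnatr_eq0 -lt0n muln_gt0.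
have tN : t ^+ N = 1 + eps.
  by rewrite -powR_mulrn ?powR_ge0 // -powRrM mulVf // powRr1 // ltW.
have t0 : 0 < t by rewrite powR_gt0.
have t1 : 1 < t.
  rewrite ltNge; apply/negP => tle.
  have : t ^+ N <= 1 by apply: exprn_ile1 => //; exact: ltW.
  by rewrite tN gerDl leNgt e0.
have d0 : 0 < t - 1 by rewrite subr_gt0.
(* The value makes [C0 * (t - 1)] at least 1, the increment needed in the induction for [kC]. *)
pose C0 := 1 + (t - 1)^-1.
have C1 : 1 <= C0 by rewrite lerDl invr_ge0 ltW.
have C00 : 0 <= C0 by exact: le_trans C1.
have kC k : k.+1%:R <= C0 * t ^+ k.
  elim: k => [|k IH]; first by rewrite expr0 mulr1.
  have tk : 1 <= t ^+ k by apply: exprn_ege1; exact: ltW.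
  have -> : C0 * t ^+ k.+1 = C0 * t ^+ k + (C0 * (t - 1)) * t ^+ k by rewrite exprS; ring.
  rewrite -natr1; apply: lerD => //; apply: mulr_ege1 => //.
  by rewrite /C0 mulrDl mul1r mulVf ?gt_eqF // lerDr ltW.
have xk k : t^-1 ^+ k <= C0 / k.+1%:R.
  by rewrite exprVn ler_pdivlMr ?ltr0n // mulrC ler_pdivrMr ?exprn_gt0.
exists t^-1, (C0 ^+ m.+1), (t^-1 ^+ m.+2).
have x0 : 0 < t^-1 by rewrite invr_gt0.
have x1 : t^-1 < 1 by rewrite invf_lt1.
split; first by rewrite x0.
- exact: exprn_ge0.
- by rewrite exprn_ge0 ?(ltW x0) //= exprn_ilt1 // ltW.
- by rewrite -exprM exprVn tN.
split=> k; last first.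
  apply: le_trans (xk k) _; rewrite ler_wpM2r ?invr_ge0 // exprS ler_peMr //.
  exact: exprn_ege1.
have -> : C0 ^+ m.+1 * t^-1 ^+ k = (C0 * t ^+ k) ^+ m.+1 * (t^-1 ^+ m.+2) ^+ k.
  rewrite exprMn -mulrA; congr (_ * _).
  rewrite [(t^-1 ^+ m.+2) ^+ k]exprAC [(t^-1 ^+ k) ^+ m.+2]exprS mulrCA -exprMn.
  by rewrite -exprMn mulfV ?gt_eqF // !expr1n mulr1.
rewrite ler_wpM2r ?exprn_ge0 ?(ltW x0) // lerXn2r ?nnegrE //.
  by rewrite mulr_ge0 // exprn_ge0 // ltW.
Qed.

Theorem theorem1p1 (R : realType) (m : nat) (hm : (1 <= m)%N)
  (d : nat -> measure_display) (T : forall n, measurableType (d n))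
  (P : forall n, probability (T n) R)
  (a : forall n, 'I_m -> 'I_n -> 'I_n -> {RV (P n) >-> R[i]})
  (mu : probability R[i] R)
  (law_a : forall n k i j, has_law (a n k i j) mu)
  (indep_a : forall n, mutually_independent
     (fun t : 'I_m * 'I_n * 'I_n => a n t.1.1 t.1.2 t.2))
  (mean_a : forall n k i j,
     ('E_(P n)[fun w => complex.Re (a n k i j w)] = 0)%E /\
     ('E_(P n)[fun w => complex.Im (a n k i j w)] = 0)%E)
  (second_moment_a : forall n k i j,
     ('E_(P n)[fun w => (Normc.normc (a n k i j w) ^+ 2)%R] = 1)%E)
  (eps : R) (heps : 0 < eps) :
  let M n (w : T n) : 'M[R[i]]_n :=
    scaled_product (fun k => \matrix_(i < n, j < n) a n k i j w) in
  (P n [set w | forall z, eigenvalue (M n w) z ->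
      [set (1 + eps)%:C * u | u in @unit_disk R] z] @[n --> \oo] --> 1%E) /\
  (P n [set w | spectral_radius (M n w) <= 1 + eps] @[n --> \oo] --> 1%E).
Proof.
move=> M.
have p0 : 0 < 1 + eps by rewrite addr_gt0.
(* Size 1 already has an entry, from which the moments of [mu] are read off. *)
pose X1 : {RV (P 1%N) >-> R[i]} := a 1%N (Ordinal hm) ord0 ord0.
have law1 : has_law X1 mu by exact: law_a.
have mid := cmeasurable_idfun R.
have msq := measurable_normc_sqr mid.
have sqrE : (\int[mu]_z (Normc.normc z ^+ 2)%:E = 1)%E.
  rewrite -(law_ge0_integral law1 msq); last by move=> z; exact: sqr_ge0.
  by have := second_moment_a 1%N (Ordinal hm) ord0 ord0; rewrite unlock.
have sqr_int : mu.-integrable setT (EFin \o (fun z => Normc.normc z ^+ 2)).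
  apply/integrableP; split; first exact/measurable_EFinP.
  under eq_integral do rewrite /= ger0_norm ?sqr_ge0 //.
  by rewrite sqrE ltry.
have sqr1 : \int[mu]_z (Normc.normc z ^+ 2) = 1 by rewrite /Rintegral sqrE.
have mean0 : cexpectation mu id = 0.
  have [i1 i2] := cintegrable_id sqr_int; case: mid => m1 m2.
  have [_ e1] := law_integral law1 m1 i1; have [_ e2] := law_integral law1 m2 i2.
  have [f1 f2] := mean_a 1%N (Ordinal hm) ord0 ord0; rewrite unlock in f1 f2.
  rewrite /cexpectation -e1 -e2 /Rintegral.
  by rewrite [X in fine X +i* _]f1 [X in _ +i* fine X]f2.
have mM n i j : cmeasurable (fun w => M n w i j).
  rewrite /M /scaled_product; under eq_fun do rewrite mxE.
  apply: cmeasurableM; first exact: cmeasurable_cst.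
  apply: cmeasurable_prodmx => k i' j'; under eq_fun do rewrite mxE.
  exact: cmeasurable_RV.
pose good n x := [set w : T n | forall z, eigenvalue (M n w) z -> Normc.normc z < x].
have mgood n x : measurable (good n x) by exact: measurable_eigenvalues_lt.
have [x [C [r [/andP[x0 x1] C0 /andP[r0 r1] rm [geo xC]]]]] := exists_geometric_rate hm heps.
have main (e : R) : 0 < e -> exists N, forall n, (N <= n)%N ->
    (0 < n)%N /\ ((1 - e)%:E <= P n (good n (1 + eps)%R))%E.
  move=> e0; have db := det_bound_gt0 hm r1; set D := det_bound m r in db.
  (* Four errors share [e * D]: the tail of high degrees, the fluctuation, the truncation and the
     weight [t]. *)
  pose Q := e * D / 4.
  have Q0 : 0 < Q by have eD := mulr_gt0 e0 db; rewrite /Q; move: (e * D) eD => y; lra.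
  have y0 : 0 < 1 - x by rewrite subr_gt0.
  (* Since [x ^+ K <= C / k1], the tail is at most [B / k1]. *)
  pose B := 7 * C * C / (1 - x).
  have B0 : 0 <= B by rewrite /B divr_ge0 ?(ltW y0) // !mulr_ge0.
  pose K := Num.bound (B / Q); pose k1 : R := K.+1%:R.
  have k10 : 0 < k1 by rewrite ltr0n.
  have tailQ : 7 * C * x ^+ K / (1 - x) <= Q.
    apply: (@le_trans _ _ (B / k1)).
      have -> : B / k1 = 7 * C * (C / k1) / (1 - x) by rewrite /B; field; rewrite !gt_eqF.
      by rewrite ler_wpM2r ?invr_ge0 ?(ltW y0) // ler_wpM2l ?mulr_ge0 // xC.
    rewrite ler_pdivrMr // -ler_pdivrMl // mulrC.
    have := archi_boundP (divr_ge0 B0 (ltW Q0)); rewrite -/K => h.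
    by rewrite (le_trans (ltW h)) // ler_nat.
  pose W := k1 ^+ m.
  have W0 : 0 <= W by rewrite /W exprn_ge0 // ltW.
  pose Z := k1 * (1 + k1 * W).
  have Z0 : 0 < Z by rewrite /Z mulr_gt0 // ltr_pwDl // mulr_ge0 // ltW.
  (* The terms proportional to [t] then add up to exactly [Q]. Below, [L] and [L2] are the resulting
     coefficients of [1 - v] and of 1/n. *)
  pose t := Q / Z.
  have t0 : 0 < t by rewrite /t divr_gt0.
  have ti : 0 < t^-1 by rewrite invr_gt0.
  pose L := k1 * (k1 * W) * t^-1 * (2 * K%:R).
  have L0 : 0 <= L by rewrite /L !mulr_ge0 ?(ltW k10) ?(ltW ti).
  have L1 : 0 < 1 + L by rewrite ltr_pwDl.
  (* The level comes after [K] and [t], which determine [L], and before n, which must beat the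
     variance constants at this level. *)
  have [Mx M0 vM] := truncated_moment_cvg sqr_int sqr1 (divr_gt0 Q0 L1).
  set v := truncated_moment mu Mx in vM.
  pose S := \sum_(k < K.+1) variance_const m (2 * (1 + Mx)) k.
  have S0 : 0 <= S.
    apply: sumr_ge0 => i _; rewrite /variance_const !mulr_ge0 ?exprn_ge0 ?mulr_ge0 //;
      by rewrite addr_ge0.
  pose L2 := k1 * t^-1 * S.
  have L20 : 0 <= L2 by rewrite /L2 !mulr_ge0 ?(ltW k10) ?(ltW ti).
  exists (Num.bound (L2 / Q)).+1 => n nN.
  have n0 : (0 < n)%N by exact: leq_trans nN.
  split => //.
  pose s : R := n%:R `^ (- (m%:R / 2)).
  have nR : 0 < n%:R :> R by rewrite ltr0n.
  have s0 : 0 < s by rewrite powR_gt0.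
  have sC : s%:C != 0 :> R[i] by rewrite -(rmorph0 (real_complex R)) (inj_eq (@complexI R)) gt_eqF.
  have cs : scale R n ^+ m = s%:C.
    rewrite /scale -rmorphXn /s; congr (_%:C).
    by rewrite -powR12_sqrt ?ltW // -powRN -powR_mulrn ?powR_ge0 // -powRrM mulNr mulrC.
  have PB := bad_event_bound (indep_a n) (fun t' => law_a n t'.1.1 t'.1.2 t'.2)
    mean0 sqr_int sqr1 n0 hm M0 r0 r1 K t0 C0 (ltW x0) x1 geo (measurableC (mgood n (1 + eps))).
  have HA : forall w, (~` good n (1 + eps)) w -> exists z l, [/\
     eigenvalue (\prod_(k < m) (\matrix_(i, j) a n k i j w) : 'M[R[i]]_n) l,
     (z * scale R n) ^+ m * l = 1 & Normc.normc z <= r].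
    move=> w /existsNP[l /not_implyP[lM /negP]]; rewrite -leNgt => lge.
    have l0 : l != 0.
      by apply/eqP => l0; move: lge; rewrite l0 Normc.normc0 leNgt p0.
    (* Any m-th root of the inverse eigenvalue serves: [1 + eps <= Normc.normc l] puts it in the
       disk of radius [r]. *)
    pose z : R[i] := m.-root (l^-1).
    have zm : z ^+ m = l^-1 by rewrite /z rootCK.
    exists z, (l / s%:C); split.
    - have /eigenvalueP[u uM u0] := lM; apply/eigenvalueP; exists u => //.
      move: uM; rewrite /M /scaled_product -scalemxAr => /(congr1 (fun y => s%:C^-1 *: y)).
      by rewrite !scalerA mulVf // scale1r mulrC.
    - by rewrite exprMn zm cs; field; rewrite l0 sC.
    - rewrite -(ler_pXn2r hm) ?nnegrE ?normc_ge0 // -normcX zm rm Normc.normcV.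
      by rewrite lef_pV2 // posrE; exact: lt_le_trans lge.
  have fin := fin_num_measure (P n) _ (mgood n (1 + eps)).
  have bound : D^-1 * (k1 * (t^-1 * (S / n%:R) + t + k1 * (W * (t^-1 * (2 * (K%:R * (1 - v))) + t)))
      + 7 * C * x ^+ K / (1 - x)) <= e.
    rewrite mulrC ler_pdivrMr //.
    have -> : e * D = Q + Q + Q + Q by rewrite /Q; field.
    have -> : k1 * (t^-1 * (S / n%:R) + t + k1 * (W * (t^-1 * (2 * (K%:R * (1 - v))) + t))) =
        L2 / n%:R + L * (1 - v) + Z * t.
      by rewrite /L2 /L /Z; move: (t^-1) (n%:R^-1) => u1 u2; ring.
    rewrite lerD // lerD // ?lerD //.
    - rewrite ler_pdivrMr // mulrC -ler_pdivrMr //.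
      apply: le_trans (ltW (archi_boundP (divr_ge0 L20 (ltW Q0)))) _.
      by rewrite ler_nat ltnW.
    - apply: (@le_trans _ _ (L * (Q / (1 + L)))); first by rewrite ler_wpM2l // lerBlDr addrC -lerBlDr.
      rewrite mulrCA ler_piMr ?(ltW Q0) // ler_pdivrMr // mul1r lerDr //.
    - by rewrite /t mulrC divfK // gt_eqF.
  have : (P n (~` good n (1 + eps)%R) <= e%:E)%E.
    by apply: le_trans (PB HA) _; rewrite lee_fin; exact: bound.
  rewrite probability_setC // -(fineK fin) -EFinB !lee_fin => h.
  by rewrite lerBlDr addrC -lerBlDr.
split.
  apply: cvg_probability1 => e /main[N HN]; exists N => n /HN[n0 h].
  have -> : [set w | forall z, eigenvalue (M n w) z ->
      [set (1 + eps)%:C * u | u in @unit_disk R] z] = good n (1 + eps).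
    by apply/seteqP; split => w h' z /h' /image_unit_disk; exact.
  by split.
apply: cvg_probability1 => e /main[N HN]; exists N => n /HN[n0 h].
have mA : measurable [set w | spectral_radius (M n w) <= 1 + eps].
  (* The closed condition is a countable intersection of strict ones, whose measurability is
     known. *)
  have -> : [set w | spectral_radius (M n w) <= 1 + eps] =
      \bigcap_(j in [set: nat]) good n (1 + eps + j.+1%:R^-1).
    apply/seteqP; split => w /=.
      move=> /(spectral_radius_le _ _ n0) h' j _ z /h' zle.
      by apply: (le_lt_trans zle); rewrite ltrDl invr_gt0.
    move=> h'; apply/(spectral_radius_le _ _ n0) => z zM; rewrite leNgt; apply/negP => lt.
    have [j] := ltr_add_invr lt; rewrite ltNge; apply/negP; rewrite negbK.
    by apply: ltW; exact: h' j Logic.I z zM.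
  exact: bigcapT_measurable.
split => //; apply: (le_trans h); apply: le_measure; rewrite ?inE //.
by move=> w h' /=; apply/(spectral_radius_le _ _ n0) => z /h' /ltW.
Qed.
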